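(* There exists an absolute constant $C>0$ such that the following holds. Let $X$ be a complex Banach space and let $F=(F_k)$ be any $X$-valued Hardy martingale. Then there exist $X$-valued Hardy martingales $G=(G_k)$ and $B=(B_k)$ with $F_k=G_k+B_k$ for all $k$, such that for every $k\ge 1$, pointwise almost surely, $$\|\Delta G_k\|_X\le C\,\|F_{k-1}\|_X ,$$ and $$\mathbb{E}\Big(\sum_{k=1}^\infty\|\Delta B_k\|_X\Big)\le C\,\mathbb{E}(\|F\|_X),$$ where $\mathbb{E}(\|F\|_X)=\sup_k\mathbb{E}(\|F_k\|_X)$.
   Context: $\mathbb{T}=\{e^{i\theta}:\theta\in[0,2\pi)\}$ carries normalized angular (Haar) measure $m$, and $\mathbb{T}^{\mathbb{N}}$ is the countable torus product with its normalized Haar measure $\mathbb{P}$; $\mathbb{E}$ is integration against $\mathbb{P}$. $\mathcal{F}_n$ is the $\sigma$-algebra on $\mathbb{T}^{\mathbb{N}}$ generated by the first $n$ coordinates, and $\mathcal{F}_0$ is the trivial $\sigma$-algebra. For a complex Banach space $X$, $L^1_0(\mathbb{T},X)$ is the space of Bochner integrable functions $\mathbb{T}\to X$ with vanishing mean, and $H^1_0(\mathbb{T},X)\subset L^1_0(\mathbb{T},X)$ consists of those functions whose harmonic extension to the unit disk is analytic. An $X$-valued Hardy martingale is a sequence $F=(F_k)$ in $L^1(\mathbb{T}^{\mathbb{N}},X)$ which is an $(\mathcal{F}_k)$-martingale and such that, for each $k\ge1$ and almost every fixed $x\in\mathbb{T}^{k-1}$ (values of the first $k-1$ coordinates), the martingale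 difference $\Delta F_k=F_k-F_{k-1}$, as a function $y\mapsto\Delta F_k(x,y)$ of the $k$-th coordinate $y\in\mathbb{T}$, belongs to $H^1_0(\mathbb{T},X)$. Here $F_0=\mathbb{E}(F_1)$ is constant. *)

(* Defs.v *)
From HB Require Import structures.
From mathcomp Require Import all_boot all_order all_algebra.
From mathcomp Require Import all_classical all_reals all_analysis.
From mathcomp Require Import measurable_realfun complex.

Set Implicit Arguments.
Unset Strict Implicit.
Unset Printing Implicit Defensive.

Import Order.TTheory GRing.Theory Num.Theory.
Import numFieldNormedType.Exports.

Local Open Scope classical_set_scope.
Local Open Scope complex_scope.
Local Open Scope ring_scope.

(* The norm of a normed module over R[i] takes its values in R[i]. *)
Definition rnorm (R : realType) (X : normedModType R[i]) (x : X) : R :=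
  complex.Re `|x|.

Section Bochner.
Context (R : realType) (X : normedModType R[i]) (d : measure_display)
  (T : measurableType d).

Definition simple_for (S : set (set T)) (s : T -> X) :=
  finite_set (range s) /\ forall v, S (s @^-1` [set v]).

Definition strongly_measurable (S : set (set T)) (f : T -> X) :=
  exists s : nat -> T -> X,
    (forall n, simple_for S (s n)) /\ forall w, s n w @[n --> \oo] --> f w.

Definition ae_strongly_measurable (P : probability T R) (f : T -> X) :=
  exists s : nat -> T -> X,
    (forall n, simple_for measurable (s n)) /\
    {ae P, forall w, s n w @[n --> \oo] --> f w}.

Definition simple_integral (P : probability T R) (s : T -> X) : X :=
  \sum_(v \in range s) (fine (P (s @^-1` [set v])))%:C *: v.

Definition L1_approx (P : probability T R) (f : T -> X) (s : nat -> T -> X) :=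
  (forall n, simple_for measurable (s n)) /\
  (\int[P]_w (rnorm (f w - s n w))%:E)%E @[n --> \oo] --> (0 : \bar R)%E.

Definition bochner_integrable (P : probability T R) (f : T -> X) :=
  ae_strongly_measurable P f /\ exists s, L1_approx P f s.

(* The limit does not depend on the approximating sequence when [f] is Bochner
   integrable and [X] is complete. *)
Definition bochner_integral (P : probability T R) (f : T -> X) : X :=
  xget 0 [set v | exists2 s, L1_approx P f s &
                  simple_integral P (s n) @[n --> \oo] --> v].

End Bochner.

Section Circle.
Context (R : realType).

Definition circle : Type := {z : R[i] | `|z| == 1}.

HB.instance Definition _ := Choice.on circle.

Lemma expi_subproof (t : R) : `|(cos t +i* sin t)%C| == 1 :> R[i].
Proof. by rewrite normc_def /= cos2Dsin2 sqrtr1. Qed.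

Definition expi : measurableTypeR R -> circle :=
  fun t => @exist R[i] _ _ (expi_subproof t).

HB.instance Definition _ := isPointed.Build circle (expi 0).

Definition circle_coord (z : circle) : R * R :=
  (complex.Re (val z), complex.Im (val z)).

HB.instance Definition _ :=
  Measurable.copy circle (g_sigma_algebra_preimageType circle_coord).

Lemma measurable_expi :
  @measurable_fun _ _ (measurableTypeR R) circle setT expi.
Proof.
move=> _ _ [B mB <-]; rewrite !setTI.
have -> : expi @^-1` (circle_coord @^-1` B) =
    setT `&` (fun t : R => (cos t, sin t)) @^-1` B by rewrite setTI.
by apply: measurable_fun_pair => //; apply: continuous_measurable_fun;
  [exact: continuous_cos | exact: continuous_sin].
Qed.

HB.instance Definition _ := isMeasurableFun.Build _ _
  (measurableTypeR R) circle expi measurable_expi.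

Lemma twopi_gt0 : 0 < 2 * pi :> R.
Proof. by rewrite mulr_gt0 // pi_gt0. Qed.

Definition circle_haar : probability circle R :=
  distribution (uniform_prob twopi_gt0) expi.

End Circle.

Section HardySpace.
Context (R : realType) (X : completeNormedModType R[i]).

Definition poisson_kernel (z : R[i]) (y : circle R) : R[i] :=
  (1 - `|z| ^+ 2) / `|val y - z| ^+ 2.

Definition harmonic_extension (f : circle R -> X) (z : R[i]) : X :=
  bochner_integral (@circle_haar R) (fun y => poisson_kernel z y *: f y).

(* [R[i]] being the field of scalars, [derivable] is complex
   differentiability. *)
Definition analytic_on_disk (u : R[i] -> X) :=
  forall z : R[i], `|z| < 1 -> derivable (u : R[i]^o -> X) z 1.

Definition L1_0 (f : circle R -> X) :=
  bochner_integrable (@circle_haar R) f /\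
  bochner_integral (@circle_haar R) f = 0.

Definition H1_0 (f : circle R -> X) :=
  L1_0 f /\ analytic_on_disk (harmonic_extension f).

End HardySpace.

Section InfiniteTorus.
Context (R : realType).

Definition coordinate_events (I : set nat) : set (set (nat -> circle R)) :=
  \bigcup_(i in I)
    preimage_set_system setT (fun w : nat -> circle R => w i) measurable.

Definition torusN : Type := g_sigma_algebraType (coordinate_events setT).

HB.instance Definition _ :=
  Measurable.copy torusN (g_sigma_algebraType (coordinate_events setT)).

(* Coordinates are numbered from 0, so the first [k] are those below [k]. *)
Definition torus_filtration (k : nat) : set (set torusN) :=
  <<s coordinate_events `I_k >>.

(* [P] is the product of the Haar measures of the factors; this determines
   [P], as such cylinders form a pi-system generating the sigma-algebra. *)
Definition torus_haar (P : probability torusN R) :=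
  forall (n : nat) (A : nat -> set (circle R)), (forall i, measurable (A i)) ->
    P [set w | forall i, (i < n)%N -> A i (w i)] =
    (\prod_(i < n) @circle_haar R (A i))%E.

Definition replace_coordinate (w : torusN) (k : nat) (y : circle R) : torusN :=
  fun i => if i == k then y else w i.

End InfiniteTorus.

Section HardyMartingale.
Context (R : realType) (X : completeNormedModType R[i])
  (P : probability (torusN R) R).

(* [mdiff F k] is the difference of index [k.+1]; it depends on the coordinates
   [0, ..., k]. *)
Definition mdiff (F : nat -> torusN R -> X) (k : nat) (w : torusN R) : X :=
  F k.+1 w - F k w.

Definition martingale (F : nat -> torusN R -> X) :=
  [/\ forall k, strongly_measurable (@torus_filtration R k) (F k),
      forall k, bochner_integrable P (F k) &
      forall k (A : set (torusN R)), torus_filtration k A ->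
        bochner_integral P (patch (fun=> 0) A (F k.+1)) =
        bochner_integral P (patch (fun=> 0) A (F k))].

(* Almost every value of the first [k] coordinates is expressed on the whole
   torus: by adaptedness the section below only depends on those coordinates,
   and their joint law under [P] is the Haar measure of the [k]-torus. *)
Definition hardy_martingale (F : nat -> torusN R -> X) :=
  martingale F /\
  forall k, {ae P, forall w,
    H1_0 (fun y => mdiff F k (replace_coordinate w k y))}.

End HardyMartingale.

(* Main.v *)
Require Import Defs.
From HB Require Import structures.
From mathcomp Require Import all_boot all_order all_algebra.
From mathcomp Require Import all_classical all_reals all_analysis.
From mathcomp Require Import measurable_realfun finmap complex ring lra.

(* Everything happens on one fiber. Let [z : X], let [h] be a fiber of the next
   martingale difference, so that [h] has vanishing moments [int y^n h(y) dy],
   [n >= 0], and let [w = |h|]. Put [s = sqrt (w / (9 |z|))] where [w > 9 |z|]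
   and [s = 0] elsewhere, let [s~] be the harmonic conjugate of [s], and set
   [a = 1 / (1 + s + i s~)] and [q = a^2 (2 - a^2)] ([q = 0] if [z = 0]).
   Then [a] is the boundary value of a bounded analytic function, [q h] has
   vanishing moments, [|q| w <= 27 |z|], and [|1 - q| <= 4 min (1, s^2 + s~^2)], so
   [int |(1 - q) h| <= 8 W] with [W] the integral of [w] over [w > 9 |z|].
   As [int a (z + h) = z / (1 + int s)], one has
   [|z| / (1 + int s) <= int |z + h| / (1 + s)], whence the gain
   [|z| + W / 3 <= int |z + h|]. Thus
   [int |(1 - q) h| + 27 |z| <= 27 int |z + h|], which telescopes. *)

Set Implicit Arguments.
Unset Strict Implicit.
Unset Printing Implicit Defensive.

Import Order.TTheory GRing.Theory Num.Theory.
Import numFieldNormedType.Exports.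

Local Open Scope classical_set_scope.
Local Open Scope complex_scope.
Local Open Scope ring_scope.

(** * Norms and strong measurability *)

(** Cutting [h] off where it is large would destroy analyticity, so the cut-off is made by the
    analytic function [a], of modulus at most [1 / (1 + s)]. The square root in [s] makes [|a|^2] at
    most [9 |z| / w] where [w] is large, the decay needed to bound [q h] by [|z|]. The quartic is
    chosen because [1 - q = (1 - a^2)^2]: the defect vanishes to second order in [s + i s~], so the
    [L^2] bound for conjugation is enough to integrate it against [w]. For polynomials that bound is
    the mean value property of [p^2]. Analyticity of a Poisson extension is awkward to multiply by
    [q]. It is therefore traded for vanishing moments, a condition stable under polynomial
    multipliers and under bounded almost everywhere limits, and [a] is such a limit of functions
    [1 / (1 + p)] with [p] a polynomial. The second obstacle is that [q] has to be measurable
    jointly in the fiber variable and in all earlier coordinates. Hence [s~] is built as a limit of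
    Fejer polynomials along indices that depend measurably on the fiber. *)

Definition cmod (R : realType) (c : R[i]) : R := complex.Re `|c|.

Section Modulus.
Context (R : realType).
Implicit Types c d : R[i].

Lemma cmodE c : `|c| = (cmod c)%:C.
Proof. by rewrite /cmod normc_def. Qed.

Lemma sqr_cmod c : cmod c ^+ 2 = complex.Re c ^+ 2 + complex.Im c ^+ 2.
Proof. by rewrite /cmod normc_def /= sqr_sqrtr// addr_ge0// sqr_ge0. Qed.

Lemma cmod_ge0 c : 0 <= cmod c.
Proof. by rewrite -lecR -cmodE normr_ge0. Qed.

Lemma cmodM c d : cmod (c * d) = cmod c * cmod d.
Proof. by apply: complexI; rewrite -cmodE normrM !cmodE rmorphM. Qed.

Lemma cmodX c n : cmod (c ^+ n) = cmod c ^+ n.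
Proof. by apply: complexI; rewrite -cmodE normrX !cmodE rmorphXn. Qed.

Lemma cmodV c : cmod c^-1 = (cmod c)^-1.
Proof. by apply: complexI; rewrite -cmodE normfV !cmodE fmorphV. Qed.

Lemma cmodN c : cmod (- c) = cmod c.
Proof. by rewrite /cmod normrN. Qed.

Lemma cmod0 : cmod 0 = 0 :> R.
Proof. by rewrite /cmod normr0. Qed.

Lemma cmod1 : cmod 1 = 1 :> R.
Proof. by rewrite /cmod normr1. Qed.

Lemma cmod_eq0 c : (cmod c == 0) = (c == 0).
Proof. by rewrite -[RHS]normr_eq0 cmodE -(inj_eq (@complexI R)). Qed.

Lemma ler_cmodD c d : cmod (c + d) <= cmod c + cmod d.
Proof. by rewrite -lecR rmorphD /= -!cmodE ler_normD. Qed.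

Lemma ler_cmodB c d : cmod (c - d) <= cmod c + cmod d.
Proof. by rewrite -[cmod d]cmodN ler_cmodD. Qed.

Lemma cmod_real (x : R) : cmod x%:C = `|x|.
Proof. by rewrite /cmod normc_def /= expr0n addr0 sqrtr_sqr. Qed.

Lemma ler_Re_cmod c : `|complex.Re c| <= cmod c.
Proof.
rewrite -(ler_pXn2r (n := 2))// ?nnegrE ?cmod_ge0// sqr_cmod real_normK ?num_real//.
by rewrite lerDl sqr_ge0.
Qed.

Lemma ler_Im_cmod c : `|complex.Im c| <= cmod c.
Proof.
rewrite -(ler_pXn2r (n := 2))// ?nnegrE ?cmod_ge0// sqr_cmod real_normK ?num_real//.
by rewrite lerDr sqr_ge0.
Qed.

Lemma ler_cmod_ReIm c : cmod c <= `|complex.Re c| + `|complex.Im c|.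
Proof.
rewrite -(ler_pXn2r (n := 2))// ?nnegrE ?cmod_ge0 ?addr_ge0//.
by rewrite sqr_cmod sqrrD !real_normK ?num_real// lerD2r lerDl mulrn_wge0// mulr_ge0.
Qed.

End Modulus.

Section RNorm.
Context (R : realType) (X : normedModType R[i]).
Implicit Types x y : X.

Lemma rnormE x : `|x| = (rnorm x)%:C.
Proof. by rewrite /rnorm RRe_real ?normr_real. Qed.

Lemma rnorm_ge0 x : 0 <= rnorm x.
Proof. by rewrite -lecR -rnormE normr_ge0. Qed.

Lemma rnorm0 : rnorm (0 : X) = 0.
Proof. by rewrite /rnorm normr0. Qed.

Lemma rnorm_eq0 x : (rnorm x == 0) = (x == 0).
Proof. by rewrite -[RHS]normr_eq0 rnormE -(inj_eq (@complexI R)). Qed.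

Lemma rnormN x : rnorm (- x) = rnorm x.
Proof. by rewrite /rnorm normrN. Qed.

Lemma rnormZ c x : rnorm (c *: x) = cmod c * rnorm x.
Proof. by apply: complexI; rewrite -rnormE normrZ cmodE rnormE rmorphM. Qed.

Lemma ler_rnormD x y : rnorm (x + y) <= rnorm x + rnorm y.
Proof. by rewrite -lecR rmorphD /= -!rnormE ler_normD. Qed.

Lemma rnorm_distC x y : rnorm (x - y) = rnorm (y - x).
Proof. by rewrite -opprB rnormN. Qed.

Lemma ler_rnormB x y : rnorm (x - y) <= rnorm x + rnorm y.
Proof. by rewrite -[rnorm y]rnormN ler_rnormD. Qed.

Lemma ler_rdist x y : `|rnorm x - rnorm y| <= rnorm (x - y).
Proof.
have h (a b : X) : rnorm a - rnorm b <= rnorm (a - b).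
  by rewrite lerBlDr; have := ler_rnormD (a - b) b; rewrite subrK.
by rewrite ler_norml h andbT lerNl opprB rnorm_distC h.
Qed.

Lemma cvg_rnormP (T : Type) (F : set_system T) {FF : Filter F} (s : T -> X) l :
  (s x @[x --> F] --> l) <-> (rnorm (s x - l) @[x --> F] --> (0 : R)).
Proof.
split.
  move=> /cvgrPdist_lt sl; apply/cvgrPdist_lt => e e0.
  have := sl e%:C; rewrite ltcR => /(_ e0); apply: filterS => x.
  by rewrite sub0r normrN ger0_norm ?rnorm_ge0// rnormE ltcR rnorm_distC.
(* The radius ranges over [R[i]]; being positive, it has imaginary part zero. *)
move=> /cvgrPdist_lt sl; apply/cvgrPdist_lt => -[e e'].
rewrite ltcE/= => /andP[/eqP -> e0].
have := sl _ e0; apply: filterS => x.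
by rewrite sub0r normrN ger0_norm ?rnorm_ge0// rnormE ltcE/= eqxx rnorm_distC.
Qed.

Lemma cvg_rnorm (T : Type) (F : set_system T) {FF : Filter F} (s : T -> X) l :
  s x @[x --> F] --> l -> rnorm (s x) @[x --> F] --> rnorm l.
Proof.
move=> /cvg_rnormP /cvgrPdist_lt sl; apply/cvgrPdist_lt => e /sl; apply: filterS.
move=> x; rewrite sub0r normrN ger0_norm ?rnorm_ge0//; apply: le_lt_trans.
by rewrite rnorm_distC ler_rdist.
Qed.

Lemma ler_rnorm_sum (I : Type) (r : seq I) (Q : pred I) (f : I -> X) :
  rnorm (\sum_(i <- r | Q i) f i) <= \sum_(i <- r | Q i) rnorm (f i).
Proof.
elim/big_rec2 : _ => [|i y1 y2 _ h]; first by rewrite rnorm0.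
exact: le_trans (ler_rnormD _ _) (lerD _ _).
Qed.

End RNorm.

(** The codomain is arbitrary, so that pairs of simple functions and truth values are covered; for
    values in [X] this is [simple_for measurable]. *)
Definition simple d (T : measurableType d) (Y : Type) (s : T -> Y) :=
  finite_set (range s) /\ forall v, measurable (s @^-1` [set v]).

Section Simple.
Context d (T : measurableType d).

Lemma simple_preimage (Y : choiceType) (s : T -> Y) (B : set Y) :
  simple s -> measurable (s @^-1` B).
Proof.
move=> [fs ms].
rewrite (_ : _ @^-1` _ = \bigcup_(y in range s `&` B) s @^-1` [set y]).
  by apply: fin_bigcup_measurable => //; exact: finite_setIl.
apply/seteqP; split => [w Bw|w [y [_ By] /= sw]]; last by rewrite /preimage/= sw.
by exists (s w); split => //; exists w.
Qed.

Lemma simple_map (Y Z : choiceType) (p : T -> Y) (g : Y -> Z) :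
  simple p -> simple (g \o p).
Proof.
move=> sp; split=> [|v].
  have -> : range (g \o p) = g @` range p by rewrite image_comp.
  by apply: finite_image; case: sp.
by rewrite comp_preimage; exact: simple_preimage.
Qed.

Lemma simple_pair (Y Z : choiceType) (p : T -> Y) (q : T -> Z) :
  simple p -> simple q -> simple (fun w => (p w, q w)).
Proof.
move=> [fp mp] [fq mq]; split=> [|[y z]].
  apply: (@sub_finite_set _ _ (range p `*` range q)); last exact: finite_setX.
  by move=> _ [w _ <-]; split => /=; exists w.
rewrite (_ : _ @^-1` _ = p @^-1` [set y] `&` q @^-1` [set z]).
  exact: measurableI.
by apply/seteqP; split=> w /= [-> ->].
Qed.

Lemma simple_cst (Y : Type) (y : Y) : simple (fun _ : T => y).
Proof.
split=> [|v].
  by apply: (@sub_finite_set _ _ [set y]); [move=> _ [w _ <-]|exact: finite_set1].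
have [->|yv] := pselect (y = v).
  by rewrite (_ : _ @^-1` _ = setT)//; apply/seteqP; split.
by rewrite (_ : _ @^-1` _ = set0)//; apply/seteqP; split.
Qed.

Lemma measurable_simple_comp (R : realType) (Y : choiceType) (p : T -> Y)
    (g : Y -> R) : simple p -> measurable_fun setT (g \o p).
Proof.
by move=> sp _ B mB; rewrite setTI comp_preimage; exact: simple_preimage.
Qed.

End Simple.

Section SimpleIntegral.
Context (R : realType) (X : normedModType R[i]) (d : measure_display)
  (T : measurableType d) (P : probability T R).
Implicit Types (s t : T -> X).

Lemma integral_simple (Y : choiceType) (p : T -> Y) (g : Y -> R) :
  simple p -> (forall y, 0 <= g y) ->
  (\int[P]_w (g (p w))%:E =
   \sum_(y <- fset_set (range p)) (g y * fine (P (p @^-1` [set y])))%:E)%E.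
Proof.
move=> sp g0; have [fp mp] := sp.
transitivity (\int[P]_w (\sum_(y <- fset_set (range p))
    (g y * \1_(p @^-1` [set y]) w)%:E))%E.
  apply: eq_integral => w _; rewrite sumEFin (big_fsetD1 (p w))/=; last first.
    by rewrite in_fset_set//; apply/mem_set; exists w.
  rewrite indicE mem_set// mulr1 big1_seq ?addr0// => y /andP[_].
  rewrite in_fsetD1 => /andP[/eqP yp _].
  by rewrite indicE memNset ?mulr0// => /= pw; apply: yp.
rewrite ge0_integral_sum//=.
- apply: eq_bigr => y _; under eq_integral do rewrite EFinM.
  rewrite ge0_integralZl//.
  + by rewrite integral_indic// setIT EFinM fineK ?fin_num_measure.
  + exact/measurable_EFinP/measurable_indic.
  + by rewrite lee_fin.
- by move=> y; apply/measurable_EFinP; apply: measurable_funM.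
- by move=> y w _; rewrite lee_fin mulr_ge0.
Qed.

(** Regroup the fibers of [p] by the value of [g]. With [p] a pair of simple functions, several
    integrals become sums over one common partition, whence additivity. *)
Lemma simple_integral_map (Y : choiceType) (p : T -> Y) (g : Y -> X) :
  simple p -> simple_integral P (g \o p) =
  \sum_(y <- fset_set (range p)) (fine (P (p @^-1` [set y])))%:C *: g y.
Proof.
move=> sp; have [fp mp] := sp; have [fgp _] := simple_map g sp.
rewrite /simple_integral fsbig_finite//=.
have Pv v : fine (P ((g \o p) @^-1` [set v])) =
    \sum_(y <- fset_set (range p) | g y == v) fine (P (p @^-1` [set y])).
  pose F y := if g y == v then p @^-1` [set y] else set0.
  have -> : (g \o p) @^-1` [set v] = \big[setU/set0]_(y <- fset_set (range p)) F y.
    rewrite -bigcup_fset; apply/seteqP; split => [w /= gw|w [y _]].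
      by exists (p w); rewrite /F /= ?gw ?eqxx// in_fset_set//; apply/mem_set; exists w.
    by rewrite /F; case: eqP => [<- <-|//].
  rewrite measure_fbigsetU//.
  - rewrite [RHS]big_mkcond -sum_fine//=; first last.
      by move=> y _; apply: fin_num_measure; rewrite /F; case: ifP.
    by apply: eq_bigr => y _; rewrite /F; case: ifP; rewrite ?measure0.
  - by move=> y _; rewrite /F; case: ifP.
  - move=> y z _ _ [w []]; rewrite /F; do 2 case: ifP => // _.
    by move=> /= -> ->.
under eq_bigr do rewrite Pv raddf_sum scaler_suml big_mkcond.
rewrite exchange_big/= !big_seq; apply: eq_bigr => y yp.
rewrite (big_fsetD1 (g y))/=; last first.
  move: yp; rewrite !in_fset_set// => /set_mem[w _ <-].
  by apply/mem_set; exists w.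
rewrite eqxx big1_seq ?addr0// => v.
by rewrite in_fsetD1 eq_sym => /andP[_ /andP[/negbTE -> _]].
Qed.

Lemma ler_simple_integral s : simple s ->
  ((rnorm (simple_integral P s))%:E <= \int[P]_w (rnorm (s w))%:E)%E.
Proof.
move=> ss; have [fs ms] := ss.
rewrite (integral_simple (g := @rnorm R X))//; last by move=> ?; exact: rnorm_ge0.
rewrite sumEFin lee_fin /simple_integral fsbig_finite//=.
apply: le_trans (ler_rnorm_sum _ _ _) _.
apply: ler_sum => v _; rewrite rnormZ cmod_real mulrC ger0_norm//.
by rewrite fine_ge0.
Qed.

Lemma simple_integralB s t : simple s -> simple t ->
  simple_integral P (fun w => s w - t w) = simple_integral P s - simple_integral P t.
Proof.
move=> ss st; have sp := simple_pair ss st.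
rewrite (simple_integral_map (fun p : X * X => p.1 - p.2) sp).
rewrite -[in RHS]/(fst \o (fun w => (s w, t w))) (simple_integral_map fst sp).
rewrite -[in X in _ = _ - X]/(snd \o (fun w => (s w, t w))).
by rewrite (simple_integral_map snd sp) -sumrB; apply: eq_bigr => y _; rewrite scalerBr.
Qed.

End SimpleIntegral.

(** * Null sequences and dominated convergence *)

Section NullSequences.
Context (R : realType).

Lemma cvg_le_EFin0 (x : nat -> R) (e : nat -> \bar R) :
  (forall n, 0 <= x n) -> (forall n, ((x n)%:E <= e n)%E) ->
  e n @[n --> \oo] --> (0 : \bar R)%E -> x n @[n --> \oo] --> (0 : R).
Proof.
move=> x0 xe e0; apply: (@fine_cvg _ _ _ _ (EFin \o x)).
apply: (@squeeze_cvge _ _ _ _ (cst 0%E) _ e) => //; last exact: cvg_cst.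
by apply: nearW => n /=; rewrite lee_fin x0 xe.
Qed.

Lemma cvg_le_ereal0 (x e : nat -> \bar R) :
  (forall n, (0 <= x n)%E) -> (forall n, (x n <= e n)%E) ->
  e n @[n --> \oo] --> (0 : \bar R)%E -> x n @[n --> \oo] --> (0 : \bar R)%E.
Proof.
move=> x0 xe e0.
apply: (@squeeze_cvge _ _ _ _ (cst 0%E) _ e) => //; last exact: cvg_cst.
by apply: nearW => n /=; rewrite x0 xe.
Qed.

Lemma cvg_ereal0D (x y : nat -> \bar R) :
  x n @[n --> \oo] --> (0 : \bar R)%E -> y n @[n --> \oo] --> (0 : \bar R)%E ->
  (x n + y n)%E @[n --> \oo] --> (0 : \bar R)%E.
Proof.
move=> x0 y0; have : (x n + y n)%E @[n --> \oo] --> (0 + 0 : \bar R)%E.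
  by apply: cvgeD.
by rewrite adde0.
Qed.

Lemma cvg0Mr (x : nat -> R) (c : R) :
  x n @[n --> \oo] --> (0 : R) -> (x n * c) @[n --> \oo] --> (0 : R).
Proof.
move=> x0; have : (x n * c) @[n --> \oo] --> (0 * c : R).
  by apply: cvgM => //; exact: cvg_cst.
by rewrite mul0r.
Qed.

Lemma cvg_ereal0M (x : nat -> \bar R) (c : R) :
  x n @[n --> \oo] --> (0 : \bar R)%E -> (c%:E * x n)%E @[n --> \oo] --> (0 : \bar R)%E.
Proof.
move=> x0; have : (c%:E * x n)%E @[n --> \oo] --> (c%:E * 0 : \bar R)%E.
  exact: cvgeZl.
by rewrite mule0.
Qed.

Lemma cvg_cauchy_bound (X : completeNormedModType R[i]) (a : nat -> X)
    (e : nat -> \bar R) :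
  (forall n m, ((rnorm (a n - a m))%:E <= e n + e m)%E) ->
  e n @[n --> \oo] --> (0 : \bar R)%E -> exists l : X, a n @[n --> \oo] --> l.
Proof.
move=> ae e0; suff h : cauchy (a n @[n --> \oo]).
  by exists (lim (a n @[n --> \oo])); exact: cauchy_cvg h.
apply: cauchy_exP => -[r r']; rewrite ltcE/= => /andP[/eqP -> r0].
have r20 : 0 < r / 2 by rewrite divr_gt0.
have [N _ eN] : \forall n \near \oo, (e n < (r / 2)%:E)%E.
  have /fine_cvgP[fe /cvgrPdist_lt/(_ _ r20)] := e0; move: fe; apply: filterS2 => n en.
  by rewrite /= sub0r normrN => ern; rewrite -(fineK en) lte_fin (le_lt_trans (ler_norm _)).
exists (a N), N => // n /= Nn.
rewrite -ball_normE /ball_/= rnormE ltcE/= eqxx/= -lte_fin (le_lt_trans (ae _ _))//.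
by rewrite [r]splitr EFinD lteD// eN//=.
Qed.

End NullSequences.

Section RealConvergence.
Context (R : realType) (d : measure_display) (T : measurableType d)
  (P : {measure set T -> \bar R}).

Lemma dominated_cvg0_real (f : nat -> T -> R) (g : T -> R) :
  (forall n, measurable_fun setT (f n)) -> measurable_fun setT g ->
  {ae P, forall w, f n w @[n --> \oo] --> (0 : R)} ->
  (forall n w, 0 <= f n w <= g w) -> (\int[P]_w (g w)%:E < +oo)%E ->
  (\int[P]_w (f n w)%:E)%E @[n --> \oo] --> (0 : \bar R)%E.
Proof.
move=> mf mg f0 fg ig.
have ig' : P.-integrable setT (EFin \o g).
  apply/integrableP; split; first exact/measurable_EFinP.
  under eq_integral => w _.
    rewrite /= ger0_norm; last by case/andP: (fg 0%N w); exact: le_trans.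
    over.
  by [].
have mf' n : measurable_fun setT (EFin \o f n) by exact/measurable_EFinP.
have f0' : {ae P, forall w, setT w -> (f n w)%:E @[n --> \oo] --> (0 : \bar R)%E}.
  apply: filterS f0 => w fw _; apply: cvg_EFin; last exact: fw.
  exact: nearW.
have fg' : {ae P, forall w n, setT w -> (`|(f n w)%:E| <= (EFin \o g) w)%E}.
  apply: nearW => w n _ /=; rewrite lee_fin ger0_norm; first by case/andP: (fg n w).
  by case/andP: (fg n w).
have [_ _] := dominated_convergence measurableT mf' (measurable_cst _) f0' ig' fg'.
by rewrite integral0.
Qed.

End RealConvergence.

Import HBSimple.

Definition smeas (R : realType) (X : normedModType R[i]) d (T : measurableType d)
    (f : T -> X) := strongly_measurable measurable f.

Definition cmeas (R : realType) d (T : measurableType d) (c : T -> R[i]) :=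
  measurable_fun setT (fun w => complex.Re (c w)) /\
  measurable_fun setT (fun w => complex.Im (c w)).

Section StrongMeasurability.
Context (R : realType) (X : normedModType R[i]) (d : measure_display)
  (T : measurableType d).
Implicit Types (f g : T -> X) (c : T -> R[i]).

Lemma smeas_cst (v : X) : smeas (fun _ : T => v).
Proof.
exists (fun _ _ => v); split=> [n|w]; first exact: simple_cst.
exact: cvg_cst.
Qed.

Lemma smeasB f g : smeas f -> smeas g -> smeas (fun w => f w - g w).
Proof.
move=> [s [ss sf]] [t [st tg]].
exists (fun n w => s n w - t n w); split=> [n|w].
  exact: (simple_map (fun p : X * X => p.1 - p.2) (simple_pair (ss n) (st n))).
by apply: cvgB; [exact: sf|exact: tg].
Qed.

Lemma smeasD f g : smeas f -> smeas g -> smeas (fun w => f w + g w).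
Proof.
move=> mf mg; rewrite (_ : (fun _ => _) = (fun w => f w - (0 - g w))).
  by apply: smeasB => //; apply: smeasB => //; exact: smeas_cst.
by apply/funext => w; rewrite sub0r opprK.
Qed.

Lemma cvg_complex (x y : nat -> R) (a b : R) :
  x n @[n --> \oo] --> a -> y n @[n --> \oo] --> b ->
  (x n +i* y n : R[i]^o) @[n --> \oo] --> (a +i* b : R[i]^o).
Proof.
move=> xa yb; apply/cvg_rnormP.
apply: (@cvg_le_EFin0 _ _ (fun n => (`|x n - a| + `|y n - b|)%:E)).
- by move=> n; exact: rnorm_ge0.
- by move=> n; rewrite lee_fin; exact: (ler_cmod_ReIm ((x n +i* y n) - (a +i* b))).
- apply: cvg_EFin; first exact: nearW.
  rewrite -[0 : R]addr0; apply: cvgD.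
    by rewrite -[0 : R](normr0 R^o) -(subrr a); apply: cvg_norm; apply: cvgB => //; exact: cvg_cst.
  by rewrite -[0 : R](normr0 R^o) -(subrr b); apply: cvg_norm; apply: cvgB => //; exact: cvg_cst.
Qed.

Lemma measurable_simple_approx (r : T -> R) : measurable_fun setT r ->
  exists s : nat -> T -> R, (forall n, simple (s n)) /\
    forall w, s n w @[n --> \oo] --> r w.
Proof.
move=> /measurable_EFinP mr.
have [s sr] := approximation_sfun measurableT mr.
exists (fun n => s n : T -> R); split=> [n|w].
  split; first exact: fimfunP.
  by move=> v; rewrite -[X in measurable X]setTI; exact: measurable_funP.
have /fine_cvgP[_] := sr w I.
exact.
Qed.

Lemma smeasZ c f : cmeas c -> smeas f -> smeas (fun w => c w *: f w).
Proof.
move=> [mr mi] [s [ss sf]].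
have [r [sr rc]] := measurable_simple_approx mr.
have [j [sj jc]] := measurable_simple_approx mi.
exists (fun n w => (r n w +i* j n w) *: s n w); split=> [n|w].
  exact: (simple_map (fun p : R * R * X => (p.1.1 +i* p.1.2) *: p.2)
    (simple_pair (simple_pair (sr n) (sj n)) (ss n))).
apply: cvgZ; last exact: sf.
by have := cvg_complex (rc w) (jc w); case: (c w).
Qed.

Lemma measurable_rnorm f : smeas f -> measurable_fun setT (fun w => rnorm (f w)).
Proof.
move=> [s [ss sf]].
apply: (@measurable_fun_cvg _ _ _ _ (fun n w => rnorm (s n w))).
  by move=> n; exact: (measurable_simple_comp (@rnorm R X) (ss n)).
by move=> w _; apply: cvg_rnorm; exact: sf.
Qed.

Lemma smeas_comp d' (T' : measurableType d') (u : T' -> T) f :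
  measurable_fun setT u -> smeas f -> smeas (f \o u).
Proof.
move=> mu [s [ss sf]]; exists (fun n => s n \o u); split=> [n|w]; last exact: sf.
have [fs ms] := ss n; split.
  apply: sub_finite_set fs => _ [w _ <-] /=; by exists (u w).
by move=> v; rewrite comp_preimage -[X in measurable X]setTI; exact: mu.
Qed.

Lemma cmeas_indic (A : set T) : measurable A -> cmeas (fun w => (\1_A w)%:C : R[i]).
Proof. by move=> mA; split => /=; [exact: measurable_indic|exact: measurable_cst]. Qed.

Lemma patchE0 (A : set T) f :
  patch (fun=> 0) A f = (fun w => (\1_A w)%:C *: f w).
Proof.
apply/funext => w; rewrite /patch indicE.
by case: ifP => _; rewrite ?scale1r ?scale0r.
Qed.

End StrongMeasurability.

Lemma measurable_inv (R : realType) : measurable_fun setT (@GRing.inv R).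
Proof.
rewrite (_ : setT = [set x : R | x != 0] `|` [set 0]); last first.
  apply/seteqP; split=> // x _ /=; have [->|x0] := eqVneq x 0; by [right|left].
apply/measurable_funU; [|exact: measurable_set1|split].
- by apply: open_measurable; exact: open_neq.
- apply: open_continuous_measurable_fun; first exact: open_neq.
  by move=> x /set_mem x0; exact: inv_continuous.
- exact: measurable_fun_set1.
Qed.

Section ComplexMeasurability.
Context (R : realType) (d : measure_display) (T : measurableType d).
Implicit Types (c e : T -> R[i]).

Lemma cmeasB c e : cmeas c -> cmeas e -> cmeas (fun w => c w - e w).
Proof.
move=> [mc mc'] [me me']; split=> /=.
  rewrite (_ : (fun _ => _) = (fun w => complex.Re (c w) - complex.Re (e w))).
    exact: measurable_funB.
  by apply/funext => w; rewrite raddfB.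
rewrite (_ : (fun _ => _) = (fun w => complex.Im (c w) - complex.Im (e w))).
  exact: measurable_funB.
by apply/funext => w; rewrite raddfB.
Qed.

Lemma cmeasM c e : cmeas c -> cmeas e -> cmeas (fun w => c w * e w).
Proof.
move=> [mc mc'] [me me']; split=> /=.
  rewrite (_ : (fun _ => _) = (fun w => complex.Re (c w) * complex.Re (e w) -
      complex.Im (c w) * complex.Im (e w))).
    by apply: measurable_funB; apply: measurable_funM.
  by apply/funext => w; case: (c w) (e w) => [? ?] [? ?].
rewrite (_ : (fun _ => _) = (fun w => complex.Re (c w) * complex.Im (e w) +
      complex.Im (c w) * complex.Re (e w))).
  by apply: measurable_funD; apply: measurable_funM.
by apply/funext => w; case: (c w) (e w) => [? ?] [? ?].
Qed.

Lemma cmeas_cst (v : R[i]) : cmeas (fun _ : T => v).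
Proof. by split; exact: measurable_cst. Qed.

Lemma cmeasV c : cmeas c -> cmeas (fun w => (c w)^-1).
Proof.
move=> [mc mc'].
have mn : measurable_fun setT (fun w => (complex.Re (c w) ^+ 2 + complex.Im (c w) ^+ 2)^-1).
  apply: (measurableT_comp (@measurable_inv R)); by apply: measurable_funD; apply: measurable_funX.
split=> /=.
  rewrite (_ : (fun _ => _) = (fun w => complex.Re (c w) *
      (complex.Re (c w) ^+ 2 + complex.Im (c w) ^+ 2)^-1)).
    exact: measurable_funM.
  by apply/funext => w; case: (c w).
rewrite (_ : (fun _ => _) = (fun w => - complex.Im (c w) *
      (complex.Re (c w) ^+ 2 + complex.Im (c w) ^+ 2)^-1)).
  apply: measurable_funM => //; exact: measurable_funN.
by apply/funext => w; case: (c w) => a b /=; rewrite mulNr.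
Qed.

Lemma cmeas_ite (A : T -> bool) c e : measurable_fun setT A ->
  cmeas c -> cmeas e -> cmeas (fun w => if A w then c w else e w).
Proof.
move=> mA [mc mc'] [me me']; split => /=.
  rewrite (_ : (fun _ => _) = (fun w => if A w then complex.Re (c w) else complex.Re (e w))).
    by apply: measurable_fun_ifT.
  by apply/funext => w; case: ifP.
rewrite (_ : (fun _ => _) = (fun w => if A w then complex.Im (c w) else complex.Im (e w))).
  by apply: measurable_fun_ifT.
by apply/funext => w; case: ifP.
Qed.

Lemma measurable_cmod c : cmeas c -> measurable_fun setT (fun w => cmod (c w)).
Proof.
move=> [mc mc']; rewrite (_ : (fun _ => _) = (fun w => Num.sqrt (complex.Re (c w) ^+ 2 + complex.Im (c w) ^+ 2))).
  apply: (@measurableT_comp _ _ _ _ _ _ (@Num.sqrt R)); first exact: continuous_measurable_fun (@sqrt_continuous R).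
  by apply: measurable_funD; apply: measurable_funX.
by apply/funext => w; rewrite /cmod normc_def.
Qed.

End ComplexMeasurability.

Import HBNNSimple.

(** * The Bochner integral *)

Section BochnerIntegral.
Context (R : realType) (X : completeNormedModType R[i]) (d : measure_display)
  (T : measurableType d) (P : probability T R).
Implicit Types (f g h : T -> X).

(** Measurability is asked everywhere rather than almost everywhere, so that sections and
    compositions stay in the class; on strongly measurable functions the notion agrees with
    [bochner_integrable]. *)
Definition bint f := smeas f /\ (\int[P]_w (rnorm (f w))%:E < +oo)%E.

Lemma measurable_rnormE f : smeas f -> measurable_fun setT (fun w => (rnorm (f w))%:E).
Proof. by move=> mf; apply/measurable_EFinP; exact: measurable_rnorm. Qed.

Lemma int_rnorm_triangle f g h : smeas f -> smeas g -> smeas h ->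
  (forall w, rnorm (f w) <= rnorm (g w) + rnorm (h w)) ->
  (\int[P]_w (rnorm (f w))%:E <=
   \int[P]_w (rnorm (g w))%:E + \int[P]_w (rnorm (h w))%:E)%E.
Proof.
move=> mf mg mh fgh; rewrite -ge0_integralD//; first last.
- exact: measurable_rnormE.
- by move=> w _; rewrite lee_fin rnorm_ge0.
- exact: measurable_rnormE.
- by move=> w _; rewrite lee_fin rnorm_ge0.
apply: ge0_le_integral => //.
- by move=> w _; rewrite lee_fin rnorm_ge0.
- exact: measurable_rnormE.
- by apply: emeasurable_funD; exact: measurable_rnormE.
- by move=> w _; rewrite -EFinD lee_fin.
Qed.

Lemma simple_smeas (s : T -> X) : simple s -> smeas s.
Proof. by move=> ss; exists (fun _ => s); split=> // w; exact: cvg_cst. Qed.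

(** With [f = g] this one estimate gives both the Cauchy property ([t = s]) and the independence of
    the limit from the approximating sequence. *)
Lemma L1_approx_dist f g (s t : nat -> T -> X) : smeas f -> smeas g ->
  (forall n, simple (s n)) -> (forall n, simple (t n)) -> forall n m,
  ((rnorm (simple_integral P (s n) - simple_integral P (t m)))%:E <=
   \int[P]_w (rnorm (f w - g w))%:E +
   (\int[P]_w (rnorm (f w - s n w))%:E + \int[P]_w (rnorm (g w - t m w))%:E))%E.
Proof.
move=> mf mg ss st n m; rewrite -simple_integralB//.
have mst : simple (fun w => s n w - t m w).
  exact: (simple_map (fun p : X * X => p.1 - p.2) (simple_pair (ss n) (st m))).
apply: le_trans (ler_simple_integral P mst) _.
have mfs := smeasB mf (simple_smeas (ss n)).
have mgt := smeasB mg (simple_smeas (st m)).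
have mfg := smeasB mf mg.
apply: le_trans (@int_rnorm_triangle _ (fun w => f w - g w)
  (fun w => (f w - s n w) - (g w - t m w)) _ _ _ _) _ => //.
- exact: simple_smeas.
- exact: smeasB.
- move=> w; rewrite (_ : s n w - t m w =
    (f w - g w) - ((f w - s n w) - (g w - t m w))) ?ler_rnormB//.
  by rewrite [- (_ - _ - _)]opprB addrA subrKA opprB addrC subrKA.
apply: leeD => //; apply: int_rnorm_triangle => //; first exact: smeasB.
by move=> w; exact: ler_rnormB.
Qed.

Lemma L1_approx_cvg f s : smeas f -> L1_approx P f s ->
  simple_integral P (s n) @[n --> \oo] --> bochner_integral P f.
Proof.
move=> mf sf; have [ss s0] := sf.
have d0 : (\int[P]_w (rnorm (f w - f w))%:E = 0)%E.
  by under eq_integral do rewrite subrr rnorm0; rewrite integral0.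
have [v sv] : exists v : X, simple_integral P (s n) @[n --> \oo] --> (v : X).
  apply: cvg_cauchy_bound s0 => n m.
  by have := L1_approx_dist mf mf ss ss n m; rewrite d0 add0e.
suff -> : bochner_integral P f = v by [].
(* [xget] returns a limit along some sequence [t], possibly different from [s]; the distance
   estimate identifies the two limits. *)
have : [set v : X | exists2 s, L1_approx P f s &
    simple_integral P (s n) @[n --> \oo] --> (v : X)] (bochner_integral P f).
  by apply: (@xgetPex _ 0 _); exists v, s.
move=> [t tf tv]; have [st t0] := tf.
have uv : (simple_integral P (t n) - simple_integral P (s n)) @[n --> \oo]
    --> bochner_integral P f - v by exact: cvgB.
have u0 : (simple_integral P (t n) - simple_integral P (s n)) @[n --> \oo]
    --> (0 : X).
  apply/cvg_rnormP; under eq_cvg do rewrite subr0.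
  apply: (cvg_le_EFin0 _ (fun n => L1_approx_dist mf mf st ss n n)) => [n|].
    exact: rnorm_ge0.
  rewrite d0; under eq_cvg do rewrite add0e.
  exact: cvg_ereal0D.
by apply/eqP; rewrite -subr_eq0; apply/eqP; apply: (cvg_unique (@norm_hausdorff _ X) uv u0).
Qed.

(** Pointwise approximants are kept only where their norm is at most [2 |f|]. The truncation is
    dominated by a multiple of [|f|] and still converges: where [f] is nonzero the condition
    eventually holds, and where [f] vanishes it forces the value 0. *)
Lemma bint_L1_approx f : bint f -> exists s, L1_approx P f s.
Proof.
move=> [mf intf]; have [s [ss sf]] := mf.
pose A n w := rnorm (s n w) <= 2 * rnorm (f w).
pose t n w := if A n w then s n w else 0.
have mA n : measurable_fun setT (A n).
  apply: measurable_fun_ler; first exact: measurable_rnorm (simple_smeas (ss n)).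
  by apply: measurable_funM => //; exact: measurable_rnorm.
have st n : simple (t n).
  apply: (simple_map (fun p : bool * X => if p.1 then p.2 else 0)
    (simple_pair _ (ss n))).
  split=> [|b]; first exact: finite_finset.
  by rewrite -[X in measurable X]setTI; exact: mA.
exists t; split=> //.
have mt n : smeas (fun w => f w - t n w).
  by apply: smeasB => //; exact: simple_smeas.
apply: (@dominated_cvg0_real _ _ _ P _ (fun w => 3 * rnorm (f w))).
- by move=> n; exact: measurable_rnorm.
- by apply: measurable_funM => //; exact: measurable_rnorm.
- apply: nearW => w.
  have ft : t n w @[n --> \oo] --> f w.
    have [fw0|fw0] := eqVneq (f w) 0.
      rewrite (_ : t ^~ w = fun=> 0) ?fw0; first exact: cvg_cst.
      apply/funext => n; rewrite /t /A fw0 rnorm0 mulr0.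
      by case: ifPn => // sn0; apply/eqP; rewrite -rnorm_eq0 eq_le sn0 rnorm_ge0.
    have f0 : 0 < rnorm (f w) by rewrite lt_def rnorm_eq0 fw0 rnorm_ge0.
    have sfw := sf w.
    apply: cvg_trans (sf w); apply: near_eq_cvg.
    have : rnorm (s n w) @[n --> \oo] --> rnorm (f w) by exact: cvg_rnorm sfw.
    move=> /cvgrPdist_lt h; have := h _ f0.
    apply: filterS => n; rewrite ltr_distlC => /andP[_ sn].
    by rewrite /t /A ltW// mulr_natl mulr2n.
  have /cvg_rnormP := ft.
  by under eq_cvg do rewrite rnorm_distC.
- move=> n w; rewrite rnorm_ge0/=.
  apply: le_trans (ler_rnormB _ _) _.
  rewrite (_ : 3 * rnorm (f w) = rnorm (f w) + 2 * rnorm (f w)); last by ring.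
  rewrite lerD2l /t; case: ifP => //.
  by rewrite rnorm0 mulr_ge0// rnorm_ge0.
- under eq_integral do rewrite EFinM.
  rewrite ge0_integralZl//.
  + by rewrite lte_mul_pinfty// ?lee_fin.
  + exact: measurable_rnormE.
  + by move=> w _; rewrite lee_fin rnorm_ge0.
Qed.

Lemma bint_bochner f : bint f -> bochner_integrable P f.
Proof.
move=> bf; split; last exact: bint_L1_approx.
have [[s [ss sf]] _] := bf.
by exists s; split => //; exact: nearW.
Qed.

Lemma bochner_bint f : smeas f -> bochner_integrable P f -> bint f.
Proof.
move=> mf [_ [s [ss s0]]]; split=> //.
have /fine_cvgP[[N _ /(_ N (leqnn N))] /= fN _] := s0.
apply: le_lt_trans (int_rnorm_triangle mf (smeasB mf (simple_smeas (ss N)))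
   (simple_smeas (ss N)) _) _.
  move=> w; by rewrite -[X in rnorm X <= _](subrK (s N w)) ler_rnormD.
rewrite lte_add_pinfty//; first by rewrite ltey_eq fN.
by rewrite (@integral_simple _ _ _ P _ _ (@rnorm R X) (ss N)) ?sumEFin ?ltry// => ?; exact: rnorm_ge0.
Qed.

Lemma bint_approx f : bint f -> exists2 s, L1_approx P f s &
  simple_integral P (s n) @[n --> \oo] --> bochner_integral P f.
Proof.
move=> bf; have [s sf] := bint_L1_approx bf.
by exists s => //; apply: L1_approx_cvg => //; case: bf.
Qed.

Lemma ler_bochner f : bint f ->
  ((rnorm (bochner_integral P f))%:E <= \int[P]_w (rnorm (f w))%:E)%E.
Proof.
move=> bf; have [mf _] := bf; have [s [ss s0] sv] := bint_approx bf.
apply: (@lee_cvg_to _ \oo _ _ (fun n => (rnorm (simple_integral P (s n)))%:E)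
  (fun n => \int[P]_w (rnorm (f w))%:E + \int[P]_w (rnorm (f w - s n w))%:E)%E).
- by apply: cvg_EFin; [apply: nearW|exact: cvg_rnorm sv].
- have : (\int[P]_w (rnorm (f w))%:E + \int[P]_w (rnorm (f w - s n w))%:E)%E @[n --> \oo]
      --> (\int[P]_w (rnorm (f w))%:E + 0)%E.
    by apply: cvgeD; [rewrite fin_num_adde_defl|exact: cvg_cst|exact: s0].
  by rewrite adde0.
- apply: nearW => n; apply: le_trans (ler_simple_integral P (ss n)) _.
  have mfs := smeasB mf (simple_smeas (ss n)).
  apply: int_rnorm_triangle => //; first exact: simple_smeas (ss n).
  by move=> w; rewrite -{1}[s n w](subKr (f w)) ler_rnormB.
Qed.

Lemma bintB f g : bint f -> bint g -> bint (fun w => f w - g w).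
Proof.
move=> [mf intf] [mg intg]; split; first exact: smeasB.
apply: le_lt_trans (int_rnorm_triangle (smeasB mf mg) mf mg _) _.
  by move=> w; exact: ler_rnormB.
exact: lte_add_pinfty.
Qed.

Lemma bochner_uniq f s v : bint f -> L1_approx P f s ->
  simple_integral P (s n) @[n --> \oo] --> v -> bochner_integral P f = v.
Proof.
move=> [mf _] sf sv; have /(cvg_unique (@norm_hausdorff _ X)) := L1_approx_cvg mf sf.
exact.
Qed.

Lemma bochnerB f g : bint f -> bint g ->
  bochner_integral P (fun w => f w - g w) =
  bochner_integral P f - bochner_integral P g.
Proof.
move=> bf bg; have [mf _] := bf; have [mg _] := bg.
have [s [ss s0] sv] := bint_approx bf.
have [t [st t0] tv] := bint_approx bg.
apply: (@bochner_uniq _ (fun n w => s n w - t n w)); first exact: bintB.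
- split=> [n|].
    exact: (simple_map (fun p : X * X => p.1 - p.2) (simple_pair (ss n) (st n))).
  apply: (@cvg_le_ereal0 _ _ (fun n => \int[P]_w (rnorm (f w - s n w))%:E +
      \int[P]_w (rnorm (g w - t n w))%:E)%E).
  + by move=> n; apply: integral_ge0 => w _; rewrite lee_fin rnorm_ge0.
  + move=> n; have mfs := smeasB mf (simple_smeas (ss n)).
    have mgt := smeasB mg (simple_smeas (st n)).
    apply: (int_rnorm_triangle _ mfs mgt).
      apply: smeasB; first exact: smeasB.
      by apply: smeasB; [exact: simple_smeas (ss n)|exact: simple_smeas (st n)].
    move=> w; rewrite (_ : _ - _ = (f w - s n w) - (g w - t n w)) ?ler_rnormB//.
    by rewrite !opprD !opprK addrACA.
  + exact: cvg_ereal0D.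
- under eq_cvg => n do rewrite (simple_integralB P (ss n) (st n)).
  exact: cvgB sv tv.
Qed.

Lemma bint_cst v : bint (fun=> v).
Proof.
split; first exact: smeas_cst.
by rewrite integral_cst//= probability_setT mule1 ltry.
Qed.

Lemma bochner0 : bochner_integral P (fun=> 0 : X) = 0.
Proof.
apply/eqP; rewrite -rnorm_eq0 eq_le rnorm_ge0 andbT -lee_fin.
apply: le_trans (ler_bochner (bint_cst 0)) _.
by under eq_integral do rewrite rnorm0; rewrite integral0.
Qed.

Lemma bintN f : bint f -> bint (fun w => - f w).
Proof.
move=> bf; rewrite (_ : (fun _ => _) = (fun w => 0 - f w)).
  by apply: bintB => //; exact: bint_cst.
by apply/funext => w; rewrite sub0r.
Qed.

Lemma bochnerN f : bint f ->
  bochner_integral P (fun w => - f w) = - bochner_integral P f.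
Proof.
move=> bf; rewrite (_ : (fun _ => _) = (fun w => 0 - f w)).
  by rewrite bochnerB ?bochner0 ?sub0r//; exact: bint_cst.
by apply/funext => w; rewrite sub0r.
Qed.

Lemma bintD f g : bint f -> bint g -> bint (fun w => f w + g w).
Proof.
move=> bf bg; rewrite (_ : (fun _ => _) = (fun w => f w - (- g w))).
  by apply: bintB => //; exact: bintN.
by apply/funext => w; rewrite opprK.
Qed.

Lemma bochnerD f g : bint f -> bint g ->
  bochner_integral P (fun w => f w + g w) =
  bochner_integral P f + bochner_integral P g.
Proof.
move=> bf bg; rewrite (_ : (fun _ => _) = (fun w => f w - (- g w))).
  by rewrite bochnerB ?bochnerN ?opprK//; exact: bintN.
by apply/funext => w; rewrite opprK.
Qed.

Lemma bintM (c : T -> R[i]) M f : cmeas c -> (forall w, cmod (c w) <= M) ->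
  bint f -> bint (fun w => c w *: f w).
Proof.
move=> mc cM [mf intf]; split; first exact: smeasZ.
apply: (@le_lt_trans _ _ (\int[P]_w ((`|M|)%:E * (rnorm (f w))%:E))%E).
  apply: ge0_le_integral => //.
  - by move=> w _; rewrite lee_fin rnorm_ge0.
  - by apply: measurable_rnormE; exact: smeasZ.
  - by apply: measurable_funeM; exact: measurable_rnormE.
  - move=> w _; rewrite lee_fin rnormZ ler_wpM2r ?rnorm_ge0//.
    exact: le_trans (cM w) (ler_norm _).
rewrite ge0_integralZl//; first by rewrite lte_mul_pinfty// lee_fin.
- exact: measurable_rnormE.
- by move=> w _; rewrite lee_fin rnorm_ge0.
Qed.

Lemma bintZ (c : R[i]) f : bint f -> bint (fun w => c *: f w).
Proof. by apply: (bintM (M := cmod c)) => //; exact: cmeas_cst. Qed.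

Lemma bochnerZ (c : R[i]) f : bint f ->
  bochner_integral P (fun w => c *: f w) = c *: bochner_integral P f.
Proof.
move=> bf; have [mf _] := bf; have [s [ss s0] sv] := bint_approx bf.
apply: (@bochner_uniq _ (fun n w => c *: s n w)); first exact: bintZ.
- split=> [n|]; first exact: (simple_map (fun x => c *: x) (ss n)).
  have mfs n := smeasB mf (simple_smeas (ss n)).
  rewrite (_ : (fun n => _) = (fun n => (cmod c)%:E *
      \int[P]_w (rnorm (f w - s n w))%:E)%E).
    exact: cvg_ereal0M.
  apply/funext => n; rewrite -ge0_integralZl//.
  + by apply: eq_integral => w _; rewrite -scalerBr rnormZ.
  + exact: measurable_rnormE.
  + by move=> w _; rewrite lee_fin rnorm_ge0.
  + by rewrite lee_fin cmod_ge0.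
- rewrite (_ : (fun n => _) = (fun n => c *: simple_integral P (s n))).
    by apply: cvgZ => //; exact: cvg_cst.
  apply/funext => n; rewrite (simple_integral_map P (fun x => c *: x) (ss n)).
  rewrite (simple_integral_map P id (ss n)) scaler_sumr.
  by apply: eq_bigr => y _; rewrite !scalerA mulrC.
Qed.

End BochnerIntegral.

Section BochnerConvergence.
Context (R : realType) (X : completeNormedModType R[i]) (d : measure_display)
  (T : measurableType d) (P : probability T R).
Implicit Types (f g h : T -> X).

Lemma bochner_simple (s : T -> X) : simple s ->
  bint P s /\ bochner_integral P s = simple_integral P s.
Proof.
move=> ss; have bs : bint P s.
  split; first exact: simple_smeas.
  by rewrite (@integral_simple _ _ _ P _ _ (@rnorm R X) ss) ?sumEFin ?ltry// => ?; exact: rnorm_ge0.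
split=> //; apply: (@bochner_uniq _ _ _ _ _ _ (fun=> s)) => //; last exact: cvg_cst.
split=> //; rewrite (_ : (fun=> _) = fun=> 0%E); first exact: cvg_cst.
apply/funext => n; under eq_integral do rewrite subrr rnorm0.
by rewrite integral0.
Qed.

Lemma bochner_cvg (g : nat -> T -> X) f (v : nat -> X) (l : X) :
  bint P f -> (forall n, bint P (g n)) ->
  (\int[P]_w (rnorm (f w - g n w))%:E)%E @[n --> \oo] --> (0 : \bar R)%E ->
  (forall n, bochner_integral P (g n) = v n) -> v n @[n --> \oo] --> l ->
  bochner_integral P f = l.
Proof.
move=> bf bg gf gv vl.
have vf : v n @[n --> \oo] --> bochner_integral P f.
  apply/cvg_rnormP; apply: (cvg_le_EFin0 _ _ gf) => n; first exact: rnorm_ge0.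
  rewrite rnorm_distC -gv -bochnerB//; apply: ler_bochner; exact: bintB.
exact: (cvg_unique (@norm_hausdorff _ X) vf vl).
Qed.

(** The passage to the limit behind every analytic multiplier below: identities proved for
    polynomials are carried to Neumann series, Cauchy kernels and boundary values. *)
Lemma bochner_cvgM (c : nat -> T -> R[i]) (e : T -> R[i]) f M (v : nat -> X) (l : X) :
  (forall n, cmeas (c n)) -> cmeas e ->
  (forall n w, cmod (c n w) <= M) -> (forall w, cmod (e w) <= M) ->
  {ae P, forall w, cmod (c n w - e w) @[n --> \oo] --> (0 : R)} -> bint P f ->
  (forall n, bochner_integral P (fun w => c n w *: f w) = v n) ->
  v n @[n --> \oo] --> l -> bochner_integral P (fun w => e w *: f w) = l.
Proof.
move=> mc me cM eM ce bf cv vl; have [mf intf] := bf.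
apply: (@bochner_cvg (fun n w => c n w *: f w) _ v) => //.
- exact: bintM eM bf.
- by move=> n; exact: bintM (cM n) bf.
apply: (@dominated_cvg0_real _ _ _ P _ (fun w => (M + M) * rnorm (f w))).
- move=> n; apply: measurable_rnorm; apply: smeasB; exact: smeasZ.
- by apply: measurable_funM => //; exact: measurable_rnorm.
- apply: filterS ce => w cw.
  under eq_cvg do rewrite -scalerBl rnormZ -cmodN opprB.
  exact: cvg0Mr.
- move=> n w; rewrite rnorm_ge0/= -scalerBl rnormZ ler_wpM2r ?rnorm_ge0//.
  by apply: le_trans (ler_cmodB _ _) _; rewrite lerD.
- have M0 : 0 <= M + M.
    by have w := point : T; rewrite addr_ge0 ?(le_trans (cmod_ge0 _) (eM w)).
  under eq_integral do rewrite EFinM.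
  rewrite ge0_integralZl//.
  + by rewrite lte_mul_pinfty// ?lee_fin.
  + exact: measurable_rnormE.
  + by move=> w _; rewrite lee_fin rnorm_ge0.
Qed.

Lemma integrable_bounded (r : T -> R) M : measurable_fun setT r ->
  (forall w, `|r w| <= M) -> P.-integrable setT (EFin \o r).
Proof.
move=> mr rM; apply/integrableP; split; first exact/measurable_EFinP.
apply: (@le_lt_trans _ _ (\int[P]_w M%:E)%E).
  apply: ge0_le_integral => //.
  - by apply: measurableT_comp => //; exact/measurable_EFinP.
  - by move=> w _ /=; rewrite lee_fin.
by rewrite integral_cst//= probability_setT mule1 ltry.
Qed.

Lemma Rintegral_cst_prob (r : R) : \int[P]_w r = r.
Proof. by rewrite Rintegral_cst//= probability_setT mulr1. Qed.

Lemma bochner_real_ge0 (r : T -> R) M (v : X) : measurable_fun setT r ->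
  (forall w, 0 <= r w <= M) ->
  bochner_integral P (fun w => (r w)%:C *: v) = (\int[P]_w r w)%:C *: v.
Proof.
move=> mr rM.
have r0 w : 0 <= r w by case/andP: (rM w).
have rM' w : r w <= M by case/andP: (rM w).
have cr : cmeas (fun w => (r w)%:C) by split.
have bv : bint P (fun w => (r w)%:C *: v).
  apply: (bintM (M := M) cr); last exact: bint_cst.
  by move=> w; rewrite cmod_real ger0_norm.
have mrE : measurable_fun setT (EFin \o r) by exact/measurable_EFinP.
pose p := nnsfun_approx measurableT mrE.
have sp n : simple (p n).
  split; first exact: fimfunP.
  by move=> y; rewrite -[X in measurable X]setTI; exact: measurable_funP.
have svp n : simple (fun w => (p n w)%:C *: v) := simple_map (fun x : R => x%:C *: v) (sp n).
have pcvg w : p n w @[n --> \oo] --> r w.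
  have /fine_cvgP[_] : EFin \o (p^~ w) @ \oo --> (EFin \o r) w.
    by apply: cvg_nnsfun_approx => // x _; rewrite lee_fin.
  exact.
have pr n w : p n w <= r w.
  rewrite -(cvg_lim (@Rhausdorff R) (pcvg w)).
  apply: (@nondecreasing_cvgn_le _ (fun n => p n w)); last by apply/cvg_ex; exists (r w).
  by move=> k m km; exact/lefP/nd_nnsfun_approx.
have pd0 w : (r w - p n w) @[n --> \oo] --> (0 : R).
  by rewrite -(subrr (r w)); apply: cvgB => //; exact: cvg_cst.
have iM : (\int[P]_w M%:E < +oo)%E.
  by rewrite integral_cst//= probability_setT mule1 ltry.
have dpr : (\int[P]_w (r w - p n w)%:E)%E @[n --> \oo] --> (0 : \bar R)%E.
  apply: (@dominated_cvg0_real _ _ _ P _ (fun w => M)) => //.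
  - by move=> n; apply: measurable_funB.
  - exact: nearW.
  - move=> n w; rewrite subr_ge0 pr/=; apply: le_trans (rM' w).
    by rewrite lerBlDr lerDl.
apply: (@bochner_cvg (fun n w => (p n w)%:C *: v) _ (fun n => (\int[P]_w p n w)%:C *: v)) => //.
- by move=> n; have [] := bochner_simple (svp n).
- rewrite (_ : (fun n => _) = (fun n => (rnorm v)%:E * \int[P]_w (r w - p n w)%:E)%E).
    exact: cvg_ereal0M.
  apply/funext => n; rewrite -ge0_integralZl//.
  + apply: eq_integral => w _; rewrite -scalerBl -rmorphB rnormZ cmod_real mulrC.
    by rewrite ger0_norm ?subr_ge0.
  + by apply/measurable_EFinP; apply: measurable_funB.
  + by move=> w _; rewrite lee_fin subr_ge0.
  + by rewrite lee_fin rnorm_ge0.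
- move=> n; have [_ ->] := bochner_simple (svp n).
  rewrite (simple_integral_map P (fun x : R => x%:C *: v) (sp n)).
  rewrite /Rintegral.
  (* [integral_simple] asks for a function nonnegative on the whole line, not only on the range of
     [p n]; hence the maximum with 0. *)
  have -> : (\int[P]_w (p n w)%:E)%E = (\int[P]_w (Num.max 0 (p n w))%:E)%E.
    by apply: eq_integral => w _; rewrite max_r.
  rewrite (@integral_simple _ _ _ P _ (p n) (Num.max 0)) ?sumEFin//=; last first.
    by move=> y; rewrite le_max lexx.
  rewrite rmorph_sum/= scaler_suml [LHS]big_seq [RHS]big_seq; apply: eq_bigr => y.
  rewrite in_fset_set; last by case: (sp n).
  move=> /set_mem[w _ <-]; rewrite max_r// scalerA; congr (_ *: _).
  by rewrite -rmorphM mulrC.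
- have ir : P.-integrable setT (EFin \o r).
    by apply: (integrable_bounded mr) => w; rewrite ger0_norm.
  have ip n : P.-integrable setT (EFin \o p n).
    apply: (@integrable_bounded _ M) => // w; rewrite ger0_norm//.
    exact: le_trans (pr n w) (rM' w).
  apply/cvg_rnormP; apply: (@cvg_le_EFin0 _ _
    (fun n => (rnorm v)%:E * \int[P]_w (r w - p n w)%:E)%E).
  + by move=> n; exact: rnorm_ge0.
  + move=> n; rewrite -scalerBl -rmorphB rnormZ cmod_real mulrC distrC.
    rewrite -RintegralB// ger0_norm; last first.
      by apply: Rintegral_ge0 => w _; rewrite subr_ge0.
    rewrite EFinM /Rintegral fineK// ge0_fin_numE; last first.
      by apply: integral_ge0 => w _; rewrite lee_fin subr_ge0.
    apply: le_lt_trans iM; apply: ge0_le_integral => //.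
    * by move=> w _; rewrite lee_fin subr_ge0.
    * by apply/measurable_EFinP; apply: measurable_funB.
    * by move=> w _; rewrite lee_fin; apply: le_trans (rM' w); rewrite lerBlDr lerDl.
  + exact: cvg_ereal0M.
Qed.

End BochnerConvergence.

Section BochnerBounded.
Context (R : realType) (X : completeNormedModType R[i]) (d : measure_display)
  (T : measurableType d) (P : probability T R).

Lemma bint_real (r : T -> R) M (v : X) : measurable_fun setT r ->
  (forall w, `|r w| <= M) -> bint P (fun w => (r w)%:C *: v).
Proof.
move=> mr rM; apply: (bintM (M := M)); [by split| |exact: bint_cst].
by move=> w; rewrite cmod_real.
Qed.

Lemma bochner_real (r : T -> R) M (v : X) : measurable_fun setT r ->
  (forall w, `|r w| <= M) ->
  bochner_integral P (fun w => (r w)%:C *: v) = (\int[P]_w r w)%:C *: v.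
Proof.
move=> mr rM.
have M0 : 0 <= M by apply: le_trans (rM point); exact: normr_ge0.
have rM0 w : 0 <= r w + M <= M + M.
  by have := rM w; rewrite ler_norml => /andP[h1 h2]; rewrite -lerBlDr sub0r h1 lerD.
have mrM : measurable_fun setT (fun w => r w + M) by apply: measurable_funD.
rewrite (_ : (fun _ => _) = (fun w => (r w + M)%:C *: v - M%:C *: v)); last first.
  by apply/funext => w; rewrite -scalerBl -rmorphB addrK.
rewrite bochnerB; last 2 first.
- by apply: (bint_real (M := M + M) v mrM) => w; rewrite ger0_norm; case/andP: (rM0 w).
- exact: bint_cst.
rewrite (bochner_real_ge0 P v mrM rM0).
rewrite (bochner_real_ge0 P (r := fun=> M) (M := M) v)//; last by move=> w; rewrite M0 lexx.
rewrite -scalerBl -rmorphB -RintegralB//.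
- by congr (_ %:C *: _); apply: eq_Rintegral => w _; rewrite addrK.
- by apply: (integrable_bounded P (M := M + M) mrM) => w; rewrite ger0_norm; case/andP: (rM0 w).
- by apply: (integrable_bounded P (M := M)) => // w; rewrite ger0_norm.
Qed.

Lemma bochner_sum (I : eqType) (r : seq I) (f : I -> T -> X) :
  (forall i, i \in r -> bint P (f i)) ->
  bint P (fun w => \sum_(i <- r) f i w) /\
  bochner_integral P (fun w => \sum_(i <- r) f i w) =
  \sum_(i <- r) bochner_integral P (f i).
Proof.
elim: r => [|i r IH] bf.
  rewrite big_nil; under [fun _ => _]eq_fun do rewrite big_nil.
  by split; [exact: bint_cst|exact: bochner0].
have [|b1 b2] := IH; first by move=> j jr; apply: bf; rewrite inE jr orbT.
have bi : bint P (f i) by apply: bf; rewrite mem_head.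
under [fun _ => _]eq_fun do rewrite big_cons.
by rewrite big_cons; split; [exact: bintD|rewrite bochnerD// b2].
Qed.

Lemma simple_integral_widen (s : T -> X) (A : {fset X}) :
  simple s -> (forall w, s w \in A) ->
  simple_integral P s = \sum_(v <- A) (fine (P (s @^-1` [set v])))%:C *: v.
Proof.
move=> [fs ms] sA; rewrite /simple_integral (@fsbig_widen _ _ _ _ (range s) [set` A]).
- by rewrite -fsbig_seq.
- by move=> _ [w _ <-] /=.
- move=> v [_ /= nv]; rewrite (_ : _ @^-1` _ = set0) ?measure0 ?scale0r//.
  by apply/seteqP; split => // w /= swv; apply: nv; exists w.
Qed.

End BochnerBounded.

(** * Vector-valued integrals through sections *)

Section VectorFubini.
Context (R : realType) (X : completeNormedModType R[i]) (d e : measure_display)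
  (T : measurableType d) (S : measurableType e)
  (P : probability T R) (Q : probability S R) (u : T * S -> T).
Hypothesis mu : measurable_fun setT u.
Hypothesis Pu : forall g : T -> \bar R, measurable_fun setT g ->
  (forall w, 0 <= g w)%E ->
  (\int[P]_w g w = \int[P]_w \int[Q]_y g (u (w, y)))%E.
Implicit Types f : T -> X.

Lemma measurable_section w : measurable_fun setT (fun y => u (w, y)).
Proof. exact: measurableT_comp mu (measurable_pair1 w). Qed.

Lemma measurable_int_section (g : T -> \bar R) : measurable_fun setT g ->
  (forall w, 0 <= g w)%E -> measurable_fun setT (fun w => \int[Q]_y g (u (w, y)))%E.
Proof.
move=> mg g0; apply: (measurable_fun_fubini_tonelli_F (g \o u)).
- exact: measurableT_comp.
- by move=> p; exact: g0.
Qed.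

Lemma ae_int_section_lty (g : T -> \bar R) : measurable_fun setT g ->
  (forall w, 0 <= g w)%E -> (\int[P]_w g w < +oo)%E ->
  {ae P, forall w, (\int[Q]_y g (u (w, y)) < +oo)%E}.
Proof.
move=> mg g0; rewrite Pu// => ig.
have g0' w : (0 <= \int[Q]_y g (u (w, y)))%E by apply: integral_ge0.
have : P.-integrable setT (fun w => \int[Q]_y g (u (w, y)))%E.
  apply/integrableP; split; first exact: measurable_int_section.
  by under eq_integral do rewrite gee0_abs//.
move=> /integrable_ae -/(_ measurableT); apply: filterS => w /(_ I).
by rewrite ge0_fin_numE.
Qed.

Lemma ae_bint_section f : bint P f ->
  {ae P, forall w, bint Q (fun y => f (u (w, y)))}.
Proof.
move=> [mf intf].
have f0 w : (0 <= (rnorm (f w))%:E)%E by rewrite lee_fin rnorm_ge0.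
have := ae_int_section_lty (measurable_rnormE mf) f0 intf.
by apply: filterS => w fw; split=> //; exact: (smeas_comp (measurable_section w) mf).
Qed.

(** The section integral of a simple function is a finite sum of its values [v] with scalar weights
    [r v w], the measures of the sections of its level sets. The scalar hypothesis [Pu] integrates
    these weights, and [ler_bochner] does the rest. *)
Lemma ler_simple_integral_section (s : T -> X) : simple s ->
  ((rnorm (simple_integral P s))%:E <=
   \int[P]_w (rnorm (simple_integral Q (fun y => s (u (w, y)))))%:E)%E /\
  measurable_fun setT (fun w => rnorm (simple_integral Q (fun y => s (u (w, y))))).
Proof.
move=> ss; have [fs ms] := ss; pose A := fset_set (range s).
pose r v w := fine (Q ((fun y => s (u (w, y))) @^-1` [set v])).
have sA w : s w \in A by rewrite in_fset_set//; apply/mem_set; exists w.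
have QI v w : Q ((fun y => s (u (w, y))) @^-1` [set v]) =
    (\int[Q]_y (\1_(s @^-1` [set v]) (u (w, y)))%:E)%E.
  rewrite -[_ @^-1` _]setIT -integral_indic//.
  by rewrite -[X in measurable X]setTI; exact: measurable_section (ms v).
have i0 v w : (0 <= (\1_(s @^-1` [set v]) w : R)%:E)%E by rewrite lee_fin.
have mi v : measurable_fun setT (fun w => (\1_(s @^-1` [set v]) w : R)%:E).
  by apply/measurable_EFinP; exact: measurable_indic.
have mr v : measurable_fun setT (r v).
  apply/measurable_EFinP.
  rewrite (_ : EFin \o r v = fun w => (\int[Q]_y (\1_(s @^-1` [set v]) (u (w, y)))%:E)%E).
    exact: measurable_int_section (mi v) (i0 v).
  apply/funext => w; rewrite -QI /= fineK// fin_num_measure//.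
  by rewrite -[X in measurable X]setTI; exact: measurable_section (ms v).
have r1 v w : `|r v w| <= 1.
  have mq : measurable ((fun y => s (u (w, y))) @^-1` [set v]).
    by rewrite -[X in measurable X]setTI; exact: measurable_section (ms v).
  rewrite ger0_norm ?fine_ge0// -lee_fin fineK ?fin_num_measure//.
  exact: probability_le1.
have su w : simple (fun y => s (u (w, y))).
  split; first by apply: sub_finite_set fs => _ [y _ <-]; exists (u (w, y)).
  by move=> v; rewrite -[X in measurable X]setTI; exact: measurable_section (ms v).
have IE w : simple_integral Q (fun y => s (u (w, y))) =
    \sum_(v <- A) (r v w)%:C *: v.
  exact: (simple_integral_widen Q (su w)).
have [|bI bIE] := @bochner_sum _ X _ _ P _ A (fun v w => (r v w)%:C *: v).
  by move=> v _; apply: bint_real (r1 v).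
under [fun w => rnorm _]eq_fun do rewrite IE.
under eq_integral do rewrite IE.
split; last by apply: measurable_rnorm; case: bI.
suff -> : simple_integral P s = bochner_integral P (fun w => \sum_(v <- A) (r v w)%:C *: v).
  exact: ler_bochner.
rewrite bIE (simple_integral_widen P ss sA); apply: eq_bigr => v _.
rewrite (bochner_real P v (mr v) (r1 v)); congr (_ %:C *: _); congr fine.
rewrite -[_ @^-1` _]setIT -integral_indic// Pu//.
apply: eq_integral => w _; rewrite -QI fineK//; apply: fin_num_measure.
by case: (su w).
Qed.

(** Work with the approximants: since the section integrals of [f] vanish, those of [s n] are
    bounded by the section integrals of [|f - s n|], whose total mass tends to 0. *)
Lemma bochner_section0 f : bint P f ->
  {ae P, forall w, bochner_integral Q (fun y => f (u (w, y))) = 0} ->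
  bochner_integral P f = 0.
Proof.
move=> bf f0; have [mf _] := bf; have [s [ss s0] sv] := bint_approx bf.
apply: (cvg_unique (@norm_hausdorff _ X) sv).
apply/cvg_rnormP; under eq_cvg do rewrite subr0.
apply: (cvg_le_EFin0 _ _ s0) => n; first exact: rnorm_ge0.
have [h mI] := ler_simple_integral_section (ss n).
apply: le_trans h _.
have mfs : smeas (fun w => f w - s n w) by apply: smeasB => //; exact: simple_smeas (ss n).
have fs0 w : (0 <= (rnorm (f w - s n w))%:E)%E by rewrite lee_fin rnorm_ge0.
rewrite (Pu (measurable_rnormE mfs) fs0).
apply: ae_ge0_le_integral => //.
- by move=> w _; rewrite lee_fin rnorm_ge0.
- exact/measurable_EFinP.
- by move=> w _; apply: integral_ge0.
- exact: measurable_int_section (measurable_rnormE mfs) fs0.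
have := ae_bint_section bf; move: f0; apply: filterS2 => w f0 bfw _.
have [su1 su2] : simple (fun y => s n (u (w, y))).
  have [fs ms] := ss n.
  split; first by apply: sub_finite_set fs => _ [y _ <-]; exists (u (w, y)).
  by move=> v; rewrite -[X in measurable X]setTI; exact: measurable_section (ms v).
have [bs <-] := bochner_simple Q (conj su1 su2).
rewrite -rnormN -[- _]sub0r -[0 in X in rnorm X]f0 -bochnerB//.
exact: ler_bochner (bintB bfw bs).
Qed.

End VectorFubini.

(** * Resampling a coordinate of the torus *)

Section Torus.
Context (R : realType).
Local Notation T := (torusN R).
Local Notation C := (circle R).

(** The carrier is the full product for every [I] and only the sigma-algebra varies, so a function
    on the torus is adapted when it is strongly measurable on the matching [subtorus], without any
    factorization through finitely many coordinates. *)
Definition subtorus (I : set nat) := g_sigma_algebraType (@coordinate_events R I).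

Lemma measurable_replace (I : set nat) (k : nat) :
  measurable_fun setT
    (fun p : subtorus I * C => replace_coordinate p.1 k p.2 : subtorus I).
Proof.
apply: (@measurability _ _ _ (subtorus I) _ _ (coordinate_events I)) => //.
move=> _ [_ [i Ii [B mB <-]] <-]; rewrite !setTI.
have [->|ik] := eqVneq i k.
  rewrite (_ : _ @^-1` _ = setT `*` B); first exact: measurableX.
  by apply/seteqP; split=> [[w y]|[w y]]; rewrite /replace_coordinate/= eqxx//= => -[].
rewrite (_ : _ @^-1` _ = ((fun w : nat -> C => w i) @^-1` B) `*` setT).
  apply: measurableX => //; apply: sub_sigma_algebra; exists i => //.
  by exists B => //; rewrite setTI.
by apply/seteqP; split=> [[w y]|[w y]]; rewrite /replace_coordinate/= (negbTE ik)//= => -[].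
Qed.

Lemma measurable_coordinate (I : set nat) k : I k ->
  measurable_fun setT (fun w : subtorus I => w k).
Proof.
move=> Ik _ B mB; apply: sub_sigma_algebra; exists k => //.
by exists B.
Qed.

Lemma replace_idem (w : T) k y y' :
  replace_coordinate (replace_coordinate w k y) k y' = replace_coordinate w k y'.
Proof. by apply/funext => i; rewrite /replace_coordinate; case: eqP. Qed.

Lemma replace_self (w : T) k : replace_coordinate w k (w k) = w.
Proof. by apply/funext => i; rewrite /replace_coordinate; case: eqP => // ->. Qed.

Lemma replace_same (w : T) k y : replace_coordinate w k y k = y.
Proof. by rewrite /replace_coordinate eqxx. Qed.

(** The sets that ignore coordinate [k] form a sigma-algebra, and it contains the generators. *)
Lemma filtration_replace (I : set nat) k (A : set (subtorus I)) : ~ I k ->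
  measurable A -> forall w y, A (replace_coordinate w k y) = A w.
Proof.
move=> Ik mA.
suff h : <<s coordinate_events I >> `<=`
    [set A : set (nat -> C) | forall w y, A (replace_coordinate w k y) = A w].
  exact: (h A mA).
apply: smallest_sub.
- split=> //= [B hB w y|F hF w y]; first by rewrite /setD/= hB.
  by rewrite /bigcup/=; apply/propext; split=> -[n _ Fn]; exists n => //; move: Fn; rewrite hF.
- move=> _ [i Ii [B mB <-]] w y; rewrite !setTI /preimage/= /replace_coordinate.
  by case: eqP => // ik; case: Ik; rewrite -ik.
Qed.

Lemma smeas_replace (X : normedModType R[i]) (I : set nat) k (f : subtorus I -> X) :
  ~ I k -> smeas f -> forall w y, f (replace_coordinate w k y) = f w.
Proof.
move=> Ik [s [ss sf]] w y.
have sE n : s n (replace_coordinate w k y) = s n w.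
  have [_ ms] := ss n.
  have := filtration_replace Ik (ms (s n w)) w y.
  by rewrite /preimage/= => ->.
have := sf (replace_coordinate w k y).
rewrite (_ : (fun n => s n (replace_coordinate w k y)) = (fun n => s n w)); last exact/funext.
by move=> h; exact: (cvg_unique (@norm_hausdorff _ X) h (sf w)).
Qed.

Lemma sub_filtration (I J : set nat) (A : set (subtorus I)) : I `<=` J ->
  measurable A -> @measurable _ (subtorus J) A.
Proof.
move=> IJ; apply: sub_sigma_algebra2 => _ [i Ii [B mB <-]].
by exists i; [exact: IJ|exists B].
Qed.

Lemma smeas_sub (X : normedModType R[i]) (I J : set nat) (f : subtorus I -> X) :
  I `<=` J -> smeas f -> @smeas R X _ (subtorus J) f.
Proof.
move=> IJ [s [ss sf]]; exists s; split=> // n; have [fs ms] := ss n; split=> // v.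
exact: sub_filtration IJ (ms v).
Qed.

Lemma smeas_torus (X : normedModType R[i]) (f : T -> X) :
  @smeas R X _ (subtorus setT) f -> smeas f.
Proof. by []. Qed.

Lemma measurable_replaceT (k : nat) :
  measurable_fun setT (fun p : T * C => replace_coordinate p.1 k p.2 : T).
Proof. exact: (@measurable_replace setT k). Qed.

Definition cylinder : set (set T) :=
  [set B | exists n (A : nat -> set C), (forall i, measurable (A i)) /\
     B = [set w | forall i, (i < n)%N -> A i (w i)]].

Lemma measurable_cylinder : cylinder `<=` measurable.
Proof.
move=> _ [n [A [mA ->]]].
rewrite (_ : [set w | _] = \bigcap_i ((fun w : T => w i) @^-1` (if (i < n)%N then A i else setT))).
  apply: bigcapT_measurable => i; rewrite -[X in measurable X]setTI.
  by apply: (@measurable_coordinate setT) => //; case: ifP.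
apply/seteqP; split=> w /= h i; first by move=> _; rewrite /preimage/=; case: ifP => //; exact: h.
by move=> ni; have := h i I; rewrite /preimage/= ni.
Qed.

Lemma torus_cylinder : @measurable _ T = <<s cylinder >>.
Proof.
apply/seteqP; split; last first.
  apply: smallest_sub; [exact: sigma_algebra_measurable|exact: measurable_cylinder].
apply: sub_sigma_algebra2 => _ [i _ [B mB <-]].
exists i.+1, (fun j => if j == i then B else setT); split.
  by move=> j; case: ifP.
rewrite setTI; apply/seteqP; split=> [w /= Bw j _|w /(_ i (ltnSn i))]; last by rewrite eqxx.
by case: eqP => [->|].
Qed.

Lemma cylinder_setI : setI_closed cylinder.
Proof.
move=> _ _ [n [A [mA ->]]] [m [B [mB ->]]].
exists (maxn n m), (fun i => (if (i < n)%N then A i else setT) `&`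
  (if (i < m)%N then B i else setT)); split.
  by move=> i; apply: measurableI; case: ifP.
apply/seteqP; split=> w /=.
  by move=> [h1 h2] i _; split; case: ifP => // ?; [exact: h1|exact: h2].
move=> h; split=> i ii.
  have im : (i < maxn n m)%N by rewrite leq_max ii.
  by have [+ _] := h i im; rewrite ii.
have im : (i < maxn n m)%N by rewrite leq_max ii orbT.
by have [_] := h i im; rewrite ii.
Qed.

Context (P : probability T R).
Hypothesis hP : torus_haar P.
Local Notation m := (@circle_haar R).

(** The law of the resampled point is compared with [P] on cylinders, a pi-system: factor [k]
    becomes the whole circle under [P] and reappears as the factor measured by the Haar measure of
    the new coordinate. *)
Lemma torus_resample (k : nat) (g : T -> \bar R) : measurable_fun setT g ->
  (forall w, 0 <= g w)%E ->
  (\int[P]_w g w = \int[P]_w \int[m]_y g (replace_coordinate w k y))%E.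
Proof.
move=> mg g0; pose u := fun p : T * C => replace_coordinate p.1 k p.2 : T.
have mu := measurable_replaceT k.
transitivity (\int[pushforward (P \x m)%E u]_w g w)%E; last first.
  rewrite ge0_integral_pushforward//= preimage_setT.
  rewrite (fubini_tonelli1 (g \o u))//; first exact: measurableT_comp.
  by move=> p; exact: g0.
apply: eq_measure_integral => A mA _.
apply: (measure_unique cylinder (fun=> setT) torus_cylinder cylinder_setI) => //.
- by move=> _; exists 0%N, (fun=> setT); split => //; apply/seteqP; split.
- by rewrite bigcup_const.
- move=> _ [n [B [mB ->]]].
  rewrite -[RHS]/((P \x m)%E (u @^-1` [set w | forall i, (i < n)%N -> B i (w i)])).
  rewrite (_ : u @^-1` _ =
    [set w | forall i, (i < n)%N -> (if i == k then setT else B i) (w i)] `*`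
    (if (k < n)%N then B k else setT)); last first.
    apply/seteqP; split=> [[w y] /= h|[w y] /= [h1 h2] i ni].
      split=> [i ni|]; first by have := h i ni; rewrite /u/replace_coordinate/=; case: eqP.
      by case: ifP => // kn; have := h k kn; rewrite /u/replace_coordinate/= eqxx.
    rewrite /u/replace_coordinate/=; case: eqP => [ik|/eqP ik].
      by move: h2; rewrite -ik ni.
    by have := h1 i ni; rewrite (negbTE ik).
  have mB' i : measurable (if i == k then setT else B i) by case: ifP.
  rewrite product_measure1E; last 2 first.
  + by apply: measurable_cylinder; exists n, (fun i => if i == k then setT else B i).
  + by case: ifP.
  transitivity (P [set w | forall i, (i < n)%N -> (if i == k then setT else B i) (w i)] *
    m (if (k < n)%N then B k else setT))%E; last by [].
  rewrite (hP n mB'); apply: (eq_trans (hP n mB)); case: ifP => kn.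
    rewrite (bigD1 (Ordinal kn))//= [in RHS](bigD1 (Ordinal kn))//= eqxx probability_setT mul1e muleC.
    congr (_ * _)%E; apply: eq_bigr => i ik; case: ifP => // /eqP ik'.
    by move: ik; rewrite -val_eqE/= ik' eqxx.
  rewrite probability_setT mule1; apply: eq_bigr => i _; case: ifP => // /eqP ik.
  by move: kn; rewrite -ik ltn_ord.
- by move=> _; apply: (le_lt_trans (@probability_le1 _ _ _ P setT measurableT) (ltry 1)).
Qed.

End Torus.

(** * Trigonometric polynomials and Fejer means *)

Section Circle.
Context (R : realType).
Local Notation C := (circle R).
Local Notation m := (@circle_haar R).

Lemma cmod_circle (y : C) : cmod (val y) = 1.
Proof. by apply: complexI; rewrite -cmodE; apply/eqP; exact: (valP y). Qed.

Lemma cmeas_circle : cmeas (fun y : C => val y).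
Proof.
have mc : measurable_fun setT (@circle_coord R).
  by move=> _ B mB; rewrite setTI; exists B => //; rewrite setTI.
by split; [exact: (measurableT_comp measurable_fst mc)|exact: (measurableT_comp measurable_snd mc)].
Qed.

Lemma cmeasD d (T : measurableType d) (c e : T -> R[i]) :
  cmeas c -> cmeas e -> cmeas (fun w => c w + e w).
Proof.
move=> mc me; rewrite (_ : (fun _ => _) = (fun w => c w - (0 - e w))).
  by apply: cmeasB => //; apply: cmeasB => //; exact: cmeas_cst.
by apply/funext => w; rewrite sub0r opprK.
Qed.

Lemma cmeasX d (T : measurableType d) (c : T -> R[i]) n :
  cmeas c -> cmeas (fun w => c w ^+ n).
Proof.
move=> mc; elim: n => [|n IH]; first exact: cmeas_cst.
by under eq_fun do rewrite exprS; exact: cmeasM.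
Qed.

Lemma cmeas_poly d (T : measurableType d) (c : T -> R[i]) (p : {poly R[i]}) :
  cmeas c -> cmeas (fun w => p.[c w]).
Proof.
move=> mc; elim/poly_ind: p => [|p a IH].
  by under eq_fun do rewrite horner0; exact: cmeas_cst.
under eq_fun do rewrite hornerMXaddC.
by apply: cmeasD; [exact: cmeasM|exact: cmeas_cst].
Qed.

Lemma integral_circle (g : C -> R) (f F : R -> R) : measurable_fun setT g ->
  (forall y, 0 <= g y) -> (forall t, g (expi t) = f t) -> continuous f ->
  (forall t : R, is_derive t 1 F (f t)) ->
  (\int[m]_y (g y)%:E = ((F (2 * pi) - F 0) / (2 * pi))%:E)%E.
Proof.
move=> mg g0 gf cf dF.
rewrite /circle_haar /distribution ge0_integral_pushforward//=; last 2 first.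
- exact/measurable_EFinP.
- by move=> y _; rewrite lee_fin.
rewrite preimage_setT integral_uniform//=; last 2 first.
- apply/measurable_EFinP; apply: measurableT_comp => //.
- by move=> t; rewrite lee_fin.
under eq_integral do rewrite gf.
rewrite (@continuous_FTC2 _ f F)//.
- by rewrite subr0 -EFinB -EFinM mulrC.
- exact: twopi_gt0.
- exact: continuous_subspaceT.
- have cF : continuous F.
    by move=> t; apply: differentiable_continuous; apply/derivable1_diffP; have [] := dF t.
  split.
  + by move=> t _; have [] := dF t.
  + by apply: cvg_at_right_filter; exact: cF.
  + by apply: cvg_at_left_filter; exact: cF.
- by move=> t _; rewrite derive1E; have [_ ->] := dF t.
Qed.

Lemma expiX (t : R) n : val (expi t) ^+ n = cos (n%:R * t) +i* sin (n%:R * t).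
Proof.
elim: n => [|n IH]; first by rewrite mul0r cos0 sin0.
rewrite exprS IH /= -natr1 mulrDl mul1r [_ + t]addrC cosD sinD.
by apply/eqP; rewrite eq_complex /= eqxx/= addrC eqxx.
Qed.

Lemma sin_natpi n : sin (n%:R * (2 * pi)) = 0 :> R.
Proof.
have -> : 2 * pi = pi *+ 2 :> R by rewrite mulr_natl.
elim: n => [|n IH]; first by rewrite mul0r sin0.
by rewrite -natr1 mulrDl mul1r sinD2pi.
Qed.

Lemma cos_natpi n : cos (n%:R * (2 * pi)) = 1 :> R.
Proof.
have -> : 2 * pi = pi *+ 2 :> R by rewrite mulr_natl.
elim: n => [|n IH]; first by rewrite mul0r cos0.
by rewrite -natr1 mulrDl mul1r cosD2pi.
Qed.

Lemma integral_Re_pow n : (0 < n)%N -> \int[m]_y complex.Re (val y ^+ n) = 0.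
Proof.
move=> n0; have [mR _] := cmeasX n cmeas_circle.
have nR : n%:R != 0 :> R by rewrite pnatr_eq0 -lt0n.
have rb (y : C) : `|complex.Re (val y ^+ n)| <= 1.
  by apply: le_trans (ler_Re_cmod _) _; rewrite cmodX cmod_circle expr1n.
(* [integral_circle] treats nonnegative functions; adding 1 makes the integrand nonnegative, and the
   constant is removed at the end. *)
have h : (\int[m]_y (1 + complex.Re (val y ^+ n))%:E = 1)%E.
  have ccos : continuous (fun t : R => cos (n%:R * t)).
    by move=> t; apply: continuous_comp; [exact: mulrl_continuous|exact: continuous_cos].
  have dF (t : R) : is_derive t 1 (id + (n%:R^-1 : R) \*: (sin \o (n%:R \*: id)) : R -> R)
      (1 + cos (n%:R * t)).
    apply: is_derive_eq.
    by rewrite /GRing.scale /= mulr1 [cos _ * _]mulrC mulKf.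
  rewrite (integral_circle _ _ _ _ dF).
  - rewrite !fctE /= /GRing.scale /= sin_natpi !mulr0 sin0 mulr0 !addr0 subr0.
    by rewrite divff// gt_eqF// twopi_gt0.
  - exact: measurable_funD.
  - by move=> y; have := rb y; rewrite ler_norml -lerBlDl sub0r => /andP[].
  - by move=> t; rewrite expiX.
  - by move=> t; apply: cvgD; [exact: cvg_cst|exact: ccos]. 
have : \int[m]_y (1 + complex.Re (val y ^+ n)) = 1 by rewrite /Rintegral h.
rewrite RintegralD//; last 2 first.
- by apply: (integrable_bounded m (M := 1)) => // ?; rewrite normr1.
- by apply: (integrable_bounded m (M := 1)).
rewrite Rintegral_cst_prob => h1; lra.
Qed.

Lemma integral_Im_pow n : (0 < n)%N -> \int[m]_y complex.Im (val y ^+ n) = 0.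
Proof.
move=> n0; have [_ mR] := cmeasX n cmeas_circle.
have nR : n%:R != 0 :> R by rewrite pnatr_eq0 -lt0n.
have rb (y : C) : `|complex.Im (val y ^+ n)| <= 1.
  by apply: le_trans (ler_Im_cmod _) _; rewrite cmodX cmod_circle expr1n.
have h : (\int[m]_y (1 + complex.Im (val y ^+ n))%:E = 1)%E.
  have csin : continuous (fun t : R => sin (n%:R * t)).
    by move=> t; apply: continuous_comp; [exact: mulrl_continuous|exact: continuous_sin].
  have dF (t : R) : is_derive t 1 (id - (n%:R^-1 : R) \*: (cos \o (n%:R \*: id)) : R -> R)
      (1 + sin (n%:R * t)).
    apply: is_derive_eq.
    by rewrite /GRing.scale /= mulr1 mulNr mulrN opprK [sin _ * _]mulrC mulKf.
  rewrite (integral_circle _ _ _ _ dF).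
  - rewrite !fctE /= /GRing.scale /= cos_natpi mulr0 cos0 mulr1 sub0r opprK subrK.
    by rewrite divff// gt_eqF// twopi_gt0.
  - exact: measurable_funD.
  - by move=> y; have := rb y; rewrite ler_norml -lerBlDl sub0r => /andP[].
  - by move=> t; rewrite expiX.
  - by move=> t; apply: cvgD; [exact: cvg_cst|exact: csin]. 
have : \int[m]_y (1 + complex.Im (val y ^+ n)) = 1 by rewrite /Rintegral h.
rewrite RintegralD//; last 2 first.
- by apply: (integrable_bounded m (M := 1)) => // ?; rewrite normr1.
- by apply: (integrable_bounded m (M := 1)).
rewrite Rintegral_cst_prob => h1; lra.
Qed.

Lemma measurable_Re_poly (p : {poly R[i]}) :
  measurable_fun setT (fun y : C => complex.Re p.[val y]).
Proof. by have [] := cmeas_poly p cmeas_circle. Qed.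

Lemma measurable_Im_poly (p : {poly R[i]}) :
  measurable_fun setT (fun y : C => complex.Im p.[val y]).
Proof. by have [] := cmeas_poly p cmeas_circle. Qed.

Lemma poly_circle_bounded (p : {poly R[i]}) :
  exists2 M, 0 < M & forall y : C, cmod p.[val y] <= M.
Proof.
elim/poly_ind: p => [|p a [M M0 IH]].
  by exists 1 => // y; rewrite horner0 cmod0.
exists (M + cmod a) => [|y]; first by rewrite ltr_pwDl// cmod_ge0.
rewrite hornerMXaddC (le_trans (ler_cmodD _ _))// lerD2r cmodM cmod_circle mulr1.
exact: IH.
Qed.

Lemma integrable_Re_poly (p : {poly R[i]}) :
  m.-integrable setT (fun y => (complex.Re p.[val y])%:E).
Proof.
have [M _ pM] := poly_circle_bounded p.
apply: (integrable_bounded m (measurable_Re_poly p) (M := M)) => y.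
exact: le_trans (ler_Re_cmod _) (pM y).
Qed.

Lemma integral_Re_poly (p : {poly R[i]}) :
  \int[m]_y complex.Re p.[val y] = complex.Re p.[0].
Proof.
have ReX (a b : R) n : \int[m]_y complex.Re ((a +i* b) * val y ^+ n) =
    if n is 0 then a else 0.
  have [mR mI] := cmeasX n cmeas_circle.
  have rb (y : C) : `|complex.Re (val y ^+ n)| <= 1.
    by apply: le_trans (ler_Re_cmod _) _; rewrite cmodX cmod_circle expr1n.
  have ib (y : C) : `|complex.Im (val y ^+ n)| <= 1.
    by apply: le_trans (ler_Im_cmod _) _; rewrite cmodX cmod_circle expr1n.
  have ir := integrable_bounded m mR rb.
  have ii := integrable_bounded m mI ib.
  rewrite (_ : (fun y => _) = fun y : C => a * complex.Re (val y ^+ n) -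
      b * complex.Im (val y ^+ n)); last first.
    by apply/funext => y; case: (_ ^+ n).
  rewrite RintegralB//; [|exact: (integrableZl measurableT a ir)|exact: (integrableZl measurableT b ii)].
  rewrite !RintegralZl//; case: n {mR mI rb ib} ir ii => [|n] ir ii.
    rewrite (_ : (fun y => complex.Re _) = fun=> 1); last by apply/funext.
    rewrite (_ : (fun y => complex.Im _) = fun=> 0); last by apply/funext.
    by rewrite !Rintegral_cst_prob mulr1 mulr0 subr0.
  by rewrite integral_Re_pow// integral_Im_pow// !mulr0 subr0.
have bX (q : {poly R[i]}) n : m.-integrable setT
    (fun y => (complex.Re (q.[val y] * val y ^+ n))%:E).
  by have := integrable_Re_poly (q * 'X^n); under eq_fun do rewrite hornerM hornerXn.
(* The extra power of [y] makes the Horner induction close: passing from [p] to [p * 'X + a] raises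
   [n] by one. The same device reappears in [bochner_poly]. *)
suff h n : \int[m]_y complex.Re (p.[val y] * val y ^+ n) =
    if n is 0 then complex.Re p.[0] else 0.
  by have := h 0%N; under eq_Rintegral do rewrite expr0 mulr1.
elim/poly_ind: p n => [|p a IH] n.
  under eq_Rintegral do rewrite horner0 mul0r.
  by rewrite Rintegral_cst_prob horner0; case: n.
rewrite (_ : (fun y => _) = fun y : C => complex.Re (p.[val y] * val y ^+ n.+1) +
    complex.Re (a%:P.[val y] * val y ^+ n)); last first.
  by apply/funext => y; rewrite hornerMXaddC hornerC mulrDl raddfD -mulrA -exprS.
rewrite RintegralD; [|exact: measurableT|exact: bX|exact: bX].
rewrite IH add0r; under eq_Rintegral do rewrite hornerC.
rewrite hornerMXaddC mulr0 add0r; case: a => a b.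
exact: ReX.
Qed.

(** The mean of [Re (p^2) = (Re p)^2 - (Im p)^2] is its value at the origin, which is a square when
    [p] is real there. This is the [L^2] bound for harmonic conjugation. *)
Lemma integral_poly_sqr (p : {poly R[i]}) : complex.Im p.[0] = 0 ->
  \int[m]_y complex.Im p.[val y] ^+ 2 <= \int[m]_y complex.Re p.[val y] ^+ 2.
Proof.
move=> p0; have [M M0 pM] := poly_circle_bounded p.
have iR : m.-integrable setT (fun y : C => (complex.Re p.[val y] ^+ 2)%:E).
  apply: (@integrable_bounded _ _ _ m (fun y : C => complex.Re p.[val y] ^+ 2) (M ^+ 2)).
    by apply: measurable_funX; exact: measurable_Re_poly.
  move=> y; rewrite normrX ler_pXn2r ?nnegrE ?(ltW M0)//.
  exact: le_trans (ler_Re_cmod _) (pM y).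
have iI : m.-integrable setT (fun y : C => (complex.Im p.[val y] ^+ 2)%:E).
  apply: (@integrable_bounded _ _ _ m (fun y : C => complex.Im p.[val y] ^+ 2) (M ^+ 2)).
    by apply: measurable_funX; exact: measurable_Im_poly.
  move=> y; rewrite normrX ler_pXn2r ?nnegrE ?(ltW M0)//.
  exact: le_trans (ler_Im_cmod _) (pM y).
rewrite -subr_ge0 -RintegralB//.
rewrite (_ : (fun y => _) = fun y : C => complex.Re (p ^+ 2).[val y]); last first.
  by apply/funext => y; rewrite horner_exp expr2; case: p.[val y].
rewrite integral_Re_poly horner_exp expr2; move: p0; case: p.[0] => a b /= ->.
by rewrite mulr0 subr0 -expr2 sqr_ge0.
Qed.

End Circle.

(** * Square-integrable real functions *)

Section SquareIntegrable.
Context (R : realType) (d : measure_display) (T : measurableType d)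
  (P : probability T R).
Implicit Types f g : T -> R.

Definition L2 f := measurable_fun setT f /\
  P.-integrable setT (fun w => (f w ^+ 2)%:E).

Lemma integrable_le f g : measurable_fun setT f ->
  P.-integrable setT (fun w => (g w)%:E) -> (forall w, `|f w| <= g w) ->
  P.-integrable setT (fun w => (f w)%:E).
Proof.
move=> mf ig fg; apply: le_integrable ig => //; first exact/measurable_EFinP.
by move=> w _ /=; rewrite lee_fin; apply: le_trans (fg w) (ler_norm _).
Qed.

Lemma RintegrableD f g : P.-integrable setT (fun w => (f w)%:E) ->
  P.-integrable setT (fun w => (g w)%:E) ->
  P.-integrable setT (fun w => (f w + g w)%:E).
Proof. by move=> fi gi; have := integrableD measurableT fi gi. Qed.

Lemma RintegrableZ (a : R) f : P.-integrable setT (fun w => (f w)%:E) ->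
  P.-integrable setT (fun w => (a * f w)%:E).
Proof. by move=> fi; have := integrableZl measurableT a fi. Qed.

Lemma integrable_cst_prob (a : R) : P.-integrable setT (fun w => a%:E).
Proof. exact: (@integrable_bounded _ _ _ P (fun=> a) `|a|). Qed.

Lemma L2_mul f g : L2 f -> L2 g -> P.-integrable setT (fun w => (f w * g w)%:E).
Proof.
move=> [mf fi] [mg gi]; apply: (@integrable_le _ (fun w => f w ^+ 2 + g w ^+ 2)).
- exact: measurable_funM.
- exact: RintegrableD.
- move=> w; rewrite normrM; rewrite -[f w ^+ 2]real_normK ?num_real//.
  rewrite -[g w ^+ 2]real_normK ?num_real//.
  have := normr_ge0 (f w); have := normr_ge0 (g w); set a := `|f w|; set b := `|g w|.
  by move=> a0 b0; have := sqr_ge0 (a - b); nra.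
Qed.

Lemma L2_bounded f M : measurable_fun setT f -> (forall w, `|f w| <= M) -> L2 f.
Proof.
move=> mf fM; split=> //.
apply: (@integrable_bounded _ _ _ P (fun w => f w ^+ 2) (M ^+ 2)).
  exact: measurable_funX.
move=> w; rewrite normrX ler_pXn2r ?nnegrE//.
exact: le_trans (fM w).
Qed.

Lemma L2_cst (a : R) : L2 (fun=> a).
Proof. exact: (L2_bounded (M := `|a|)). Qed.

Lemma L2_integrable f : L2 f -> P.-integrable setT (fun w => (f w)%:E).
Proof.
by move=> fi; have := L2_mul fi (L2_cst 1); under eq_fun do rewrite mulr1.
Qed.

Lemma L2Z (a : R) f : L2 f -> L2 (fun w => a * f w).
Proof.
move=> [mf fi]; split; first exact: measurable_funM.
by under eq_fun do rewrite exprMn; exact: RintegrableZ.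
Qed.

Lemma L2D f g : L2 f -> L2 g -> L2 (fun w => f w + g w).
Proof.
move=> fi gi; split; first by apply: measurable_funD; [case: fi|case: gi].
rewrite (_ : (fun _ => _) = fun w => (f w ^+ 2 + (2 * (f w * g w) + g w ^+ 2))%:E).
  apply: RintegrableD; first by case: fi.
  apply: RintegrableD; last by case: gi.
  by apply: RintegrableZ; exact: L2_mul.
by apply/funext => w; congr EFin; ring.
Qed.

Lemma L2B f g : L2 f -> L2 g -> L2 (fun w => f w - g w).
Proof.
move=> fi gi; have := L2D fi (L2Z (-1) gi).
by under eq_fun do rewrite mulN1r.
Qed.

Lemma le_int_sqrD f g : L2 f -> L2 g ->
  \int[P]_w (f w + g w) ^+ 2 <= 2 * \int[P]_w f w ^+ 2 + 2 * \int[P]_w g w ^+ 2.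
Proof.
move=> fi gi; have [_ fi2] := fi; have [_ gi2] := gi.
rewrite -!RintegralZl// -RintegralD//; last 2 first.
- exact: RintegrableZ.
- exact: RintegrableZ.
apply: le_Rintegral => //.
- by have [] := L2D fi gi.
- by apply: RintegrableD; exact: RintegrableZ.
- move=> w _; rewrite (_ : (f w + g w) ^+ 2 =
    2 * f w ^+ 2 + 2 * g w ^+ 2 - (f w - g w) ^+ 2); last by ring.
  by rewrite gerBl sqr_ge0.
Qed.

Lemma Rintegral_sum (I : eqType) (r : seq I) (F : I -> T -> R) :
  (forall i, i \in r -> P.-integrable setT (fun w => (F i w)%:E)) ->
  P.-integrable setT (fun w => (\sum_(i <- r) F i w)%:E) /\
  \int[P]_w (\sum_(i <- r) F i w) = \sum_(i <- r) \int[P]_w F i w.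
Proof.
elim: r => [|i r IH] Fi.
  under eq_fun do rewrite big_nil; under eq_Rintegral do rewrite big_nil.
  by rewrite Rintegral_cst_prob big_nil; split=> //; exact: integrable_cst_prob.
have [|b1 b2] := IH; first by move=> j jr; apply: Fi; rewrite inE jr orbT.
have bi : P.-integrable setT (fun w => (F i w)%:E) by apply: Fi; rewrite mem_head.
under eq_fun do rewrite big_cons; under eq_Rintegral do rewrite big_cons.
by rewrite big_cons; split; [exact: RintegrableD|rewrite RintegralD// b2].
Qed.

Lemma L2_intlty f : measurable_fun setT f -> (\int[P]_w (f w ^+ 2)%:E < +oo)%E -> L2 f.
Proof.
move=> mf fi; split=> //; apply/integrableP; split.
  by apply/measurable_EFinP; exact: measurable_funX.
by under eq_integral do rewrite /= ger0_norm ?sqr_ge0//.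
Qed.

Lemma L2_EFin f : L2 f -> (\int[P]_w (f w ^+ 2)%:E = (\int[P]_w f w ^+ 2)%:E)%E.
Proof. by move=> [_ fi]; rewrite /Rintegral fineK//; exact: integrable_fin_num. Qed.

End SquareIntegrable.

(** * Fejer means: positivity and contraction *)

Section Fejer.
Context (R : realType).
Local Notation C := (circle R).
Local Notation m := (@circle_haar R).
Implicit Types (s f g : C -> R) (y : C).

Definition ycos k y : R := complex.Re (val y ^+ k).
Definition ysin k y : R := complex.Im (val y ^+ k).

Definition fejer_weight N k : R := (if k == 0%N then 1 else 2) * (1 - k%:R / N.+1%:R).

Definition fourier s k : R[i] :=
  (\int[m]_y (s y * ycos k y)) +i* (- \int[m]_y (s y * ysin k y)).

(** For real [s] the negative frequencies mirror the positive ones. Doubling the latter in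
    [fejer_weight] gives an analytic polynomial whose real part on the circle is the Fejer mean, and
    whose imaginary part is the harmonic conjugate of that mean. *)
Definition fejer s N : {poly R[i]} :=
  \poly_(k < N.+1) ((fejer_weight N k)%:C * fourier s k).

Definition fejer_mean s N y : R := complex.Re (fejer s N).[val y].

Definition fejer_kernel N y y' : R :=
  \sum_(k < N.+1) fejer_weight N k * (ycos k y * ycos k y' + ysin k y * ysin k y').

Lemma measurable_ycos k : measurable_fun setT (ycos k).
Proof. by have [] := cmeasX k (@cmeas_circle R). Qed.

Lemma measurable_ysin k : measurable_fun setT (ysin k).
Proof. by have [] := cmeasX k (@cmeas_circle R). Qed.

Lemma ycos_le1 k y : `|ycos k y| <= 1.
Proof. by apply: le_trans (ler_Re_cmod _) _; rewrite cmodX cmod_circle expr1n. Qed.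

Lemma ysin_le1 k y : `|ysin k y| <= 1.
Proof. by apply: le_trans (ler_Im_cmod _) _; rewrite cmodX cmod_circle expr1n. Qed.

Lemma ycos0 y : ycos 0 y = 1. Proof. by []. Qed.
Lemma ysin0 y : ysin 0 y = 0. Proof. by []. Qed.

Lemma ycos_sqr k y : ycos k y ^+ 2 + ysin k y ^+ 2 = 1.
Proof. by rewrite -sqr_cmod cmodX cmod_circle !expr1n. Qed.

Lemma integrableMb f g M : m.-integrable setT (fun y => (f y)%:E) ->
  measurable_fun setT g -> (forall y, `|g y| <= M) ->
  m.-integrable setT (fun y => (f y * g y)%:E).
Proof.
move=> fi mg gM; have mf : measurable_fun setT f.
  by apply/measurable_EFinP; exact: measurable_int fi.
have := integrable_abse fi => /(RintegrableZ M) afi.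
apply: (@integrable_le _ _ _ m _ (fun y => M * `|f y|)).
- exact: measurable_funM.
- exact: afi.
- by move=> y; rewrite normrM mulrC ler_wpM2r.
Qed.

Lemma fejer_meanE s N y : m.-integrable setT (fun y => (s y)%:E) ->
  fejer_mean s N y = \int[m]_y' (s y' * fejer_kernel N y y').
Proof.
move=> si; rewrite /fejer_mean horner_poly raddf_sum /=.
have sc k : m.-integrable setT (fun y => (s y * ycos k y)%:E).
  exact: integrableMb si (measurable_ycos k) (ycos_le1 k).
have ss k : m.-integrable setT (fun y => (s y * ysin k y)%:E).
  exact: integrableMb si (measurable_ysin k) (ysin_le1 k).
rewrite (_ : (fun y' => _) = fun y' => \sum_(k < N.+1)
   (fejer_weight N k * ycos k y * (s y' * ycos k y') +
    fejer_weight N k * ysin k y * (s y' * ysin k y'))); last first.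
  by apply/funext => y'; rewrite mulr_sumr; apply: eq_bigr => k _; ring.
have [|_ ->] := @Rintegral_sum _ _ _ m _ (index_enum 'I_N.+1) (fun k y' =>
   fejer_weight N k * ycos k y * (s y' * ycos k y') +
    fejer_weight N k * ysin k y * (s y' * ysin k y')).
  by move=> k _; apply: RintegrableD; exact: RintegrableZ.
apply: eq_bigr => k _; rewrite RintegralD//; [|exact: RintegrableZ|exact: RintegrableZ].
rewrite (RintegralZl _ measurableT (sc k)) (RintegralZl _ measurableT (ss k)) /ycos /ysin; case: (val y ^+ k) => a b /=.
by rewrite !mul0r !subr0 !addr0; ring.
Qed.

Lemma cmodJ (z : R[i]) : cmod z^*%C = cmod z.
Proof. by rewrite /cmod !normc_def; case: z => a b /=; rewrite sqrrN. Qed.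

(** The square of the modulus counts each difference [k] of exponents [n - k] times. The induction
    expands the modulus of a sum of two terms; the new cross terms are the real parts of the powers
    [1] to [n] of [u]. *)
Lemma fejer_sum_sqr (u : R[i]) n : cmod u = 1 ->
  \sum_(k < n) (if (k : nat) == 0%N then 1 else 2) * (n%:R - k%:R) * complex.Re (u ^+ k) =
  cmod (\sum_(k < n) u ^+ k) ^+ 2.
Proof.
move=> u1; have uu : u * u^*%C = 1.
  rewrite -[RHS]/(1%:C) -(expr1n _ 2) -u1; case: u {u1} => a b.
  rewrite sqr_cmod /=; apply/eqP; rewrite eq_complex /=; apply/andP; split; apply/eqP; ring.
have ReE (z w : R[i]) : cmod (z + w) ^+ 2 =
    cmod z ^+ 2 + cmod w ^+ 2 + 2 * complex.Re (w * z^*%C).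
  by rewrite !sqr_cmod; case: z w => a b [c e] /=; ring.
elim: n => [|n IH]; first by rewrite !big_ord0 cmod0 expr0n.
rewrite [in RHS]big_ord_recr /= ReE cmodX u1 !expr1n -IH big_ord_recr/=.
(* Conjugation inverts [u], so reversing the order of summation turns the product into positive
   powers. *)
have -> : u ^+ n * (\sum_(k < n) u ^+ k)^*%C = \sum_(k < n) u ^+ k.+1.
  rewrite rmorph_sum mulr_sumr (reindex_inj rev_ord_inj) /=; apply: eq_bigr => k _.
  have nk : n = (k.+1 + (n - k.+1))%N by rewrite subnKC.
  by rewrite {1}nk exprD rmorphXn -mulrA -exprMn uu expr1n mulr1.
rewrite raddf_sum /= mulr_sumr; case: n {IH} => [|n].
  by rewrite !big_ord0 /= subr0; ring.
rewrite (eq_bigr (fun k : 'I_n.+1 => (if (k : nat) == 0%N then 1 else 2) *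
    (n.+1%:R - k%:R) * complex.Re (u ^+ k) +
    (if (k : nat) == 0%N then 1 else 2) * complex.Re (u ^+ k))); last first.
  move=> k _; rewrite -[n.+2%:R]natr1; move: (if _ then _ else _) => c.
  by move: (complex.Re _) => x; ring.
rewrite big_split /= -addrA -[RHS]addrA; congr (_ + _).
rewrite big_ord_recl /= mul1r ?expr0 [in RHS]big_ord_recr /= addrA.
by congr (_ + _ + _); rewrite -[n.+2%:R]natr1 [_ + 1]addrC addrK mulr1.
Qed.

Lemma fejer_kernel_ge0 N y y' : 0 <= fejer_kernel N y y'.
Proof.
pose u := val y * (val y')^*%C.
have u1 : cmod u = 1 by rewrite cmodM cmodJ !cmod_circle mulr1.
have uE k : complex.Re (u ^+ k) = ycos k y * ycos k y' + ysin k y * ysin k y'.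
  rewrite /u exprMn -rmorphXn /ycos /ysin; case: (val y ^+ k) (val y' ^+ k) => a b [c e] /=.
  by ring.
rewrite (_ : fejer_kernel N y y' = N.+1%:R^-1 * cmod (\sum_(k < N.+1) u ^+ k) ^+ 2).
  by rewrite mulr_ge0 ?sqr_ge0.
rewrite -fejer_sum_sqr// mulr_sumr; apply: eq_bigr => k _.
rewrite uE /fejer_weight.
have a0 : N.+1%:R != 0 :> R by rewrite pnatr_eq0.
move: (if _ then _ else _) (_ + _) N.+1%:R a0 => c x a a0.
by field.
Qed.

Lemma fejer_kernel_bounded N : exists M, forall y y', `|fejer_kernel N y y'| <= M.
Proof.
exists (\sum_(k < N.+1) `|fejer_weight N k| * 2) => y y'.
apply: le_trans (ler_norm_sum _ _ _) _; apply: ler_sum => k _.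
rewrite normrM ler_wpM2l// (le_trans (ler_normD _ _))// !normrM.
by rewrite -[2]/(1 + 1) lerD// -[1]mulr1 ler_pM// ?ycos_le1 ?ysin_le1.
Qed.

Lemma measurable_fejer_kernel N y : measurable_fun setT (fejer_kernel N y).
Proof.
apply: measurable_sum => k; apply: measurable_funM => //.
by apply: measurable_funD; apply: measurable_funM => //; [exact: measurable_ycos|exact: measurable_ysin].
Qed.

Lemma fourier0 s : fourier s 0 = (\int[m]_y s y)%:C.
Proof.
rewrite /fourier; under eq_Rintegral do rewrite ycos0 mulr1.
by under [X in - X]eq_Rintegral do rewrite ysin0 mulr0; rewrite Rintegral_cst_prob oppr0.
Qed.

Lemma fejer_at0 s N : (fejer s N).[0] = (\int[m]_y s y)%:C.
Proof.
rewrite horner_coef0 coef_poly /= fourier0 /fejer_weight eqxx mul0r subr0 mulr1.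
by rewrite mul1r.
Qed.

Lemma integral_fejer_mean s N : \int[m]_y fejer_mean s N y = \int[m]_y s y.
Proof. by rewrite integral_Re_poly fejer_at0. Qed.

Lemma L2_fejer_mean s N : L2 m (fejer_mean s N).
Proof.
have [M _ pM] := poly_circle_bounded (fejer s N).
apply: (L2_bounded m (M := M)); first exact: measurable_Re_poly.
by move=> y; exact: le_trans (ler_Re_cmod _) (pM y).
Qed.

(** The kernel has total mass one; with its positivity this makes every mean an average. *)
Lemma fejer_mean_cst (a : R) N y : fejer_mean (fun=> a) N y = a.
Proof.
rewrite /fejer_mean (_ : fejer (fun=> a) N = a%:C%:P) ?hornerC//.
apply/polyP => k; rewrite coef_poly coefC.
have [->|k0] := eqVneq k 0%N.
  by rewrite /= fourier0 Rintegral_cst_prob /fejer_weight mul0r subr0 mulr1 mul1r.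
have kp : (0 < k)%N by rewrite lt0n.
have ic : m.-integrable setT (fun y => (ycos k y)%:E).
  by apply: L2_integrable; apply: (L2_bounded m (M := 1)); [exact: measurable_ycos|exact: ycos_le1].
have iss : m.-integrable setT (fun y => (ysin k y)%:E).
  by apply: L2_integrable; apply: (L2_bounded m (M := 1)); [exact: measurable_ysin|exact: ysin_le1].
rewrite /fourier !RintegralZl// integral_Re_pow// integral_Im_pow// !mulr0 oppr0.
by rewrite mulr0; case: ifP.
Qed.

Section Positivity.
Variables (N : nat) (y : C).
Local Notation K := (fejer_kernel N y).

Lemma integrable_mul_kernel s : m.-integrable setT (fun y => (s y)%:E) ->
  m.-integrable setT (fun y' => (s y' * K y')%:E).
Proof.
move=> si; have [M kM] := fejer_kernel_bounded N.
exact: integrableMb si (measurable_fejer_kernel N y) (kM y).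
Qed.

Lemma fejer_meanD f g : m.-integrable setT (fun y => (f y)%:E) ->
  m.-integrable setT (fun y => (g y)%:E) ->
  fejer_mean (fun y => f y + g y) N y = fejer_mean f N y + fejer_mean g N y.
Proof.
move=> fi gi; rewrite !fejer_meanE//; last exact: RintegrableD.
rewrite -RintegralD//; [|exact: integrable_mul_kernel|exact: integrable_mul_kernel].
by apply: eq_Rintegral => y' _; rewrite mulrDl.
Qed.

Lemma fejer_meanZ (a : R) f : m.-integrable setT (fun y => (f y)%:E) ->
  fejer_mean (fun y => a * f y) N y = a * fejer_mean f N y.
Proof.
move=> fi; rewrite !fejer_meanE//; last exact: RintegrableZ.
rewrite -RintegralZl//; last exact: integrable_mul_kernel.
by apply: eq_Rintegral => y' _; rewrite mulrA.
Qed.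

Lemma fejer_mean_le f g : m.-integrable setT (fun y => (f y)%:E) ->
  m.-integrable setT (fun y => (g y)%:E) -> (forall y, f y <= g y) ->
  fejer_mean f N y <= fejer_mean g N y.
Proof.
move=> fi gi fg; rewrite !fejer_meanE//; apply: le_Rintegral => //.
- exact: integrable_mul_kernel.
- exact: integrable_mul_kernel.
- by move=> y' _; rewrite ler_wpM2r ?fejer_kernel_ge0.
Qed.

Lemma fejer_mean_ge0 f : m.-integrable setT (fun y => (f y)%:E) ->
  (forall y, 0 <= f y) -> 0 <= fejer_mean f N y.
Proof.
move=> fi f0; rewrite -(fejer_mean_cst 0 N y); apply: fejer_mean_le => //.
exact: integrable_cst_prob.
Qed.

(* The kernel is a probability density, so its variance is nonnegative. *)
Lemma fejer_mean_sqr f : L2 m f ->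
  fejer_mean f N y ^+ 2 <= fejer_mean (fun y => f y ^+ 2) N y.
Proof.
move=> fi; have [_ fi2] := fi; have fi1 := L2_integrable fi.
set c := fejer_mean f N y.
have := @fejer_mean_ge0 (fun y => f y ^+ 2 + ((- 2 * c) * f y + c ^+ 2)).
rewrite fejer_meanD//; last first.
  by apply: RintegrableD; [exact: RintegrableZ|exact: integrable_cst_prob].
rewrite fejer_meanD//; [|exact: RintegrableZ|exact: integrable_cst_prob].
rewrite fejer_meanZ// fejer_mean_cst -/c => h.
rewrite -subr_ge0 (_ : _ - _ = fejer_mean (fun y => f y ^+ 2) N y + (-2 * c * c + c ^+ 2)).
  apply: h.
    apply: RintegrableD => //.
    by apply: RintegrableD; [exact: RintegrableZ|exact: integrable_cst_prob].
  move=> y'; rewrite (_ : _ + _ = (f y' - c) ^+ 2) ?sqr_ge0//; ring.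
by ring.
Qed.

End Positivity.

(** Jensen's inequality at each point, then invariance of the integral under averaging. The
    contraction makes mean-square convergence a closed condition. *)
Lemma fejer_mean_contract f N : L2 m f ->
  \int[m]_y fejer_mean f N y ^+ 2 <= \int[m]_y f y ^+ 2.
Proof.
move=> fi; rewrite -(integral_fejer_mean (fun y => f y ^+ 2) N).
apply: le_Rintegral => //; first by have [] := L2_fejer_mean f N.
- exact: integrable_Re_poly.
- by move=> y _; exact: fejer_mean_sqr.
Qed.

End Fejer.

(** * The first frequency and the variance of the Fejer kernel *)

Section FejerConvergence.
Context (R : realType).
Local Notation C := (circle R).
Local Notation m := (@circle_haar R).
Implicit Types (s f g : C -> R) (y : C).

Lemma integral_ycos k : \int[m]_y ycos k y = (k == 0%N)%:R.
Proof.
case: k => [|k]; last by rewrite integral_Re_pow.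
by under eq_Rintegral do rewrite ycos0; rewrite Rintegral_cst_prob.
Qed.

Lemma integral_ysin k : \int[m]_y ysin k y = 0.
Proof.
case: k => [|k]; last by rewrite integral_Im_pow.
by under eq_Rintegral do rewrite ysin0; rewrite Rintegral_cst_prob.
Qed.

Lemma integrable_ycos k : m.-integrable setT (fun y => (ycos k y)%:E).
Proof.
by apply: L2_integrable; apply: (L2_bounded m (M := 1)); [exact: measurable_ycos|exact: ycos_le1].
Qed.

Lemma integrable_ysin k : m.-integrable setT (fun y => (ysin k y)%:E).
Proof.
by apply: L2_integrable; apply: (L2_bounded m (M := 1)); [exact: measurable_ysin|exact: ysin_le1].
Qed.

Lemma trig_products j y :
  [/\ ycos 1 y * ycos j.+1 y = 2^-1 * ycos j.+2 y + 2^-1 * ycos j y,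
      ycos 1 y * ysin j.+1 y = 2^-1 * ysin j.+2 y + 2^-1 * ysin j y,
      ysin 1 y * ycos j.+1 y = 2^-1 * ysin j.+2 y + - 2^-1 * ysin j y &
      ysin 1 y * ysin j.+1 y = - 2^-1 * ycos j.+2 y + 2^-1 * ycos j y].
Proof.
have := ycos_sqr 1 y; rewrite /ycos /ysin expr1 [val y ^+ j.+2]exprS [val y ^+ j.+1]exprS.
case: (val y) (val y ^+ j) => a b [c e] /=; rewrite ?mulr1 ?mulr0 ?subr0 ?addr0 ?mul0r => h.
have hc : (a ^+ 2 + b ^+ 2) * c = c by rewrite h mul1r.
have he : (a ^+ 2 + b ^+ 2) * e = e by rewrite h mul1r.
by split; lra.
Qed.

Lemma fourier_ycos1 k : fourier (ycos 1) k = ((k == 1%N)%:R / 2)%:C :> R[i].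
Proof.
rewrite /fourier; case: k => [|j].
  under eq_Rintegral do rewrite ycos0 mulr1.
  under [X in - X]eq_Rintegral do rewrite ysin0 mulr0.
  by rewrite integral_ycos Rintegral_cst_prob oppr0 mul0r.
under eq_Rintegral => y _ do (have [-> _ _ _] := trig_products j y).
under [X in - X]eq_Rintegral => y _ do (have [_ -> _ _] := trig_products j y).
rewrite !RintegralD//; try by apply: RintegrableZ; (exact: integrable_ycos || exact: integrable_ysin).
rewrite !RintegralZl//; try (exact: integrable_ycos || exact: integrable_ysin).
rewrite !integral_ycos !integral_ysin eqSS !mulr0 !addr0 oppr0 add0r mulrC //.
Qed.

Lemma fourier_ysin1 k : fourier (ysin 1) k = 0 +i* (- ((k == 1%N)%:R / 2)) :> R[i].
Proof.
rewrite /fourier; case: k => [|j].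
  under eq_Rintegral do rewrite ycos0 mulr1.
  under [X in - X]eq_Rintegral do rewrite ysin0 mulr0.
  by rewrite integral_ysin Rintegral_cst_prob mul0r.
under [X in - X]eq_Rintegral => y _ do (have [_ _ _ ->] := trig_products j y).
under eq_Rintegral => y _ do (have [_ _ -> _] := trig_products j y).
rewrite !RintegralD//; try by apply: RintegrableZ; (exact: integrable_ycos || exact: integrable_ysin).
rewrite !RintegralZl//; try (exact: integrable_ycos || exact: integrable_ysin).
rewrite !integral_ycos !integral_ysin eqSS !mulr0 !addr0 add0r mulrC //.
Qed.

Lemma fejer_ycos1 N y : fejer_mean (ycos 1) N y = (1 - N.+1%:R^-1) * ycos 1 y.
Proof.
rewrite /fejer_mean (_ : fejer (ycos 1) N = (1 - N.+1%:R^-1)%:C *: 'X).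
  by rewrite hornerZ hornerX /ycos expr1; case: (val y) => a b /=; rewrite mul0r subr0.
apply/polyP => k; rewrite coef_poly coefZ coefX fourier_ycos1 /fejer_weight.
have [->|k1] := eqVneq k 1%N; last by rewrite mul0r !mulr0; case: ifP.
rewrite /= !mulr1 !div1r; case: ifP => [_|].
  by rewrite -rmorphM /=; congr (_ %:C); rewrite [LHS]mulrC mulKf// pnatr_eq0.
(* For [N = 0] the frequency 1 is cut off, in accordance with the factor [1 - N.+1%:R^-1], which is
   then 0. *)
by case: N => // _; rewrite invr1 subrr.
Qed.

Lemma fejer_ysin1 N y : fejer_mean (ysin 1) N y = (1 - N.+1%:R^-1) * ysin 1 y.
Proof.
rewrite /fejer_mean (_ : fejer (ysin 1) N = (0 +i* (- (1 - N.+1%:R^-1))) *: 'X).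
  by rewrite hornerZ hornerX /ysin expr1; case: (val y) => a b /=; rewrite mul0r sub0r mulNr opprK.
apply/polyP => k; rewrite coef_poly coefZ coefX fourier_ysin1 /fejer_weight.
have [->|k1] := eqVneq k 1%N.
  rewrite /= !mulr1 !div1r; case: ifP => [_|].
    apply/eqP; rewrite eq_complex /=; apply/andP; split; apply/eqP.
      by rewrite mulr0 mul0r subr0.
    by rewrite mul0r addr0 mulrN [X in - X]mulrC mulKf// pnatr_eq0.
  by case: N => // _; rewrite invr1 subrr oppr0.
by rewrite mul0r oppr0 (_ : 0 +i* 0 = 0) // !mulr0; case: ifP.
Qed.

(** The squared distance is a trigonometric polynomial of degree one, so only the damping
    [1 - N.+1%:R^-1] of the first frequency enters. This is the variance of the kernel, the quantity
    that controls Lipschitz functions. *)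
Lemma fejer_dist_sqr N y :
  fejer_mean (fun y' => cmod (val y' - val y) ^+ 2) N y = 2 / N.+1%:R.
Proof.
rewrite (_ : (fun y' => _) = fun y' => 2 + (- (2 * ycos 1 y) * ycos 1 y' + - (2 * ysin 1 y) * ysin 1 y')).
  rewrite fejer_meanD; last 2 first.
  - exact: integrable_cst_prob.
  - by apply: RintegrableD; apply: RintegrableZ; [exact: integrable_ycos|exact: integrable_ysin].
  rewrite fejer_mean_cst fejer_meanD; last 2 first.
  - by apply: RintegrableZ; exact: integrable_ycos.
  - by apply: RintegrableZ; exact: integrable_ysin.
  rewrite !fejer_meanZ; [|exact: integrable_ysin|exact: integrable_ycos].
  rewrite fejer_ycos1 fejer_ysin1.
  rewrite (_ : _ + _ = 2 - 2 * (1 - N.+1%:R^-1) * (ycos 1 y ^+ 2 + ysin 1 y ^+ 2)).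
    by rewrite ycos_sqr; ring.
  by ring.
apply/funext => y'; rewrite sqr_cmod.
have := ycos_sqr 1 y; have := ycos_sqr 1 y'; rewrite /ycos /ysin !expr1.
case: (val y) (val y') => a b [c e] /= h1 h2.
by lra.
Qed.

End FejerConvergence.

(** * Mean-square convergence of Fejer means *)

Section FejerL2.
Context (R : realType).
Local Notation C := (circle R).
Local Notation m := (@circle_haar R).
Implicit Types (s f g : C -> R) (y : C).

Definition fejer_err f N : R := \int[m]_y (fejer_mean f N y - f y) ^+ 2.

Definition fejer_cvg f := L2 m f /\ fejer_err f N @[N --> \oo] --> (0 : R).

Lemma fejer_err_ge0 f N : 0 <= fejer_err f N.
Proof. by apply: Rintegral_ge0 => y _; rewrite sqr_ge0. Qed.

Lemma fejer_meanB f g N y : L2 m f -> L2 m g ->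
  fejer_mean (fun y => f y - g y) N y = fejer_mean f N y - fejer_mean g N y.
Proof.
move=> /L2_integrable fi /L2_integrable gi.
rewrite (_ : (fun y => _) = fun y => f y + (-1) * g y); last by apply/funext => z; ring.
by rewrite fejer_meanD ?fejer_meanZ ?mulN1r//; exact: RintegrableZ.
Qed.

Lemma fejer_errD f g N : L2 m f -> L2 m g ->
  fejer_err (fun y => f y + g y) N <= 2 * fejer_err f N + 2 * fejer_err g N.
Proof.
move=> fi gi; rewrite /fejer_err.
under [leLHS]eq_Rintegral => y _.
  rewrite fejer_meanD; [|exact: L2_integrable|exact: L2_integrable].
  rewrite opprD addrACA; over.
by apply: le_int_sqrD; apply: L2B => //; exact: L2_fejer_mean.
Qed.

Lemma fejer_errZ (a : R) f N : L2 m f ->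
  fejer_err (fun y => a * f y) N = a ^+ 2 * fejer_err f N.
Proof.
move=> fi; rewrite /fejer_err -RintegralZl//; last first.
  by have [] := L2B (L2_fejer_mean f N) fi.
apply: eq_Rintegral => y _; rewrite fejer_meanZ; last exact: L2_integrable.
by ring.
Qed.

Lemma cvg0_le (x e : nat -> R) : (forall n, 0 <= x n) -> (forall n, x n <= e n) ->
  e n @[n --> \oo] --> (0 : R) -> x n @[n --> \oo] --> (0 : R).
Proof.
move=> x0 xe e0; apply: (@squeeze_cvgr _ _ _ _ (fun=> 0) e) => //; last exact: cvg_cst.
by apply: nearW => n; rewrite x0 xe.
Qed.

Lemma cvg0D (x e : nat -> R) : x n @[n --> \oo] --> (0 : R) ->
  e n @[n --> \oo] --> (0 : R) -> (x n + e n) @[n --> \oo] --> (0 : R).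
Proof.
move=> x0 e0; have : (x n + e n) @[n --> \oo] --> (0 + 0 : R) by exact: cvgD.
by rewrite addr0.
Qed.

Lemma cvg0Ml (x : nat -> R) (c : R) :
  x n @[n --> \oo] --> (0 : R) -> (c * x n) @[n --> \oo] --> (0 : R).
Proof.
move=> x0; rewrite (_ : (fun n => _) = fun n => x n * c); first exact: cvg0Mr.
by apply/funext => n; rewrite mulrC.
Qed.

Lemma fejer_cvgD f g : fejer_cvg f -> fejer_cvg g -> fejer_cvg (fun y => f y + g y).
Proof.
move=> [fi f0] [gi g0]; split; first exact: L2D.
apply: (cvg0_le (fejer_err_ge0 _) (fun N => fejer_errD N fi gi)).
by apply: cvg0D; exact: cvg0Ml.
Qed.

Lemma fejer_cvgZ (a : R) f : fejer_cvg f -> fejer_cvg (fun y => a * f y).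
Proof.
move=> [fi f0]; split; first exact: L2Z.
rewrite (_ : fejer_err _ = fun N => a ^+ 2 * fejer_err f N); first exact: cvg0Ml.
by apply/funext => N; rewrite fejer_errZ.
Qed.

Lemma fejer_cvg_cst (a : R) : fejer_cvg (fun=> a).
Proof.
split; first exact: L2_cst.
rewrite (_ : fejer_err _ = fun=> 0); first exact: cvg_cst.
apply/funext => N; rewrite /fejer_err.
by under eq_Rintegral do rewrite fejer_mean_cst subrr expr0n; rewrite Rintegral_cst_prob.
Qed.

Lemma fejer_cvg_lim (f : C -> R) (g : nat -> C -> R) : L2 m f ->
  (forall n, fejer_cvg (g n)) ->
  (\int[m]_y (f y - g n y) ^+ 2) @[n --> \oo] --> (0 : R) -> fejer_cvg f.
Proof.
move=> fi gc gf; split=> //; apply/cvgrPdist_lt => e e0.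
(* The error of [f] is at most twice that of [g n] plus twice that of [f - g n], and the latter is
   at most four times a squared distance: in total [2/16 + 8/16] of [e]. *)
have e8 : 0 < e / 16 by rewrite divr_gt0.
have /cvgrPdist_lt/(_ _ e8)[n _ /(_ n (leqnn n))] := gf.
have [gi g0] := gc n.
have fgi := L2B fi gi.
have h0 : 0 <= \int[m]_y (f y - g n y) ^+ 2 by apply: Rintegral_ge0 => y _; rewrite sqr_ge0.
rewrite sub0r normrN ger0_norm// => fgn.
have /cvgrPdist_lt := g0 => /(_ _ e8); apply: filterS => N.
rewrite !sub0r !normrN !ger0_norm ?fejer_err_ge0// => gN.
have fE : f = fun y => (f y - g n y) + g n y by apply/funext => y; rewrite subrK.
rewrite fE; apply: le_lt_trans (fejer_errD N fgi gi) _.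
suff : fejer_err (fun y => f y - g n y) N <= 4 * (e / 16).
  by lra.
apply: (@le_trans _ _ (2 * \int[m]_y fejer_mean (fun y => f y - g n y) N y ^+ 2 +
    2 * \int[m]_y (-1 * (f y - g n y)) ^+ 2)).
  rewrite /fejer_err; under eq_Rintegral do rewrite -mulN1r.
  by apply: le_int_sqrD; [exact: L2_fejer_mean|exact: L2Z].
have := fejer_mean_contract N fgi.
under [X in _ + 2 * X]eq_Rintegral do rewrite mulN1r sqrrN.
by lra.
Qed.

Lemma fejer_cvg_dominated (f : C -> R) (g : nat -> C -> R) (h : C -> R) :
  L2 m h -> (forall n, fejer_cvg (g n)) -> measurable_fun setT f ->
  (forall y, `|f y| <= h y) -> (forall n y, `|g n y| <= h y) ->
  (forall y, g n y @[n --> \oo] --> f y) -> fejer_cvg f.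
Proof.
move=> hi gc mf fh gh gf; have [_ hi2] := hi.
have fi : L2 m f.
  split=> //; apply: (integrable_le _ hi2); first exact: measurable_funX.
  move=> y; rewrite normrX ler_pXn2r ?nnegrE//.
  exact: le_trans (fh y).
apply: (fejer_cvg_lim fi gc).
have fgi n : L2 m (fun y => f y - g n y) by apply: L2B => //; case: (gc n).
suff : (\int[m]_y ((f y - g n y) ^+ 2)%:E)%E @[n --> \oo] --> (0 : \bar R)%E.
  by move=> /fine_cvg.
apply: (@dominated_cvg0_real _ _ _ m _ (fun y => 4 * h y ^+ 2)).
- by move=> n; apply: measurable_funX; case: (fgi n).
- by apply: measurable_funM => //; apply: measurable_funX; case: hi.
- apply: nearW => y; have /cvgrPdist_lt gy := gf y; apply/cvgrPdist_lt => e e0.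
  have e1 : 0 < Num.min e 1 by rewrite lt_min e0 ltr01.
  have := gy _ e1; apply: filterS => n; rewrite lt_min => /andP[h1 h2].
  rewrite sub0r normrN normrX expr2; apply: le_lt_trans h1.
  by rewrite -[leRHS]mulr1 ler_wpM2l// ltW.
- move=> n y; rewrite sqr_ge0 /= -[(f y - _) ^+ 2]real_normK ?num_real//.
  have h0 : 0 <= h y by apply: le_trans (fh y); exact: normr_ge0.
  rewrite (_ : 4 * h y ^+ 2 = (h y + h y) ^+ 2); last by ring.
  rewrite ler_pXn2r ?nnegrE ?addr_ge0//; apply: le_trans (ler_normB _ _) _.
  by rewrite lerD.
- have /integrable_fin_num := RintegrableZ 4 hi2.
  by move=> /(_ measurableT); rewrite ltey_eq => ->.
Qed.

(** Jensen's inequality for [g - g y] bounds the squared error at [y] by [L ^+ 2] times the variance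
    of the kernel, uniformly in [y]. *)
Lemma fejer_cvg_lipschitz g (L M : R) : measurable_fun setT g -> (forall y, `|g y| <= M) ->
  (forall y y', `|g y' - g y| <= L * cmod (val y' - val y)) -> fejer_cvg g.
Proof.
move=> mg gM gL; have gi := L2_bounded m mg gM; split=> //.
have mdist y : m.-integrable setT (fun y' : C => (cmod (val y' - val y) ^+ 2)%:E).
  have mc : measurable_fun setT (fun y' : C => cmod (val y' - val y)).
    by apply: measurable_cmod; apply: cmeasB; [exact: cmeas_circle|exact: cmeas_cst].
  apply: (integrable_bounded m (M := 4)); first exact: measurable_funX.
  move=> y'; rewrite ger0_norm ?sqr_ge0//.
  have := ler_cmodB (val y') (val y); rewrite !cmod_circle.
  by have := cmod_ge0 (val y' - val y); nra.
apply: (@cvg0_le _ (fun N => 2 * L ^+ 2 * N.+1%:R^-1)).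
- exact: fejer_err_ge0.
- move=> N; rewrite -[leRHS](Rintegral_cst_prob m); apply: le_Rintegral => //.
  + by have [] := L2B (L2_fejer_mean g N) gi.
  + exact: integrable_cst_prob.
  + move=> y _.
    have gyi : L2 m (fun y' => g y' - g y) by apply: L2B => //; exact: L2_cst.
    rewrite -(fejer_mean_cst (g y) N y) -fejer_meanB//; last exact: L2_cst.
    apply: le_trans (fejer_mean_sqr N y gyi) _.
    apply: (@le_trans _ _ (fejer_mean (fun y' => L ^+ 2 * cmod (val y' - val y) ^+ 2) N y)).
      apply: fejer_mean_le; [by case: gyi|exact: RintegrableZ|].
      move=> y'; rewrite -exprMn -[(g y' - _) ^+ 2]real_normK ?num_real//.
      by rewrite ler_pXn2r ?nnegrE// (le_trans _ (gL y y')).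
    by rewrite fejer_meanZ// fejer_dist_sqr mulrCA mulrA.
- apply: cvg0Ml; exact: cvg_harmonic.
Qed.

End FejerL2.

(** * From generating sets to measurable sets *)

Section FejerDynkin.
Context (R : realType).
Local Notation C := (circle R).
Local Notation m := (@circle_haar R).
Implicit Types (s f g h : C -> R) (y : C).

Lemma indic_bigcup_cvg (T : Type) (F : (set T)^nat) (w : T) : trivIset setT F ->
  (\sum_(k < n) \1_(F k) w : R) @[n --> \oo] --> (\1_(\bigcup_k F k) w : R).
Proof.
move=> tF; have [[k _ Fk]|nF] := pselect ((\bigcup_k F k) w).
  rewrite indicE mem_set//; last by exists k.
  apply: cvg_near_cst; exists k.+1 => // n /= kn.
  rewrite (bigD1 (Ordinal kn))//= indicE mem_set// big1 ?addr0// => j jk.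
  rewrite indicE memNset// => Fj; move: jk; rewrite -val_eqE/= => /eqP; apply.
  by apply: tF => //; exists w.
rewrite indicE memNset//; apply: cvg_near_cst; apply: nearW => n.
by rewrite big1// => j _; rewrite indicE memNset// => Fj; apply: nF; exists j.
Qed.

Lemma sum_indic_le1 (T : Type) (F : (set T)^nat) (w : T) n : trivIset setT F ->
  \sum_(k < n) \1_(F k) w <= 1 :> R.
Proof.
move=> tF; have [[k Fk]|nF] := pselect (exists k : 'I_n, F k w).
  rewrite (bigD1 k)//= indicE mem_set// big1 ?addr0// => j jk.
  rewrite indicE memNset// => Fj; move: jk; rewrite -val_eqE/= => /eqP; apply.
  by apply: tF => //; exists w.
by rewrite big1// => j _; rewrite indicE memNset// => Fj; apply: nF; exists j.
Qed.

Lemma fejer_cvg_sum (F : nat -> C -> R) n : (forall k, fejer_cvg (F k)) ->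
  fejer_cvg (fun y => \sum_(k < n) F k y).
Proof.
move=> FF; elim: n => [|n IH].
  by under eq_fun do rewrite big_ord0; exact: fejer_cvg_cst.
by under eq_fun do rewrite big_ord_recr; exact: fejer_cvgD.
Qed.

(** Convergence survives scaling, sums and dominated limits, so the good sets form a Dynkin class.
    The fixed weight [h] allows the real and the imaginary coordinate of the circle to be treated
    one after the other. *)
Lemma fejer_cvg_dynkin e (E : measurableType e) (phi : C -> E) (G : set (set E)) h :
  measurable_fun setT phi -> @measurable _ E = <<s G >> -> setI_closed G ->
  fejer_cvg h -> (forall y, 0 <= h y <= 1) ->
  (forall A, G A -> fejer_cvg (fun y => \1_A (phi y) * h y)) ->
  forall A, measurable A -> fejer_cvg (fun y => \1_A (phi y) * h y).
Proof.
move=> mphi EG GI hh h01 GA A mA; have [[mh _] _] := hh.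
have h0 y : 0 <= h y by case/andP: (h01 y).
have h1 y : h y <= 1 by case/andP: (h01 y).
apply: (@dynkin_induction _ E G (fun A => fejer_cvg (fun y => \1_A (phi y) * h y))) => //.
- by under eq_fun do rewrite indicT mul1r.
- move=> B mB hB; rewrite (_ : (fun y => _) = fun y => h y + (-1) * (\1_B (phi y) * h y)).
    by apply: fejer_cvgD => //; exact: fejer_cvgZ.
  apply/funext => y; rewrite !indicE in_setC; case: (_ \in B) => /=.
    by rewrite mul0r mul1r mulN1r subrr.
  by rewrite mul0r mulr0 addr0 mul1r.
- move=> F mF tF hF.
  have mi (B : set E) : measurable B -> measurable_fun setT (fun y => \1_B (phi y) * h y).
    move=> mB; apply: measurable_funM => //.
    have mB1 : measurable_fun setT (\1_B : E -> R) by exact: measurable_indic.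
    exact: (measurableT_comp mB1 mphi).
  apply: (@fejer_cvg_dominated _ _ (fun n y => \sum_(k < n) (\1_(F k) (phi y) * h y)) (fun=> 1)).
  + exact: L2_cst.
  + by move=> n; exact: (fejer_cvg_sum (F := fun k y => \1_(F k) (phi y) * h y)).
  + by apply: mi; exact: bigcup_measurable.
  + by move=> y; rewrite ger0_norm ?mulr_ge0// mulr_ile1// indicE; case: (_ \in _).
  + move=> n y; rewrite -mulr_suml ger0_norm ?mulr_ge0// ?sumr_ge0//.
    by rewrite mulr_ile1 ?sumr_ge0//; exact: sum_indic_le1.
  + move=> y; under eq_fun do rewrite -mulr_suml.
    by apply: cvgM; [exact: indic_bigcup_cvg|exact: cvg_cst].
- by rewrite -EG.
Qed.

End FejerDynkin.

(** * From Lipschitz ramps to all nonnegative square-integrable functions *)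

Section FejerAll.
Context (R : realType).
Local Notation C := (circle R).
Local Notation m := (@circle_haar R).
Implicit Types (s f g h : C -> R) (y : C).

(** Lipschitz functions tending pointwise to the indicator of the positive half-line; products of
    two of them, in the two coordinates, are the Lipschitz functions from which the approximation
    starts. *)
Definition ramp n (t : R) : R := Num.min 1 (Num.max 0 (n%:R * t)).

Lemma ramp01 n t : 0 <= ramp n t <= 1.
Proof. by rewrite /ramp le_min ler01 le_max lexx/= ge_min lexx. Qed.

Lemma ramp_lipschitz n t t' : `|ramp n t' - ramp n t| <= n%:R * `|t' - t|.
Proof.
wlog tt' : t t' / t <= t'.
  move=> h; have [|/ltW] := leP t t'; first exact: h.
  by move=> /h; rewrite distrC (distrC t).
have := ler_wpM2l (ler0n R n) tt'.
rewrite (ger0_norm (x := t' - t)) ?subr_ge0// mulrBr ler_norml /ramp.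
move: (n%:R * t) (n%:R * t') => x x' xx'.
rewrite /Num.max; case: (ltP 0 x) => h1; case: (ltP 0 x') => h2;
  rewrite /Num.min ?ltr10; case: (ltP 1 x) => h3; case: (ltP 1 x') => h4;
  by apply/andP; split; lra.
Qed.

Lemma ramp_cvg t : ramp n t @[n --> \oo] --> (\1_(`]0, +oo[%classic) t : R).
Proof.
have [t0|t0] := ltP 0 t; last first.
  rewrite indicE memNset/=; last by rewrite in_itv/= andbT; apply/negP; rewrite -leNgt.
  apply: cvg_near_cst; apply: nearW => n.
  have nt : n%:R * t <= 0 by rewrite mulr_ge0_le0.
  by rewrite /ramp (max_idPl nt) min_r.
rewrite indicE mem_set/=; last by rewrite in_itv/= andbT.
apply: cvg_near_cst; exists (Num.trunc t^-1).+1 => // n /= tn.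
have h : 1 <= n%:R * t.
  rewrite -ler_pdivrMr// div1r; apply: ltW; apply: lt_le_trans (truncnS_gt _) _.
  by rewrite ler_nat.
by rewrite /ramp min_l// le_max h orbT.
Qed.

Lemma measurable_ramp n d (T : measurableType d) (f : T -> R) :
  measurable_fun setT f -> measurable_fun setT (fun w => ramp n (f w)).
Proof.
move=> mf; apply: measurable_minr => //; apply: measurable_maxr => //.
exact: measurable_funM.
Qed.

Lemma fejer_cvg_ramp n k a b :
  fejer_cvg (fun y => ramp n (ycos 1 y - a) * ramp k (ysin 1 y - b)).
Proof.
have r0 j t : `|ramp j t| <= 1 by have /andP[h1 h2] := ramp01 j t; rewrite ger0_norm.
have dcos y y' : `|ycos 1 y' - ycos 1 y| <= cmod (val y' - val y).
  by rewrite /ycos !expr1 -raddfB; exact: ler_Re_cmod.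
have dsin y y' : `|ysin 1 y' - ysin 1 y| <= cmod (val y' - val y).
  by rewrite /ysin !expr1 -raddfB; exact: ler_Im_cmod.
apply: (@fejer_cvg_lipschitz _ _ (n%:R + k%:R) 1).
- apply: measurable_funM; apply: measurable_ramp; apply: measurable_funB => //.
    exact: measurable_ycos.
  exact: measurable_ysin.
- by move=> y; rewrite normrM mulr_ile1.
- move=> y y'.
  rewrite (_ : _ - _ =
    (ramp n (ycos 1 y' - a) - ramp n (ycos 1 y - a)) * ramp k (ysin 1 y' - b) +
    ramp n (ycos 1 y - a) * (ramp k (ysin 1 y' - b) - ramp k (ysin 1 y - b))); last by ring.
  apply: le_trans (ler_normD _ _) _; rewrite [leRHS]mulrDl lerD//.
    rewrite normrM -[leRHS]mulr1 ler_pM//.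
    apply: le_trans (ramp_lipschitz _ _ _) _; rewrite ler_wpM2l//.
    by rewrite opprB addrA subrK.
  rewrite normrM -[leRHS]mul1r ler_pM//.
  apply: le_trans (ramp_lipschitz _ _ _) _; rewrite ler_wpM2l//.
  by rewrite opprB addrA subrK.
Qed.

(** Both coordinates of the circle lie in [[-1, 1]], so a ramp starting at [-2] is the constant 1
    there. This supplies the weight itself, as the Dynkin argument requires. *)
Lemma ramp1 t : -1 <= t -> ramp 1 (t - (-2)) = 1.
Proof. by move=> t1; rewrite /ramp mul1r min_l// le_max; apply/orP; right; lra. Qed.

Lemma ramp_indic (t a : R) : (\1_(`]0, +oo[%classic) (t - a) : R) = \1_(`]a, +oo[%classic) t.
Proof. by rewrite !indicE; congr (_%:R); congr nat_of_bool; rewrite !mem_setE !in_itv/= subr_gt0. Qed.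

Lemma setI_closed_rays : setI_closed (@RGenOInfty.G R).
Proof.
move=> _ _ [a ->] [b ->]; exists (Num.max a b).
by apply/seteqP; split=> t /=; rewrite !in_itv/= !andbT gt_max; [move=> [-> ->]|move/andP].
Qed.

Lemma fejer_cvg_cos_ramp (A : set R) k b : measurable A ->
  fejer_cvg (fun y => \1_A (ycos 1 y) * ramp k (ysin 1 y - b)).
Proof.
move: A; apply: (@fejer_cvg_dynkin _ _ _ _ (@RGenOInfty.G R)).
- exact: measurable_ycos.
- exact: RGenOInfty.measurableE.
- exact: setI_closed_rays.
- have := fejer_cvg_ramp 1 k (-2) b; congr fejer_cvg; apply/funext => y.
  by rewrite ramp1 ?mul1r//; have := ycos_le1 1 y; rewrite ler_norml => /andP[].
- by move=> y; exact: ramp01.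
- move=> _ [a ->].
  apply: (@fejer_cvg_dominated _ _ (fun n y => ramp n (ycos 1 y - a) * ramp k (ysin 1 y - b)) (fun=> 1)).
  + exact: L2_cst.
  + by move=> n; exact: fejer_cvg_ramp.
  + apply: measurable_funM; last first.
      by apply: measurable_ramp; apply: measurable_funB => //; exact: measurable_ysin.
    apply: (@measurableT_comp _ _ _ _ _ _ (\1_(`]a, +oo[%classic) : R -> R)); last exact: measurable_ycos.
    exact: measurable_indic.
  + move=> y; have /andP[h1 h2] := ramp01 k (ysin 1 y - b).
    by rewrite ger0_norm ?mulr_ge0// mulr_ile1// indicE; case: (_ \in _).
  + move=> n y; have /andP[h1 h2] := ramp01 k (ysin 1 y - b).
    have /andP[h3 h4] := ramp01 n (ycos 1 y - a).
    by rewrite ger0_norm ?mulr_ge0// mulr_ile1.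
  + move=> y; apply: cvgM; last exact: cvg_cst.
    by rewrite -ramp_indic; exact: ramp_cvg.
Qed.

Lemma fejer_cvg_sin_cos (A B : set R) : measurable A -> measurable B ->
  fejer_cvg (fun y => \1_B (ysin 1 y) * \1_A (ycos 1 y)).
Proof.
move=> mA; move: B; have m1A : measurable_fun setT (fun y => \1_A (ycos 1 y) : R).
  apply: (@measurableT_comp _ _ _ _ _ _ (\1_A : R -> R)); last exact: measurable_ycos.
  exact: measurable_indic.
apply: (@fejer_cvg_dynkin _ _ _ _ (@RGenOInfty.G R)).
- exact: measurable_ysin.
- exact: RGenOInfty.measurableE.
- exact: setI_closed_rays.
- have := fejer_cvg_cos_ramp 1 (-2) mA; congr fejer_cvg; apply/funext => y.
  by rewrite ramp1 ?mulr1//; have := ysin_le1 1 y; rewrite ler_norml => /andP[].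
- by move=> y; rewrite indicE; case: (_ \in _); rewrite ?lexx ler01.
- move=> _ [a ->].
  apply: (@fejer_cvg_dominated _ _ (fun n y => \1_A (ycos 1 y) * ramp n (ysin 1 y - a)) (fun=> 1)).
  + exact: L2_cst.
  + by move=> n; exact: fejer_cvg_cos_ramp.
  + apply: measurable_funM => //.
    apply: (@measurableT_comp _ _ _ _ _ _ (\1_(`]a, +oo[%classic) : R -> R)); last exact: measurable_ysin.
    exact: measurable_indic.
  + by move=> y; rewrite !indicE; do 2 case: (_ \in _); rewrite ?mulr0 ?mul0r ?mulr1 ?normr0 ?normr1.
  + move=> n y; have /andP[h1 h2] := ramp01 n (ysin 1 y - a).
    by rewrite ger0_norm ?mulr_ge0// mulr_ile1// indicE; case: (_ \in _).
  + move=> y; rewrite mulrC; apply: cvgM; first exact: cvg_cst.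
    by rewrite -ramp_indic; exact: ramp_cvg.
Qed.

Lemma fejer_cvg_indic (A : set C) : measurable A -> fejer_cvg (\1_A).
Proof.
move=> [S mS <-]; rewrite setTI.
pose G := [set A `*` B | A in @measurable _ (measurableTypeR R) & B in @measurable _ (measurableTypeR R)].
have mc : measurable_fun setT (@circle_coord R).
  by move=> _ B mB; rewrite setTI; exists B => //; rewrite setTI.
have h : fejer_cvg (fun y => \1_S (circle_coord y) * 1).
  apply: (@fejer_cvg_dynkin _ _ _ (@circle_coord R) G) => //.
  - by rewrite measurable_prod_measurableType.
  - move=> _ _ [A1 mA1 [B1 mB1 <-]] [A2 mA2 [B2 mB2 <-]].
    exists (A1 `&` A2); first exact: measurableI.
    by exists (B1 `&` B2); [exact: measurableI|rewrite setXI].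
  - exact: fejer_cvg_cst.
  - by move=> y; rewrite ler01 lexx.
  - move=> _ [A1 mA1 [B1 mB1 <-]].
    have := fejer_cvg_sin_cos mA1 mB1; congr fejer_cvg; apply/funext => y.
    by rewrite mulr1 mulrC !indicE in_setX /= /ycos /ysin !expr1 -natrM mulnb.
by have := h; congr fejer_cvg; apply/funext => y; rewrite mulr1.
Qed.

Lemma fejer_cvg_L2 f : L2 m f -> (forall y, 0 <= f y) -> fejer_cvg f.
Proof.
move=> fi f0; have [mf _] := fi.
have mfE : measurable_fun setT (EFin \o f) by exact/measurable_EFinP.
pose p := nnsfun_approx measurableT mfE.
have pcvg y : p n y @[n --> \oo] --> f y.
  have /fine_cvgP[_] : EFin \o (p^~ y) @ \oo --> (EFin \o f) y.
    by apply: cvg_nnsfun_approx => // x _; rewrite lee_fin.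
  exact.
have pf n y : p n y <= f y.
  rewrite -(cvg_lim (@Rhausdorff R) (pcvg y)).
  apply: (@nondecreasing_cvgn_le _ (fun n => p n y)); last by apply/cvg_ex; exists (f y).
  by move=> k j kj; exact/lefP/nd_nnsfun_approx.
apply: (@fejer_cvg_dominated _ _ (fun n => p n) f) => //.
- move=> n; rewrite (_ : (p n : C -> R) = fun y => \sum_(r <- fset_set (range (p n))) r * \1_(p n @^-1` [set r]) y).
    elim: (fset_set _ : seq R) => [|r l IH].
      by under eq_fun do rewrite big_nil; exact: fejer_cvg_cst.
    under eq_fun do rewrite big_cons; apply: fejer_cvgD => //; apply: fejer_cvgZ.
    exact: fejer_cvg_indic.
  by apply/funext => y; rewrite fimfunE fsbig_finite.
- by move=> y; rewrite ger0_norm.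
- by move=> n y; rewrite ger0_norm.
Qed.

End FejerAll.

(** * Almost everywhere summability from squared norms *)

Section Summable.
Context (R : realType) (d : measure_display) (T : measurableType d)
  (P : probability T R).

(** By [|x| <= 2^-j + 2^j x^2], squared norms of order [4^-j] give means of [|f j|] of order [2^-j].
    Their sum is finite, so by Tonelli the series converges almost everywhere. *)
Lemma ae_summable (f : nat -> T -> R) (c : R) :
  (forall j, measurable_fun setT (f j)) -> 0 <= c ->
  (forall j, \int[P]_w (f j w ^+ 2)%:E <= (c / (2 ^ j)%:R ^+ 2)%:E)%E ->
  {ae P, forall w, cvgn (series (fun j => `|f j w|))}.
Proof.
move=> mf c0 fc.
have mfE j : measurable_fun setT (fun w => (`|f j w|)%:E).
  by apply/measurable_EFinP; apply: measurableT_comp => //.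
(* The bound is [(1 + c) / 2^j], written in the shape that [epsilon_trick0] sums to
   [2 * (1 + c)]. *)
have fj j : (\int[P]_w (`|f j w|)%:E <= (2 * (1 + c) / (2 ^ j.+1)%:R)%:E)%E.
  pose a : R := (2 ^ j)%:R.
  have a0 : 0 < a by rewrite ltr0n expn_gt0.
  apply: (@le_trans _ _ (\int[P]_w (a^-1%:E + a%:E * (f j w ^+ 2)%:E))%E).
    apply: ge0_le_integral => //.
    - apply: emeasurable_funD => //; apply: measurable_funeM.
      by apply/measurable_EFinP; exact: measurable_funX.
    - move=> w _; rewrite -EFinM -EFinD lee_fin -real_normK ?num_real//.
      have := normr_ge0 (f j w); move: (`|f j w|) => x x0.
      rewrite -subr_ge0 (_ : _ - _ = a^-1 * (3 / 4 + (a * x - 2^-1) ^+ 2)); last first.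
        by field; rewrite gt_eqF.
      by rewrite mulr_ge0 ?invr_ge0 ?(ltW a0)// addr_ge0 ?sqr_ge0.
  have g0 w : setT w -> (0 <= a%:E * (f j w ^+ 2)%:E)%E.
    by rewrite -EFinM lee_fin mulr_ge0 ?sqr_ge0// ltW.
  have mg : measurable_fun setT (fun w => a%:E * (f j w ^+ 2)%:E)%E.
    by apply: measurable_funeM; apply/measurable_EFinP; exact: measurable_funX.
  have a0' w : @setT T w -> (0 <= a^-1%:E)%E by rewrite lee_fin invr_ge0 ltW.
  rewrite (ge0_integralD P measurableT a0' (measurable_cst _) g0 mg).
  rewrite integral_cst//= probability_setT mule1 ge0_integralZl//; last 3 first.
  - by apply/measurable_EFinP; exact: measurable_funX.
  - by move=> w _; rewrite lee_fin sqr_ge0.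
  - by rewrite lee_fin ltW.
  apply: (@le_trans _ _ (a^-1%:E + a%:E * (c / a ^+ 2)%:E)%E).
    by rewrite leeD2l// lee_wpmul2l ?lee_fin ?(ltW a0)// fc.
  rewrite -EFinM -EFinD lee_fin expnS natrM -/a.
  by rewrite le_eqVlt; apply/orP; left; apply/eqP; field; rewrite gt_eqF.
have sumlty : (\int[P]_w (\sum_(j <oo) (`|f j w|)%:E) < +oo)%E.
  rewrite integral_nneseries//.
  apply: (@le_lt_trans _ _ (\sum_(j <oo) (2 * (1 + c) / (2 ^ j.+1)%:R)%:E)%E).
    by apply: lee_nneseries => j *; [exact: integral_ge0|exact: fj].
  apply: le_lt_trans (ltry (2 * (1 + c))); apply: epsilon_trick0.
  by rewrite mulr_ge0// addr_ge0.
have si : P.-integrable setT (fun w => \sum_(j <oo) (`|f j w|)%:E)%E.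
  apply/integrableP; split; first exact: ge0_emeasurable_sum.
  by under eq_integral do rewrite gee0_abs ?nneseries_ge0//.
have := integrable_ae measurableT si; apply: filterS => w /(_ I) fw.
apply: nondecreasing_is_cvgn.
  by apply: nondecreasing_series => j _.
exists (fine (\sum_(j <oo) (`|f j w|)%:E)%E) => _ [n _ <-].
rewrite -lee_fin fineK// /series/= -sumEFin.
exact: nneseries_lim_ge.
Qed.

End Summable.

(** * Harmonic conjugation *)

Lemma double_sum_le (R : realFieldType) (a b c d : R) :
  a <= c -> b <= d -> c <= d -> 2 * a + 2 * b <= 4 * d.
Proof. by lra. Qed.

Section Conjugate.
Context (R : realType).
Local Notation C := (circle R).
Local Notation m := (@circle_haar R).
Implicit Types (s f g h : C -> R) (y : C).

(* Least index with error at most [4^-j]: summable errors give almost everywhere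
   convergence, and a least index depends measurably on parameters of [s]. *)
Definition conj_idx s j : nat :=
  match pselect (exists N, fejer_err s N <= ((2 ^ j)%:R ^+ 2)^-1) with
  | left h => ex_minn h
  | right _ => 0%N
  end.

Definition conj_approx s j : {poly R[i]} := fejer s (conj_idx s j).

(* Imaginary part of the Herglotz transform of [s]; the limsup is a.e. a limit
   when [s] is nonnegative and square integrable. *)
Definition conj_fun s y : R :=
  fine (limn_esup (fun j => (complex.Im (conj_approx s j).[val y])%:E)).

Variable s : C -> R.
Hypotheses (sL2 : L2 m s) (s0 : forall y, 0 <= s y).
Let p := conj_approx s.

Lemma conj_approx_Re_ge0 j y : 0 <= complex.Re (p j).[val y].
Proof. by apply: (fejer_mean_ge0 _ _ (L2_integrable sL2)). Qed.

Lemma conj_approx0 j : (p j).[0] = (\int[m]_y s y)%:C.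
Proof. exact: fejer_at0. Qed.

Lemma conj_approx_err j : \int[m]_y (complex.Re (p j).[val y] - s y) ^+ 2 <= ((2 ^ j)%:R ^+ 2)^-1.
Proof.
rewrite /p /conj_approx /conj_idx; case: pselect => [h|[]]; first by case: ex_minnP.
have [_ /cvgrPdist_lt] := fejer_cvg_L2 sL2 s0.
have e0 : 0 < ((2 ^ j)%:R ^+ 2 : R)^-1 by rewrite invr_gt0 exprn_gt0// ltr0n expn_gt0.
move=> /(_ _ e0)[N _ /(_ N (leqnn N))].
by rewrite sub0r normrN ger0_norm ?fejer_err_ge0// => /ltW h; exists N.
Qed.

Lemma measurable_conj_fun : measurable_fun setT (conj_fun s).
Proof.
apply: measurableT_comp => //; apply: measurable_fun_limn_esup => j.
by apply/measurable_EFinP; exact: measurable_Im_poly.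
Qed.

Let L2_Re (q : {poly R[i]}) : L2 m (fun y => complex.Re q.[val y]).
Proof.
have [M _ pM] := poly_circle_bounded q.
apply: (L2_bounded m (M := M)); first exact: measurable_Re_poly.
by move=> y; exact: le_trans (ler_Re_cmod _) (pM y).
Qed.

Let L2_Im (q : {poly R[i]}) : L2 m (fun y => complex.Im q.[val y]).
Proof.
have [M _ pM] := poly_circle_bounded q.
apply: (L2_bounded m (M := M)); first exact: measurable_Im_poly.
by move=> y; exact: le_trans (ler_Im_cmod _) (pM y).
Qed.

Lemma cvg_conj_Re : {ae m, forall y, complex.Re (p j).[val y] @[j --> \oo] --> s y}.
Proof.
have dL2 j : L2 m (fun y => complex.Re (p j).[val y] - s y) by exact: L2B.
have B j : (\int[m]_y ((complex.Re (p j).[val y] - s y) ^+ 2)%:E <= (1 / (2 ^ j)%:R ^+ 2)%:E)%E.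
  by rewrite (L2_EFin (dL2 j)) lee_fin div1r; exact: conj_approx_err.
have := ae_summable (fun j => (dL2 j).1) ler01 B; apply: filterS => y.
move=> /cvg_series_cvg_0 /cvgrPdist_lt py; apply/cvgrPdist_lt => e e0.
have := py _ e0; apply: filterS => j.
by rewrite sub0r normrN normr_id distrC.
Qed.

(** All approximating polynomials take the value [\int s] at the origin, so consecutive differences
    vanish there and [integral_poly_sqr] bounds their imaginary parts by their real parts, which are
    small in mean square. The telescoping series of imaginary parts then converges almost
    everywhere. *)
Lemma cvg_conj_Im : {ae m, forall y,
  complex.Im (p j).[val y] @[j --> \oo] --> conj_fun s y}.
Proof.
have qE j y : complex.Im (p j.+1).[val y] - complex.Im (p j).[val y] =
    complex.Im (p j.+1 - p j).[val y] by rewrite hornerD hornerN raddfB.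
have dL2 j : L2 m (fun y => complex.Im (p j.+1).[val y] - complex.Im (p j).[val y]).
  exact: L2B.
have B j : (\int[m]_y ((complex.Im (p j.+1).[val y] - complex.Im (p j).[val y]) ^+ 2)%:E
    <= (4 / (2 ^ j)%:R ^+ 2)%:E)%E.
  rewrite (L2_EFin (dL2 j)).
  rewrite lee_fin; under eq_Rintegral do rewrite qE.
  apply: le_trans (integral_poly_sqr _) _.
    by rewrite hornerD hornerN !conj_approx0 subrr.
  rewrite (_ : (fun y => _) = fun y => (complex.Re (p j.+1).[val y] - s y +
     -1 * (complex.Re (p j).[val y] - s y)) ^+ 2); last first.
    by apply/funext => y; rewrite hornerD hornerN raddfB; ring.
  apply: le_trans (le_int_sqrD _ _) _; [exact: L2B|by apply: L2Z; exact: L2B|].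
  under [X in _ + 2 * X]eq_Rintegral do rewrite mulN1r sqrrN.
  have h1 := conj_approx_err j; have h2 := conj_approx_err j.+1.
  have : ((2 ^ j.+1)%:R ^+ 2 : R)^-1 <= ((2 ^ j)%:R ^+ 2)^-1.
    rewrite lef_pV2 ?posrE ?exprn_gt0 ?ltr0n ?expn_gt0//.
    by rewrite ler_pXn2r ?nnegrE// ler_nat leq_exp2l.
  exact: double_sum_le h2 h1.
have := ae_summable (fun j => (dL2 j).1) (ler0n _ 4) B; apply: filterS => y hy.
have : cvgn (series (telescope (fun j => complex.Im (p j).[val y]))).
  exact: normed_cvg hy.
rewrite telescopeK => /cvg_ex[l hl].
pose u0 := complex.Im (p 0%N).[val y].
have ul : complex.Im (p j).[val y] @[j --> \oo] --> (l + u0 : R).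
  rewrite (_ : (fun j => _) = (fun j => (complex.Im (p j).[val y] - u0) + u0)).
    by apply: cvgD; [exact: hl|exact: cvg_cst].
  by apply/funext => j; rewrite subrK.
have hlE : (complex.Im (p j).[val y])%:E @[j --> \oo] --> (l + u0)%:E.
  by apply: cvg_EFin; [apply: nearW|exact: ul].
by rewrite /conj_fun; have [_ ->] := cvg_limn_einf_sup hlE.
Qed.

(** For each approximant, combine [integral_poly_sqr] with the contraction of Fejer means; Fatou's
    lemma then reaches the limit. *)
Lemma int_conj_sqr : \int[m]_y (conj_fun s y ^+ 2) <= \int[m]_y (s y ^+ 2) /\
  L2 m (conj_fun s).
Proof.
have mc := measurable_conj_fun.
have h : (\int[m]_y (conj_fun s y ^+ 2)%:E <= (\int[m]_y (s y ^+ 2))%:E)%E.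
  have mI j : measurable_fun setT (fun y => ((complex.Im (p j).[val y]) ^+ 2)%:E).
    by apply/measurable_EFinP; apply: measurable_funX; exact: measurable_Im_poly.
  have mC : measurable_fun setT (fun y => (conj_fun s y ^+ 2)%:E).
    by apply/measurable_EFinP; exact: measurable_funX.
  have I0 j y : setT y -> (0 <= ((complex.Im (p j).[val y]) ^+ 2)%:E)%E.
    by move=> _; rewrite lee_fin sqr_ge0.
  have mL : measurable_fun setT (fun y => limn_einf (fun j => ((complex.Im (p j).[val y]) ^+ 2)%:E)).
    rewrite (_ : (fun y => _) = fun y => (- limn_esup (fun j => - ((complex.Im (p j).[val y]) ^+ 2)%:E))%E).
      apply: measurableT_comp => //; apply: measurable_fun_limn_esup => j.
      exact: measurableT_comp.
    by apply/funext => y; rewrite -limn_einfN; congr limn_einf; apply/funext => j /=; rewrite ?oppeK ?opprK.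
  have -> : (\int[m]_y (conj_fun s y ^+ 2)%:E =
      \int[m]_y limn_einf (fun j => ((complex.Im (p j).[val y]) ^+ 2)%:E))%E.
    apply: ae_eq_integral => //.
    have := cvg_conj_Im; apply: filterS => y hy _.
    have hyE : ((complex.Im (p j).[val y]) ^+ 2)%:E @[j --> \oo] --> (conj_fun s y ^+ 2)%:E.
      apply: cvg_EFin; first by apply: nearW.
      exact: (cvgM hy hy).
    by have [-> _] := cvg_limn_einf_sup hyE.
  apply: le_trans (fatou m measurableT mI I0) _.
  rewrite limn_einf_lim; apply: lime_le; first exact: is_cvg_einfs.
  apply: nearW => j; apply: (@le_trans _ _ (\int[m]_y (complex.Im (p j).[val y] ^+ 2)%:E)%E).
    by apply: ereal_inf_lbound; exists j => /=.
  rewrite L2_EFin// lee_fin.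
  apply: le_trans (fejer_mean_contract (conj_idx s j) sL2).
  by apply: integral_poly_sqr; rewrite fejer_at0.
have cL2 : L2 m (conj_fun s) by apply: L2_intlty => //; exact: le_lt_trans h (ltry _).
by split=> //; rewrite -lee_fin -L2_EFin.
Qed.

End Conjugate.

(** * Measurable dependence of the conjugate function on a parameter *)

Section ConjugateMeasurability.
Context (R : realType) (d : measure_display) (T : measurableType d).
Local Notation C := (circle R).
Local Notation m := (@circle_haar R).

Lemma measurable_Rintegral_param (g : T * C -> R) : measurable_fun setT g ->
  measurable_fun setT (fun w => \int[m]_y g (w, y)).
Proof.
move=> mg; have mgE : measurable_fun setT (EFin \o g) by exact/measurable_EFinP.
apply: (@measurableT_comp _ _ _ _ _ _ (@fine R)) => //.
rewrite (_ : (fun w => _) = fun w =>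
    (\int[m]_y ((EFin \o g)^\+ (w, y)) - \int[m]_y ((EFin \o g)^\- (w, y)))%E); last first.
  apply/funext => w; rewrite -[LHS]/(\int[m]_y ((EFin \o g) \o (pair w)) y)%E integralE.
  by rewrite funepos_comp funeneg_comp.
apply: emeasurable_funB.
  apply: (measurable_fun_fubini_tonelli_F (EFin \o g)^\+)%E.
  - exact: measurable_funepos.
  - by move=> p; exact: funepos_ge0.
apply: (measurable_fun_fubini_tonelli_F (EFin \o g)^\-)%E.
- exact: measurable_funeneg.
- by move=> p; exact: funeneg_ge0.
Qed.

Lemma cmeas_sum (I : Type) (r : seq I) e (S : measurableType e) (c : I -> S -> R[i]) :
  (forall i, cmeas (c i)) -> cmeas (fun w => \sum_(i <- r) c i w).
Proof.
move=> mc; elim: r => [|i r IH].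
  by under eq_fun do rewrite big_nil; exact: cmeas_cst.
by under eq_fun do rewrite big_cons; exact: cmeasD.
Qed.

Lemma measurable_select (e : measure_display) (S : measurableType e) (N : S -> nat)
    (f : nat -> S -> R) :
  (forall n, measurable (N @^-1` [set n])) -> (forall n, measurable_fun setT (f n)) ->
  measurable_fun setT (fun w => f (N w) w).
Proof.
move=> mN mf _ B mB; rewrite setTI.
rewrite (_ : _ @^-1` B = \bigcup_n (N @^-1` [set n] `&` f n @^-1` B)).
  apply: bigcupT_measurable => n; apply: measurableI => //.
  by rewrite -[X in measurable X]setTI; exact: mf.
apply/seteqP; split=> [w Bw|w [n _ [/= <-]]//].
by exists (N w).
Qed.

Variable u : T * C -> R.
Hypothesis mu : measurable_fun setT u.
Let v (w : T) (y : C) := u (w, y).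

Lemma cmeas_fourier k : cmeas (fun w => fourier (v w) k).
Proof.
split; rewrite /fourier /=.
  apply: (@measurable_Rintegral_param (fun p => u p * ycos k p.2)).
  by apply: measurable_funM => //; apply: measurableT_comp => //; exact: measurable_ycos.
apply: measurable_funN; apply: (@measurable_Rintegral_param (fun p => u p * ysin k p.2)).
by apply: measurable_funM => //; apply: measurableT_comp => //; exact: measurable_ysin.
Qed.

Lemma cmeas_comp e (S : measurableType e) e' (S' : measurableType e') (f : S -> S') (c : S' -> R[i]) :
  measurable_fun setT f -> cmeas c -> cmeas (fun w => c (f w)).
Proof.
move=> mf [mc mc']; split.
  exact: (measurableT_comp mc mf).
exact: (measurableT_comp mc' mf).
Qed.

Lemma cmeas_fejer N : cmeas (fun p : T * C => (fejer (v p.1) N).[val p.2]).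
Proof.
rewrite (_ : (fun p => _) = fun p : T * C => \sum_(k < N.+1)
    (fejer_weight R N k)%:C * fourier (v p.1) k * val p.2 ^+ k); last first.
  by apply/funext => p; rewrite horner_poly.
apply: cmeas_sum => k; apply: cmeasM; last first.
  by apply: cmeasX; exact: (cmeas_comp (c := fun y : C => val y) measurable_snd (@cmeas_circle R)).
apply: cmeasM; first exact: cmeas_cst.
exact: (cmeas_comp (c := fun w => fourier (v w) k) measurable_fst (cmeas_fourier k)).
Qed.

Lemma measurable_fejer_err N : measurable_fun setT (fun w => fejer_err (v w) N).
Proof.
apply: (@measurable_Rintegral_param (fun p => (fejer_mean (v p.1) N p.2 - u p) ^+ 2)).
by apply: measurable_funX; apply: measurable_funB => //; have [] := cmeas_fejer N.
Qed.

Lemma measurable_conj_idx j n : measurable ((fun w => conj_idx (v w) j) @^-1` [set n]).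
Proof.
pose Q N := [set w | fejer_err (v w) N <= ((2 ^ j)%:R ^+ 2)^-1].
have mQ N : measurable (Q N).
  rewrite (_ : Q N = setT `&` (fun w => fejer_err (v w) N) @^-1` `]-oo, ((2 ^ j)%:R ^+ 2)^-1]%classic).
    exact: measurable_fejer_err.
  by rewrite setTI; apply/seteqP; split=> w; rewrite /Q /= in_itv.
(* A least index is [n] on [Q n] minus the earlier [Q k]; at [n = 0] one adds the set where no index
   works, on which [conj_idx] has its default value. *)
rewrite (_ : _ @^-1` _ = (Q n `&` \bigcap_(k in `I_n) ~` Q k) `|`
    (if n == 0%N then ~` \bigcup_k Q k else set0)); last first.
  apply/seteqP; split=> [w /=|w /=].
    rewrite /conj_idx; case: pselect => [h|h].
      case: ex_minnP => N QN minN <-; left; split=> // k /= kN Qk.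
      by have := minN k Qk; rewrite leqNgt kN.
    move=> <-; rewrite eqxx; right=> -[k _ Qk]; apply: h; by exists k.
  move=> [[Qn minn]|].
    rewrite /conj_idx; case: pselect => [h|[]]; last by exists n.
    case: ex_minnP => N QN minN; apply/eqP; rewrite eqn_leq minN//= leqNgt.
    by apply/negP => Nn; exact: (minn N Nn).
  case: eqP => [-> nQ|//]; rewrite /conj_idx; case: pselect => [[k Qk]|//].
  by exfalso; apply: nQ; exists k.
apply: measurableU; last by case: ifP => // _; apply: measurableC; exact: bigcupT_measurable.
apply: measurableI => //.
rewrite (_ : \bigcap_(k in `I_n) _ = \bigcap_k (if (k < n)%N then ~` Q k else setT)).
  by apply: bigcapT_measurable => k; case: ifP => // _; exact: measurableC.
apply/seteqP; split=> w h k /=; first by move=> _; case: ifP => // kn; exact: h.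
by move=> kn; have := h k I; rewrite kn.
Qed.

Lemma measurable_conj_param : measurable_fun setT (fun p : T * C => conj_fun (v p.1) p.2).
Proof.
apply: (@measurableT_comp _ _ _ _ _ _ (@fine R)) => //.
apply: measurable_fun_limn_esup => j; apply/measurable_EFinP.
apply: (@measurable_select _ (T * C)%type (fun p => conj_idx (v p.1) j)
  (fun N p => complex.Im (fejer (v p.1) N).[val p.2])) => n.
  rewrite (_ : _ @^-1` _ = fst @^-1` ((fun w => conj_idx (v w) j) @^-1` [set n]))//.
  rewrite -[X in measurable X]setTI; apply: measurable_fst => //.
  exact: measurable_conj_idx.
by have [] := cmeas_fejer n.
Qed.

End ConjugateMeasurability.

(** * Moments and the Hardy space *)

Section Moments.
Context (R : realType) (X : completeNormedModType R[i]).
Local Notation C := (circle R).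
Local Notation m := (@circle_haar R).
Implicit Types (f : C -> X) (p : {poly R[i]}).

Definition moment f n : X := bochner_integral m (fun y => val y ^+ n *: f y).

Lemma bint_poly p f : bint m f -> bint m (fun y => p.[val y] *: f y).
Proof.
have [M _ pM] := poly_circle_bounded p.
by apply: (bintM (M := M)) => //; apply: cmeas_poly; exact: cmeas_circle.
Qed.

Lemma moment0 f : moment f 0 = bochner_integral m f.
Proof. by congr bochner_integral; apply/funext => y; rewrite expr0 scale1r. Qed.

Lemma bochner_poly f v p : bint m f -> moment f 0 = v ->
  (forall n, moment f n.+1 = 0) ->
  bochner_integral m (fun y => p.[val y] *: f y) = p.[0] *: v.
Proof.
move=> bf f0 fS.
suff h n : bochner_integral m (fun y => (p.[val y] * val y ^+ n) *: f y) =
    if n is 0 then p.[0] *: v else 0.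
  by rewrite -(h 0%N); congr bochner_integral; apply/funext => y; rewrite expr0 mulr1.
have bX q k : bint m (fun y => (q.[val y] * val y ^+ k) *: f y).
  by have := bint_poly (q * 'X^k) bf; under eq_fun do rewrite hornerM hornerXn.
elim/poly_ind: p n => [|p a IH] n.
  under eq_fun do rewrite horner0 mul0r scale0r.
  by rewrite bochner0 horner0 scale0r; case: n.
rewrite (_ : (fun y => _) = fun y => (p.[val y] * val y ^+ n.+1) *: f y +
    a *: (val y ^+ n *: f y)); last first.
  by apply/funext => y; rewrite hornerMXaddC mulrDl scalerDl scalerA -mulrA -exprS.
have bn : bint m (fun y => val y ^+ n *: f y).
  by have := bX 1%:P n; under eq_fun do rewrite hornerC mul1r.
rewrite bochnerD//; last exact: bintZ.
rewrite IH add0r bochnerZ// -/(moment f n) hornerMXaddC mulr0 add0r.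
by case: n {bn} => [|n]; [rewrite f0|rewrite fS scaler0].
Qed.

Lemma cvg_cmod_expr (q : R[i]) : cmod q < 1 -> cmod q ^+ n @[n --> \oo] --> (0 : R).
Proof. by move=> q1; apply: cvg_expr; rewrite ger0_norm ?cmod_ge0. Qed.

Lemma cmod1D_ge1 (a : R[i]) : 0 <= complex.Re a -> 1 <= cmod (1 + a).
Proof.
move=> a0; apply: le_trans (ler_Re_cmod _); apply: le_trans (ler_norm _).
by rewrite raddfD /= lerDl.
Qed.

(* Where [Re p >= 0], [1 + p] lies in the disk of center [M] and radius less
   than [M] for [M] large, so the Neumann series of [1 / (1 + p)] converges. *)
Lemma bochner_inv1D f v p : bint m f -> moment f 0 = v ->
  (forall n, moment f n.+1 = 0) -> (forall y : C, 0 <= complex.Re p.[val y]) ->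
  0 <= complex.Re p.[0] ->
  bochner_integral m (fun y => (1 + p.[val y])^-1 *: f y) = (1 + p.[0])^-1 *: v.
Proof.
move=> bf f0 fS p0 p00.
have [M0 M00 pM0] := poly_circle_bounded (1 + p).
(* One bound for [|1 + p|] on the circle and at the origin. With [M = B ^+ 2], the square of
   [|1 - (1 + p) / M|] is at most [1 + (1 - 2 Re (1 + p)) / M], which is less than 1. *)
pose B := M0 + cmod (1 + p.[0]).
have B1 : 1 <= B by apply: le_trans (cmod1D_ge1 p00) _; rewrite lerDr ltW.
pose M : R := B ^+ 2.
have M1 : 1 <= M by rewrite exprn_ege1.
have M_gt0 : 0 < M by exact: lt_le_trans M1.
pose q : {poly R[i]} := 1 - (M^-1)%:C *: (1 + p).
have q1 (x : R[i]) : 0 <= complex.Re p.[x] -> cmod (1 + p.[x]) <= B ->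
    cmod q.[x] < 1 /\ q.[x] = 1 - (M^-1)%:C * (1 + p.[x]).
  move=> px pB; have qE : q.[x] = 1 - (M^-1)%:C * (1 + p.[x]).
    by rewrite hornerD hornerN hornerZ hornerD !hornerC.
  split=> //; rewrite qE.
  have pB2 : cmod (1 + p.[x]) ^+ 2 <= M by rewrite ler_pXn2r ?nnegrE ?cmod_ge0// (le_trans ler01).
  suff : cmod (1 - (M^-1)%:C * (1 + p.[x])) ^+ 2 < 1.
    by rewrite expr_lt1// cmod_ge0.
  rewrite !sqr_cmod in pB2 *; case: p.[x] px pB2 => a b /= a0 pB2.
  rewrite ?mul0r ?add0r ?addr0 ?subr0 ?sub0r.
  rewrite (_ : _ + _ = 1 + M^-1 * (M^-1 * ((1 + a) ^+ 2 + (0 + b) ^+ 2) - 2 * (1 + a))); last by ring.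
  rewrite gtrDl pmulr_rlt0 ?invr_gt0// subr_lt0.
  apply: (@le_lt_trans _ _ 1); last by lra.
  by rewrite mulrC ler_pdivrMr// mul1r.
have qy (y : C) : cmod q.[val y] < 1 /\ q.[val y] = 1 - (M^-1)%:C * (1 + p.[val y]).
  apply: q1 => //; have := pM0 y; rewrite hornerD hornerC => /le_trans; apply.
  by rewrite lerDl cmod_ge0.
have q0 : cmod q.[0] < 1 /\ q.[0] = 1 - (M^-1)%:C * (1 + p.[0]).
  by apply: q1 => //; rewrite lerDr ltW.
pose S K : {poly R[i]} := (M^-1)%:C *: \sum_(j < K) q ^+ j.
have SE (x : R[i]) K : 0 <= complex.Re p.[x] -> q.[x] = 1 - (M^-1)%:C * (1 + p.[x]) ->
    (S K).[x] = (1 - q.[x] ^+ K) / (1 + p.[x]).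
  move=> px qE; have p1 : 1 + p.[x] != 0.
    by rewrite -cmod_eq0 gt_eqF// (lt_le_trans _ (cmod1D_ge1 px)).
  apply: (mulIf p1); rewrite mulfVK//.
  rewrite hornerZ horner_sum; under eq_bigr do rewrite horner_exp.
  rewrite -mulrA [_ * (1 + _)]mulrC mulrA.
  have -> : (M^-1)%:C * (1 + p.[x]) = 1 - q.[x] by rewrite qE opprB addrCA subrr addr0.
  by rewrite -[RHS]opprB subrX1 -mulNr opprB.
have pV (y : C) : cmod (1 + p.[val y])^-1 <= 1.
  by rewrite cmodV invf_le1 ?(lt_le_trans _ (cmod1D_ge1 _))// cmod1D_ge1.
have cp : cmeas (fun y : C => (1 + p.[val y])^-1).
  apply: cmeasV; have := cmeas_poly (1 + p) (@cmeas_circle R).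
  by under eq_fun do rewrite hornerD hornerC.
have dS (x : R[i]) K : 0 <= complex.Re p.[x] -> q.[x] = 1 - (M^-1)%:C * (1 + p.[x]) ->
    cmod ((S K).[x] - (1 + p.[x])^-1) <= cmod q.[x] ^+ K.
  move=> px qE; rewrite SE// -[X in _ - X]mul1r -mulrBl addrAC subrr add0r mulNr cmodN.
  rewrite cmodM cmodX -[leRHS]mulr1 ler_wpM2l ?exprn_ge0 ?cmod_ge0//.
  by rewrite cmodV invf_le1 ?(lt_le_trans _ (cmod1D_ge1 _))// cmod1D_ge1.
apply: (@bochner_cvgM _ _ _ _ m (fun K y => (S K).[val y]) _ f 2 (fun K => (S K).[0] *: v)) => //.
- by move=> K; apply: cmeas_poly; exact: cmeas_circle.
- move=> K y; have [h1 h2] := qy y; rewrite -[X in cmod X](subrK (1 + p.[val y])^-1).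
  apply: le_trans (ler_cmodD _ _) _; rewrite -[2]/(1 + 1) lerD//.
  by apply: le_trans (dS _ _ _ h2) _ => //; rewrite exprn_ile1 ?cmod_ge0// ltW.
- by move=> y; apply: le_trans (pV y) _; rewrite ler1n.
- apply: nearW => y; have [h1 h2] := qy y.
  apply: (@cvg_le_EFin0 _ _ (fun K => (cmod q.[val y] ^+ K)%:E)).
  + by move=> K; exact: cmod_ge0.
  + by move=> K; rewrite lee_fin; exact: dS.
  + by apply: cvg_EFin; [apply: nearW|exact: cvg_cmod_expr].
- by move=> K; exact: bochner_poly.
- have [h1 h2] := q0; apply/cvg_rnormP.
  apply: (@cvg_le_EFin0 _ _ (fun K => (cmod q.[0] ^+ K * rnorm v)%:E)).
  + by move=> K; exact: rnorm_ge0.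
  + by move=> K; rewrite lee_fin -scalerBl rnormZ ler_wpM2r ?rnorm_ge0//; exact: dS.
  + by apply: cvg_EFin; [apply: nearW|apply: cvg0Mr; exact: cvg_cmod_expr].
Qed.

End Moments.

(** * Cauchy integrals and their complex derivatives *)

Section CauchyKernel.
Context (R : realType) (X : completeNormedModType R[i]).
Local Notation C := (circle R).
Local Notation m := (@circle_haar R).
Implicit Types (f : C -> X) (k : C -> R[i]) (z h : R[i]).

Lemma cmod1B_ge z x : cmod x = 1 -> 1 - cmod z <= cmod (1 - z * x).
Proof.
move=> x1; rewrite lerBlDr; have := ler_cmodD (1 - z * x) (z * x).
by rewrite subrK cmod1 cmodM x1 mulr1.
Qed.

Lemma cmod1B_neq0 z x : cmod x = 1 -> cmod z < 1 -> 1 - z * x != 0.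
Proof.
by move=> x1 z1; rewrite -cmod_eq0 gt_eqF// (lt_le_trans _ (cmod1B_ge z x1))// subr_gt0.
Qed.

Lemma cmod1BV_le z x : cmod x = 1 -> cmod z < 1 -> cmod (1 - z * x)^-1 <= (1 - cmod z)^-1.
Proof.
move=> x1 z1; have h := cmod1B_ge z x1; have z0 : 0 < 1 - cmod z by rewrite subr_gt0.
by rewrite cmodV lef_pV2 ?posrE// (lt_le_trans z0).
Qed.

Section Kernel.
Variables (k : C -> R[i]) (f : C -> X).
Hypotheses (mk : cmeas k) (k1 : forall y, cmod (k y) = 1) (bf : bint m f).

(** Used for [k y = y^-1] and, at the conjugate of [z], for [k y = y]: the analytic and the
    antianalytic half of the Poisson integral. *)
Definition cauchy_integral z : X := bochner_integral m (fun y => (1 - z * k y)^-1 *: f y).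
Definition cauchy_integral' z : X :=
  bochner_integral m (fun y => (k y * (1 - z * k y)^-1 ^+ 2) *: f y).

Lemma cmeas_cauchy z : cmeas (fun y => (1 - z * k y)^-1).
Proof.
by apply: cmeasV; apply: cmeasB; [exact: cmeas_cst|apply: cmeasM => //; exact: cmeas_cst].
Qed.

Lemma bint_cauchy z : cmod z < 1 -> bint m (fun y => (1 - z * k y)^-1 *: f y).
Proof.
move=> z1; apply: (bintM (M := (1 - cmod z)^-1)) => //; first exact: cmeas_cauchy.
by move=> y; exact: cmod1BV_le.
Qed.

Lemma bint_cauchy' z : cmod z < 1 ->
  bint m (fun y => (k y * (1 - z * k y)^-1 ^+ 2) *: f y).
Proof.
move=> z1; apply: (bintM (M := (1 - cmod z)^-1 ^+ 2)) => //.
  by apply: cmeasM => //; apply: cmeasX; exact: cmeas_cauchy.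
move=> y; rewrite cmodM k1 mul1r cmodX ler_pXn2r ?nnegrE ?cmod_ge0//; first exact: cmod1BV_le.
by rewrite invr_ge0 subr_ge0 ltW.
Qed.

(** The difference quotient of the kernel minus its derivative is exactly
    [h k^2 / ((1 - (z + h) k) (1 - z k)^2)]. With [e] half the distance from [z] to the circle, each
    of the three factors below is at least [e] in modulus. *)
Lemma cauchy_diff z : cmod z < 1 -> exists c, exists2 e, 0 < e & forall h, h != 0 ->
  cmod h < e -> cmod (z + h) < 1 /\
  rnorm (h^-1 *: (cauchy_integral (z + h) - cauchy_integral z) - cauchy_integral' z) <= c * cmod h.
Proof.
move=> z1; pose e := (1 - cmod z) / 2.
have e0 : 0 < e by rewrite divr_gt0// subr_gt0.
have bfin : (\int[m]_y (rnorm (f y))%:E)%E \is a fin_num.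
  by rewrite ge0_fin_numE ?integral_ge0//; [case: bf|move=> y _; rewrite lee_fin rnorm_ge0].
exists (e^-1 ^+ 3 * fine (\int[m]_y (rnorm (f y))%:E)%E), e => // h h0 he.
have zh : cmod (z + h) <= 1 - e.
  by apply: le_trans (ler_cmodD _ _) _; rewrite /e in he *; lra.
have zh1 : cmod (z + h) < 1 by apply: le_lt_trans zh _; rewrite gtrBl.
split=> //; rewrite /cauchy_integral /cauchy_integral' -bochnerB; [|exact: bint_cauchy|exact: bint_cauchy].
rewrite -bochnerZ; last by apply: bintB; exact: bint_cauchy.
rewrite -bochnerB; last 2 first.
- by apply: bintZ; apply: bintB; exact: bint_cauchy.
- exact: bint_cauchy'.
set F := (X in bochner_integral _ X).
have FE y : F y = (h * (k y ^+ 2 * (1 - (z + h) * k y)^-1 * (1 - z * k y)^-1 ^+ 2)) *: f y.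
  rewrite /F -scalerBl scalerA -scalerBl; congr (_ *: _).
  have := cmod1B_neq0 (k1 y) zh1; have := cmod1B_neq0 (k1 y) z1.
  by move: (k y) => x n1 n2; field; rewrite h0 n1 n2.
have bF : bint m F.
  apply: bintB; last exact: bint_cauchy'.
  by apply: bintZ; apply: bintB; exact: bint_cauchy.
have [mf intf] := bf.
rewrite -lee_fin; apply: le_trans (ler_bochner bF) _.
apply: (@le_trans _ _ (\int[m]_y ((e^-1 ^+ 3 * cmod h)%:E * (rnorm (f y))%:E))%E).
  apply: ge0_le_integral => //.
  - by move=> y _; rewrite lee_fin rnorm_ge0.
  - by apply: measurable_rnormE; case: bF.
  - by apply: measurable_funeM; exact: measurable_rnormE.
  - move=> y _; rewrite lee_fin FE rnormZ ler_wpM2r ?rnorm_ge0//.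
    rewrite !(cmodX, cmodM, k1) expr1n mul1r mulrC ler_wpM2r ?cmod_ge0//.
    rewrite [e^-1 ^+ 3]exprS ler_pM ?exprn_ge0 ?cmod_ge0//.
      apply: le_trans (cmod1BV_le (k1 y) zh1) _.
      by rewrite lef_pV2 ?posrE ?subr_gt0// lerBrDr addrC -lerBrDr.
    rewrite ler_pXn2r ?nnegrE ?cmod_ge0 ?invr_ge0 ?(ltW e0)//.
    apply: le_trans (cmod1BV_le (k1 y) z1) _.
    by rewrite lef_pV2 ?posrE ?subr_gt0// /e ler_pdivrMr// ler_peMr// ?ler1n// subr_ge0 ltW.
rewrite ge0_integralZl//; last 3 first.
- exact: measurable_rnormE.
- by move=> y _; rewrite lee_fin rnorm_ge0.
- by rewrite lee_fin mulr_ge0 ?cmod_ge0// exprn_ge0// invr_ge0 ltW.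
by rewrite [e^-1 ^+ 3 * _ * _]mulrAC EFinM [in leRHS]EFinM fineK.
Qed.

Lemma cauchy_diff_seq z (h : nat -> R[i]) : cmod z < 1 -> (forall n, h n != 0) ->
  cmod (h n) @[n --> \oo] --> (0 : R) ->
  (h n)^-1 *: (cauchy_integral (z + h n) - cauchy_integral z) @[n --> \oo] --> cauchy_integral' z.
Proof.
move=> z1 h0 hc; have [c [e e0 he]] := cauchy_diff z1.
apply/cvg_rnormP; apply/cvgrPdist_lt => eps eps0.
have hc' : (`|c| * cmod (h n)) @[n --> \oo] --> (0 : R).
  have : (`|c| * cmod (h n)) @[n --> \oo] --> (`|c| * 0 : R) by apply: cvgM => //; exact: cvg_cst.
  by rewrite mulr0.
have /cvgrPdist_lt/(_ _ eps0) := hc'; have /cvgrPdist_lt/(_ _ e0) := hc.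
apply: filterS2 => n; rewrite !sub0r !normrN => h1 h2.
have hn : cmod (h n) < e by apply: le_lt_trans h1; exact: ler_norm.
have [_ h3] := he (h n) (h0 n) hn.
rewrite ger0_norm ?rnorm_ge0//; apply: le_lt_trans h3 _; apply: le_lt_trans h2.
by apply: le_trans (ler_norm _) _; rewrite !normrM normr_id.
Qed.

End Kernel.
End CauchyKernel.

Lemma poisson_fraction (F : fieldType) (x c z : F) : x != 0 ->
  1 - z / x != 0 -> 1 - c * x != 0 ->
  (1 - z * c) / ((x - z) * (x^-1 - c)) = (1 - z / x)^-1 + (1 - c * x)^-1 - 1.
Proof.
move=> x0 n1 n2; have n3 : x - z != 0.
  by apply: contra n1 => /eqP/subr0_eq <-; rewrite divff// subrr.
have n5 : 1 - x * c != 0 by rewrite mulrC.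
by field; rewrite ?x0 ?n3 ?n5 ?n2.
Qed.

Lemma cauchy_square_step (F : fieldType) (x v z k : F) : 1 - z * x != 0 ->
  v * (k + 1 - k * z * x) * (1 - z * x)^-1 ^+ 2 - (k + 1) * v =
  z * (x * v * (k + 1 + 1 - (k + 1) * z * x) * (1 - z * x)^-1 ^+ 2).
Proof. by move=> n1; field. Qed.

Lemma three_term_diff (V : zmodType) (a b c a' b' : V) :
  (a + b - c) - (a' + b' - c) - (a - a') = b - b'.
Proof. by rewrite [- (a' + b' - c)]opprB addrA subrK [- (a' + b')]opprD addrACA addrC addrK. Qed.

(** * Hardy functions as functions with vanishing moments *)

Section HardyMoments.
Context (R : realType) (X : completeNormedModType R[i]).
Local Notation C := (circle R).
Local Notation m := (@circle_haar R).
Implicit Types (f : C -> X) (z h : R[i]).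

Let kinv (y : C) : R[i] := (val y)^-1.
Let kid (y : C) : R[i] := val y.

Lemma cmod_nat n : cmod (n%:R : R[i]) = n%:R.
Proof. by rewrite -(rmorph_nat (real_complex R)) cmod_real ger0_norm. Qed.

Lemma cmod_kinv (y : C) : cmod (kinv y) = 1.
Proof. by rewrite /kinv cmodV cmod_circle invr1. Qed.

Lemma cmeas_kinv : cmeas kinv.
Proof. by apply: cmeasV; exact: cmeas_circle. Qed.

Lemma val_circle_neq0 (y : C) : val y != 0.
Proof. by rewrite -cmod_eq0 cmod_circle oner_eq0. Qed.

(** Expand the kernel in a geometric series: only the moment of order zero survives. *)
Lemma cauchy_kid f v z : bint m f -> moment f 0 = v ->
  (forall n, moment f n.+1 = 0) -> cmod z < 1 -> cauchy_integral kid f z = v.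
Proof.
move=> bf f0 fS z1.
pose S K : {poly R[i]} := \sum_(j < K.+1) (z *: 'X) ^+ j.
have zy (y : C) : cmod (z * val y) = cmod z by rewrite cmodM cmod_circle mulr1.
have SE (y : C) K : (S K).[val y] - (1 - z * val y)^-1 = - (z * val y) ^+ K.+1 * (1 - z * val y)^-1.
  have n1 := cmod1B_neq0 (cmod_circle y) z1.
  apply: (mulIf n1); rewrite mulrBl !mulVf// mulfVK//.
  rewrite horner_sum (eq_bigr (fun j : 'I_K.+1 => (z * val y) ^+ j)); last first.
    by move=> j _; rewrite horner_exp hornerZ hornerX.
  rewrite -[(1 - z * val y) in LHS]opprB mulrN mulrC -subrX1.
  by rewrite opprB addrAC subrr add0r.
have dS (y : C) K : cmod ((S K).[val y] - (1 - z * val y)^-1) <= cmod z ^+ K * (1 - cmod z)^-1.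
  rewrite SE mulNr cmodN cmodM cmodX zy ler_pM ?exprn_ge0 ?cmod_ge0//.
    by rewrite exprS ler_piMl ?exprn_ge0 ?cmod_ge0// ltW.
  exact: cmod1BV_le (cmod_circle y) z1.
have z1' : 0 <= (1 - cmod z)^-1 by rewrite invr_ge0 subr_ge0 ltW.
apply: (@bochner_cvgM _ _ _ _ m (fun K (y : C) => (S K).[val y]) _ f
   (2 * (1 - cmod z)^-1) (fun K => (S K).[0] *: v)) => //.
- by move=> K; apply: cmeas_poly; exact: cmeas_circle.
- by apply: cmeas_cauchy; exact: cmeas_circle.
- move=> K y; rewrite -[X in cmod X](subrK (1 - z * val y)^-1).
  apply: le_trans (ler_cmodD _ _) _; rewrite mulr_natl mulr2n lerD//.
    by apply: le_trans (dS _ _) _; rewrite ler_piMl// exprn_ile1 ?cmod_ge0// (ltW z1).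
  exact: cmod1BV_le (cmod_circle y) z1.
- move=> y; apply: le_trans (cmod1BV_le (cmod_circle y) z1) _.
  by rewrite ler_peMl// ler1n.
- apply: nearW => y; apply: (@cvg_le_EFin0 _ _ (fun K => (cmod z ^+ K * (1 - cmod z)^-1)%:E)).
  + by move=> K; exact: cmod_ge0.
  + by move=> K; rewrite lee_fin; exact: dS.
  + by apply: cvg_EFin; [apply: nearW|apply: cvg0Mr; exact: cvg_cmod_expr].
- by move=> K; exact: bochner_poly.
- rewrite (_ : (fun K => _) = fun=> v); first exact: cvg_cst.
  apply/funext => K; rewrite horner_sum big_ord_recl /= expr0 hornerC big1 ?addr0 ?scale1r//.
  by move=> j _; rewrite horner_exp hornerZ hornerX mulr0 expr0n.
Qed.

Lemma poisson_kernelE z (y : C) : cmod z < 1 ->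
  poisson_kernel z y = (1 - z * kinv y)^-1 + (1 - z^*%C * kid y)^-1 - 1.
Proof.
move=> z1; rewrite /poisson_kernel /kinv /kid.
have y0 := val_circle_neq0 y.
have zJ1 : cmod z^*%C < 1 by rewrite /cmod normcJ.
have n1 := cmod1B_neq0 (cmod_kinv y) z1; rewrite /kinv in n1.
have n2 := cmod1B_neq0 (cmod_circle y) zJ1.
have yy : (val y)^*%C = (val y)^-1.
  apply: (mulfI y0); rewrite divff// -[LHS]normCK.
  by rewrite cmodE cmod_circle expr1n.
rewrite !normCK rmorphB /= [(val y)^*]yy.
exact: poisson_fraction.
Qed.

Lemma harmonic_extensionE f z : bint m f -> cmod z < 1 ->
  harmonic_extension f z = cauchy_integral kinv f z + cauchy_integral kid f z^*%C - moment f 0.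
Proof.
move=> bf z1; have zJ1 : cmod z^*%C < 1 by rewrite /cmod normcJ.
have b1 := bint_cauchy cmeas_kinv cmod_kinv bf z1.
have b2 := bint_cauchy (@cmeas_circle R) (@cmod_circle R) bf zJ1.
rewrite /harmonic_extension moment0 /cauchy_integral -(bochnerD b1 b2) -(bochnerB (bintD b1 b2) bf).
congr bochner_integral; apply/funext => y.
by rewrite poisson_kernelE// scalerBl scalerDl scale1r.
Qed.

Lemma near0_cmod (e : R) : 0 < e -> \forall h \near (0 : R[i]^o)^', cmod h < e.
Proof.
move=> e0; apply/nbhs_dnbhs/nbhs_ballP; exists e%:C; first by rewrite /= ltcR.
by move=> h; rewrite -ball_normE /ball_/= sub0r normrN cmodE ltcR.
Qed.

(** The antianalytic half of the Poisson integral vanishes by [cauchy_kid], so the extension is the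
    Cauchy integral with kernel [y^-1], which is complex differentiable. *)
Lemma H1_0_of_moments f : bint m f -> (forall n, moment f n = 0) -> H1_0 f.
Proof.
move=> bf f0; split; first by split; [exact: bint_bochner|rewrite -moment0].
move=> z; rewrite cmodE ltcR => z1.
have uE h : cmod (z + h) < 1 -> harmonic_extension f (z + h) = cauchy_integral kinv f (z + h).
  move=> zh; have zhJ : cmod (z + h)^*%C < 1 by rewrite /cmod normcJ.
  rewrite (harmonic_extensionE bf zh) f0 subr0.
  by rewrite (cauchy_kid bf (f0 0) (fun n => f0 n.+1) zhJ) addr0.
have [c [e e0 he]] := cauchy_diff cmeas_kinv cmod_kinv bf z1.
apply/cvg_ex; exists (cauchy_integral' kinv f z); apply/cvg_rnormP.
apply/cvgrPdist_lt => eps eps0.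
have ce0 : 0 < eps / (`|c| + 1) by rewrite divr_gt0// ltr_pwDr.
have hn0 : \forall h \near (0 : R[i]^o)^', h != 0 by by apply: filterS (@nbhs_dnbhs_neq _ (0 : R[i]^o)) => h.
move: hn0 (near0_cmod e0) (near0_cmod ce0); apply: filterS3 => h h0 h1 h2 /=.
have [zh1 h3] := he h h0 h1.
rewrite sub0r normrN ger0_norm ?rnorm_ge0//.
rewrite (_ : h *: 1 + z = z + h); last by rewrite addrC /GRing.scale /= mulr1.
rewrite uE// -[X in harmonic_extension f X]addr0 uE ?addr0//.
apply: le_lt_trans h3 _; move: h2; rewrite ltr_pdivlMr ?ltr_pwDr// => h2.
apply: le_lt_trans h2; rewrite mulrC ler_wpM2l ?cmod_ge0//.
by apply: le_trans (ler_norm _) _; rewrite lerDl.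
Qed.

Lemma derivable_seq (u : R[i] -> X) z : derivable (u : R[i]^o -> X) z 1 ->
  exists L : X, forall h : nat -> R[i], (forall n, h n != 0) ->
    cmod (h n) @[n --> \oo] --> (0 : R) ->
    (h n)^-1 *: (u (z + h n) - u z) @[n --> \oo] --> L.
Proof.
move=> /cvg_ex[L /cvg_rnormP/cvgrPdist_lt uL]; exists L => h h0 hc.
apply/cvg_rnormP/cvgrPdist_lt => e e0.
have /nbhs_ballP[[r r'] /=] := uL _ e0.
rewrite ltcE/= => /andP[/eqP -> r0] rL.
have /cvgrPdist_lt/(_ _ r0) := hc; apply: filterS => n.
rewrite sub0r normrN ger0_norm ?cmod_ge0// => hr.
have /= := rL (h n) _ (h0 n).
rewrite (_ : h n *: 1 + z = z + h n); last by rewrite addrC /GRing.scale /= mulr1.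
by apply; rewrite -ball_normE /ball_/= sub0r normrN cmodE ltcE/= eqxx.
Qed.

(* Cauchy-Riemann: approaching [z] along real and along imaginary increments
   gives the antianalytic part of the extension opposite derivatives. *)
Lemma cauchy_kid'_eq0 f z : bint m f -> H1_0 f -> cmod z < 1 -> cauchy_integral' kid f z^*%C = 0.
Proof.
move=> bf [_ af] z1; have zJ1 : cmod z^*%C < 1 by rewrite /cmod normcJ.
have [|L hL] := derivable_seq (af z _); first by rewrite cmodE ltcR.
pose e := (1 - cmod z) / 2.
have e0 : 0 < e by rewrite divr_gt0// subr_gt0.
(* Increments shrinking to 0 along the direction [a]. Subtracting the analytic half from the
   extension leaves the difference quotient of the antianalytic half; [a = 1] and [a = i] are used,
   where conjugation acts on the increments as the identity and as the opposite. *)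
have key (a : R[i]) : cmod a = 1 -> exists2 h : nat -> R[i],
    (forall n, h n != 0 /\ (h n = a * (cmod (h n))%:C)) &
    ((h n)^-1 *: (cauchy_integral kid f (z^*%C + (h n)^*%C) - cauchy_integral kid f z^*%C) @[n --> \oo]
      --> L - cauchy_integral' kinv f z) /\ cmod (h n) @[n --> \oo] --> (0 : R).
  move=> a1; pose h n : R[i] := a * (e * n.+1%:R^-1)%:C.
  have en n : 0 < e * n.+1%:R^-1 by rewrite mulr_gt0 ?invr_gt0.
  have ch n : cmod (h n) = e * n.+1%:R^-1.
    by rewrite /h cmodM a1 mul1r cmod_real ger0_norm// ltW.
  have h0 n : h n != 0 by rewrite -cmod_eq0 ch gt_eqF.
  have hc : cmod (h n) @[n --> \oo] --> (0 : R).
    rewrite (_ : (fun n => _) = fun n => n.+1%:R^-1 * e).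
      by apply: cvg0Mr; exact: cvg_harmonic.
    by apply/funext => n; rewrite ch mulrC.
  exists h; first by move=> n; rewrite ch.
  split=> //; have zh n : cmod (z + h n) < 1.
    apply: le_lt_trans (ler_cmodD _ _) _; rewrite ch.
    apply: (@le_lt_trans _ _ (cmod z + e)); last by rewrite /e; lra.
    by rewrite lerD2l ler_piMr ?(ltW e0)// invf_le1// ler1n.
  rewrite (_ : (fun n => _) = fun n => (h n)^-1 *: (harmonic_extension f (z + h n) -
      harmonic_extension f z) - (h n)^-1 *: (cauchy_integral kinv f (z + h n) - cauchy_integral kinv f z)).
    apply: cvgB; first exact: hL.
    exact: (cauchy_diff_seq cmeas_kinv cmod_kinv).
  apply/funext => n; rewrite (harmonic_extensionE bf (zh n)) (harmonic_extensionE bf z1).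
  by rewrite -scalerBr three_term_diff rmorphD.
have [h hE [hL1 hc]] := key 1 (cmod1 _).
have hJ n : (h n)^*%C = h n by have [_ ->] := hE n; rewrite mul1r; exact: conjc_real.
have h1 : (h n)^-1 *: (cauchy_integral kid f (z^*%C + (h n)^*%C) - cauchy_integral kid f z^*%C) @[n --> \oo]
    --> cauchy_integral' kid f z^*%C.
  rewrite (_ : (fun n => _) = fun n => (h n)^-1 *: (cauchy_integral kid f (z^*%C + h n) - cauchy_integral kid f z^*%C)).
    by apply: (cauchy_diff_seq (@cmeas_circle R) (@cmod_circle R)) => // n; case: (hE n).
  by apply/funext => n; rewrite hJ.
have ci1 : cmod (0 +i* 1 : R[i]) = 1 by rewrite /cmod normc_def /= expr0n expr1n add0r sqrtr1.
have [g gE [gL1 gc]] := key _ ci1.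
have gJ n : (g n)^*%C = - g n.
  have [_ ->] := gE n; move: (cmod (g n)) => c; apply/eqP; rewrite eq_complex /=.
  by apply/andP; split; apply/eqP; ring.
have g1 : (g n)^-1 *: (cauchy_integral kid f (z^*%C + (g n)^*%C) - cauchy_integral kid f z^*%C) @[n --> \oo]
    --> - cauchy_integral' kid f z^*%C.
  rewrite (_ : (fun n => _) = fun n => - ((- g n)^-1 *: (cauchy_integral kid f (z^*%C + (- g n)) - cauchy_integral kid f z^*%C))).
    apply: cvgN; apply: (cauchy_diff_seq (@cmeas_circle R) (@cmod_circle R)) => // [n|].
      by rewrite oppr_eq0; case: (gE n).
    by under eq_fun do rewrite cmodN.
  by apply/funext => n; rewrite gJ invrN scaleNr opprK.
have e1 := cvg_unique (@norm_hausdorff _ X) g1 gL1.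
have e2 := cvg_unique (@norm_hausdorff _ X) h1 hL1.
rewrite -e2 in e1; have /eqP : cauchy_integral' kid f z^*%C *+ 2 = 0 by rewrite mulr2n -{1}e1 addNr.
by rewrite -scaler_nat scaler_eq0 pnatr_eq0 /= => /eqP.
Qed.

(** The moments of positive order are, up to integer factors, the Taylor coefficients of the
    antianalytic derivative, which is zero on the disk. They are peeled off one by one: let [z] tend
    to 0, then divide by [z]. *)
Lemma moments_of_H1_0 f : bint m f -> H1_0 f -> forall n, moment f n = 0.
Proof.
move=> bf hf; have [[_ f0] _] := hf.
(* The tail of the series of [y / (1 - z y)^2] from order [n] on, divided by [z^n], that is the sum
   over [j] of [(n + 1 + j) z^j y^(n + 1 + j)]. *)
pose w n z (y : C) : R[i] := val y ^+ n.+1 * (n.+1%:R - n%:R * z * val y) * (1 - z * val y)^-1 ^+ 2.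
have wE n z (y : C) : cmod z < 1 -> w n z y - n.+1%:R * val y ^+ n.+1 = z * w n.+1 z y.
  move=> z1; have n1 := cmod1B_neq0 (cmod_circle y) z1.
  by rewrite /w ![val y ^+ _.+2]exprS -[n.+2%:R]natr1 -[n.+1%:R]natr1; exact: cauchy_square_step.
have wb n z (y : C) : cmod z <= 2^-1 -> cmod (w n z y) <= (2 * n%:R + 1) * 4.
  move=> z1; rewrite /w !(cmodX, cmodM, cmod_circle) expr1n mul1r.
  have z1' : cmod z < 1 by apply: le_lt_trans z1 _; lra.
  have n0 := ler0n R n.
  apply: ler_pM; rewrite ?exprn_ge0 ?cmod_ge0//.
    apply: le_trans (ler_cmodB _ _) _.
    rewrite !cmodM cmod_circle mulr1 !cmod_nat -natr1.
    have : n%:R * cmod z <= n%:R * 2^-1 by rewrite ler_wpM2l.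
    by lra.
  rewrite (_ : 4 = 2 ^+ 2); last by ring.
  rewrite ler_pXn2r ?nnegrE ?cmod_ge0//.
  apply: le_trans (cmod1BV_le (cmod_circle y) z1') _.
  by rewrite -[2]invrK lef_pV2 ?posrE ?invr_gt0// ?subr_gt0//; lra.
have mw n z : cmeas (w n z).
  apply: cmeasM; last by apply: cmeasX; apply: cmeas_cauchy; exact: cmeas_circle.
  apply: cmeasM; first by apply: cmeasX; exact: cmeas_circle.
  apply: cmeasB; first exact: cmeas_cst.
  by apply: cmeasM; [exact: cmeas_cst|exact: cmeas_circle].
have bw n z : cmod z < 1 -> bint m (fun y => w n z y *: f y).
  move=> z1; apply: (bintM (M := (n.+1%:R + n%:R) * (1 - cmod z)^-1 ^+ 2)) => //.
  move=> y; rewrite /w !(cmodX, cmodM, cmod_circle) expr1n mul1r.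
  apply: ler_pM; rewrite ?exprn_ge0 ?cmod_ge0//.
    apply: le_trans (ler_cmodB _ _) _.
    rewrite !cmodM cmod_circle mulr1 !cmod_nat lerD2l ler_piMr//; exact: ltW.
  have z1' : 0 <= (1 - cmod z)^-1 by rewrite invr_ge0 subr_ge0 ltW.
  rewrite ler_pXn2r ?nnegrE ?cmod_ge0//.
  exact: cmod1BV_le (cmod_circle y) z1.
have bm n : bint m (fun y : C => val y ^+ n *: f y).
  apply: (bintM (M := 1)) => //; first by apply: cmeasX; exact: cmeas_circle.
  by move=> y; rewrite cmodX cmod_circle expr1n.
have step n : (forall z, z != 0 -> cmod z < 1 -> bochner_integral m (fun y => w n z y *: f y) = 0) ->
    moment f n.+1 = 0.
  (* Nonzero points tending to 0 inside the disk of radius [2^-1], on which [wb] bounds [w n]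
     uniformly. *)
  move=> Wn; pose z j : R[i] := (j.+2%:R^-1)%:C.
  have cz j : cmod (z j) = j.+2%:R^-1 by rewrite cmod_real ger0_norm// invr_ge0.
  have z2 j : cmod (z j) <= 2^-1 by rewrite cz lef_pV2 ?posrE// ler_nat.
  have z1 j : cmod (z j) < 1 by apply: le_lt_trans (z2 j) _; lra.
  have zc : cmod (z j) @[j --> \oo] --> (0 : R).
    under eq_fun do rewrite cz.
    by have := @cvg_harmonic R; rewrite -(cvg_shiftS (@harmonic R)).
  have : bochner_integral m (fun y : C => (n.+1%:R * val y ^+ n.+1) *: f y) = 0.
    apply: (@bochner_cvgM _ _ _ _ m (fun j => w n (z j)) _ f ((2 * n%:R + 1) * 4) (fun=> 0)).
    - by move=> j; exact: mw.
    - by apply: cmeasM; [exact: cmeas_cst|apply: cmeasX; exact: cmeas_circle].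
    - by move=> j y; apply: wb.
    - move=> y; rewrite cmodM cmodX cmod_circle expr1n mulr1 cmod_nat -natr1.
      by have := ler0n R n; lra.
    - apply: nearW => y; apply: (@cvg_le_EFin0 _ _ (fun j => (cmod (z j) * ((2 * n.+1%:R + 1) * 4))%:E)).
      + by move=> j; exact: cmod_ge0.
      + by move=> j; rewrite lee_fin wE// cmodM ler_wpM2l ?cmod_ge0//; exact: wb.
      + by apply: cvg_EFin; [apply: nearW|exact: cvg0Mr].
    - exact: bf.
    - by move=> j; rewrite Wn// -cmod_eq0 cz invr_eq0 pnatr_eq0.
    - exact: cvg_cst.
  under eq_fun do rewrite -scalerA.
  by rewrite (bochnerZ _ (bm n.+1)) => /eqP; rewrite scaler_eq0 pnatr_eq0 /= => /eqP.
have W n : forall z, z != 0 -> cmod z < 1 -> bochner_integral m (fun y => w n z y *: f y) = 0.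
  elim: n => [|n IH] z z0 z1.
    have := cauchy_kid'_eq0 (z := z^*%C) bf hf; rewrite conjcK => /(_ _).
    have zJ1 : cmod z^*%C < 1 by rewrite /cmod normcJ.
    move=> /(_ zJ1) <-; congr bochner_integral; apply/funext => y; congr (_ *: _).
    by rewrite /w expr1 mul0r mul0r subr0 mulr1.
  have := IH z z0 z1.
  rewrite (_ : (fun y => _) = fun y => z *: (w n.+1 z y *: f y) + n.+1%:R *: (val y ^+ n.+1 *: f y)); last first.
    by apply/funext => y; rewrite !scalerA -scalerDl -wE// subrK.
  rewrite bochnerD; [|by apply: bintZ; exact: bw|by apply: bintZ; exact: bm].
  rewrite (bochnerZ _ (bw n.+1 z z1)) (bochnerZ _ (bm n.+1)).
  rewrite -/(moment f n.+1) (step n IH) scaler0 addr0 => /eqP.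
  by rewrite scaler_eq0 (negbTE z0) => /eqP.
case=> [|n]; first by rewrite moment0.
exact: step (W n).
Qed.

End HardyMoments.

(** * Analytic multipliers on a fiber *)

Section Fiber.
Context (R : realType) (X : completeNormedModType R[i]).
Local Notation C := (circle R).
Local Notation m := (@circle_haar R).

(** [excess], [outer] and [multiplier] are the functions [s], [a] and [q] of the overview, with [r]
    for [|z|]. *)
Definition excess (r : R) (w : C -> R) (y : C) : R :=
  if 9 * r < w y then Num.sqrt (w y / (9 * r)) else 0.

Definition outer (r : R) (w : C -> R) (y : C) : R[i] :=
  (1 + (excess r w y +i* conj_fun (excess r w) y))^-1.

Definition multiplier (r : R) (w : C -> R) (y : C) : R[i] :=
  if r == 0 then 0 else outer r w y ^+ 2 * (2 - outer r w y ^+ 2).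

Lemma excess_ge0 r w y : 0 <= excess r w y.
Proof. by rewrite /excess; case: ifP => // _; exact: sqrtr_ge0. Qed.

Lemma cmod_outer r w y : cmod (outer r w y) <= (1 + excess r w y)^-1.
Proof.
have p0 : 0 < 1 + excess r w y by rewrite ltr_pwDl// excess_ge0.
have h : 1 + excess r w y <= cmod (1 + (excess r w y +i* conj_fun (excess r w) y)).
  apply: le_trans (ler_Re_cmod _); apply: le_trans (ler_norm _).
  by [].
by rewrite /outer cmodV lef_pV2 ?posrE// (lt_le_trans p0).
Qed.

Lemma cmod_outer_le1 r w y : cmod (outer r w y) <= 1.
Proof.
apply: le_trans (cmod_outer r w y) _.
by rewrite invf_le1 ?lerDl ?excess_ge0// ltr_pwDl// excess_ge0.
Qed.

Lemma cmod_quartic (a : R[i]) : cmod a <= 1 ->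
  cmod (a ^+ 2 * (2 - a ^+ 2)) <= 3 * cmod a ^+ 2.
Proof.
move=> a1; rewrite cmodM cmodX mulrC ler_wpM2r ?sqr_ge0//.
apply: le_trans (ler_cmodB _ _) _; rewrite cmod_nat cmodX.
have : cmod a ^+ 2 <= 1 by rewrite exprn_ile1 ?cmod_ge0.
by lra.
Qed.

Lemma multiplier_le3 r w y : cmod (multiplier r w y) <= 3.
Proof.
rewrite /multiplier; case: ifP => _; first by rewrite cmod0.
have a1 := cmod_outer_le1 r w y.
apply: le_trans (cmod_quartic a1) _.
by rewrite -[leRHS]mulr1 ler_wpM2l// exprn_ile1 ?cmod_ge0.
Qed.

(** Both regimes give [27 = 3 * 9]: for [w <= 9 r] use [|q| <= 3], otherwise [|q| <= 3 |a|^2] and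
    [|a|^2 <= s^-2 = 9 r / w]. *)
Lemma multiplier_bound r w y : 0 <= r -> cmod (multiplier r w y) * w y <= 27 * r.
Proof.
move=> r0; rewrite /multiplier; have [->|rn0] := eqVneq r 0; first by rewrite cmod0 mul0r mulr0.
have rp : 0 < r by rewrite lt_def rn0.
have q3 := multiplier_le3 r w y; rewrite /multiplier (negbTE rn0) in q3.
have [wr|wr] := leP (w y) (9 * r).
  have [w0|w0] := leP 0 (w y).
    apply: le_trans (ler_wpM2r w0 q3) _; lra.
  by apply: (@le_trans _ _ 0); [rewrite mulr_ge0_le0 ?cmod_ge0// ltW|lra].
have w0 : 0 <= w y by apply: ltW; apply: le_lt_trans wr; lra.
apply: le_trans (ler_wpM2r w0 (cmod_quartic (cmod_outer_le1 _ _ _))) _.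
have e0 := excess_ge0 r w y.
have ha : cmod (outer r w y) ^+ 2 <= (w y / (9 * r))^-1.
  apply: (@le_trans _ _ ((1 + excess r w y)^-1 ^+ 2)).
    rewrite ler_pXn2r ?nnegrE ?cmod_ge0 ?invr_ge0 ?addr_ge0//; exact: cmod_outer.
  rewrite exprVn lef_pV2 ?posrE ?exprn_gt0 ?ltr_pwDl// ?divr_gt0// ?(lt_trans _ wr)//; [|lra|lra].
  have eE : excess r w y ^+ 2 = w y / (9 * r).
    rewrite /excess wr sqr_sqrtr// divr_ge0//; lra.
  by rewrite -eE ler_pXn2r ?nnegrE ?addr_ge0// lerDr.
rewrite invf_div in ha.
apply: (@le_trans _ _ (3 * (9 * r / w y) * w y)).
  by rewrite ler_wpM2r// ler_wpM2l.
by rewrite -mulrA divfK ?gt_eqF ?(lt_trans _ wr)//; lra.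
Qed.

(** Here [1 - q = (1 - a)^2 (1 + a)^2] and [1 - a = S / (1 + S)] with [S = s + i s~]. As
    [Re S >= 0], the modulus of this quotient is at most 1 and at most that of [S]. *)
Lemma one_minus_multiplier r w y : r != 0 ->
  cmod (1 - multiplier r w y) <= 4 /\
  cmod (1 - multiplier r w y) <= 4 * (excess r w y ^+ 2 + conj_fun (excess r w) y ^+ 2).
Proof.
move=> rn0; rewrite /multiplier (negbTE rn0).
have a1 := cmod_outer_le1 r w y; set a := outer r w y in a1 *.
set S := excess r w y +i* conj_fun (excess r w) y.
have n1 : 1 + S != 0.
  rewrite -cmod_eq0 gt_eqF// (lt_le_trans ltr01)// cmod1D_ge1//; exact: excess_ge0.
have aE : 1 - a = S * a by rewrite /a /outer -/S; field.
have h : cmod (1 - a ^+ 2 * (2 - a ^+ 2)) <= 4 * cmod (1 - a) ^+ 2.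
  rewrite (_ : 1 - _ = (1 - a) ^+ 2 * (1 + a) ^+ 2); last by ring.
  rewrite cmodM !cmodX mulrC ler_wpM2r ?sqr_ge0//.
  rewrite (_ : 4 = 2 ^+ 2 :> R); last by ring.
  rewrite ler_pXn2r ?nnegrE ?cmod_ge0//; apply: le_trans (ler_cmodD _ _) _.
  by rewrite cmod1 -[2]/(1 + 1) lerD2l.
split; apply: le_trans h _.
  rewrite ler_piMr// exprn_ile1 ?cmod_ge0//.
  have -> : 1 - a = S / (1 + S) by rewrite aE.
  rewrite cmodM cmodV ler_pdivrMr ?mul1r; last by rewrite lt_def cmod_eq0 n1 cmod_ge0.
  rewrite -(ler_pXn2r (n := 2)) ?nnegrE ?cmod_ge0// !sqr_cmod /= add0r.
  by rewrite lerD2r ler_pXn2r ?nnegrE ?addr_ge0 ?excess_ge0// lerDr.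
rewrite ler_wpM2l// aE cmodM exprMn sqr_cmod /= ler_piMr ?addr_ge0 ?sqr_ge0//.
by rewrite exprn_ile1 ?cmod_ge0.
Qed.

Lemma measurable_excess e (S : measurableType e) (r w : S -> R) :
  measurable_fun setT r -> measurable_fun setT w ->
  measurable_fun setT (fun x => if 9 * r x < w x then Num.sqrt (w x / (9 * r x)) else 0).
Proof.
move=> mr mw; have m9 : measurable_fun setT (fun x => 9 * r x) by exact: measurable_funM.
apply: measurable_fun_ifT => //; first exact: measurable_fun_ltr.
apply: (measurableT_comp (continuous_measurable_fun (@sqrt_continuous R))).
apply: measurable_funM => //.
exact: (measurableT_comp (@measurable_inv R) m9).
Qed.

Section Bounds.
Variables (r : R) (w : C -> R).
Hypotheses (r0 : 0 < r) (mw : measurable_fun setT w) (w0 : forall y, 0 <= w y)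
  (iw : m.-integrable setT (fun y => (w y)%:E)).

Let W y := if 9 * r < w y then w y else 0.

Lemma measurable_excess1 : measurable_fun setT (excess r w).
Proof. by apply: (@measurable_excess _ _ (fun=> r) w). Qed.

Lemma excess_sqr y : excess r w y ^+ 2 = (9 * r)^-1 * W y.
Proof.
rewrite /excess /W; case: ifP => _; last by rewrite expr0n mulr0.
rewrite sqr_sqrtr; first by rewrite mulrC.
by apply: divr_ge0 => //; apply: mulr_ge0 => //; exact: ltW.
Qed.

Lemma integrable_W : m.-integrable setT (fun y => (W y)%:E).
Proof.
apply: (integrable_le _ iw).
  by apply: measurable_fun_ifT => //; exact: measurable_fun_ltr.
by move=> y; rewrite /W; case: ifP => _; rewrite ?ger0_norm// normr0.
Qed.

Lemma L2_excess : L2 m (excess r w).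
Proof.
split; first exact: measurable_excess1.
by under eq_fun do rewrite excess_sqr; apply: RintegrableZ; exact: integrable_W.
Qed.

Lemma cmeas_outer : cmeas (outer r w).
Proof.
apply: cmeasV; apply: cmeasD; first exact: cmeas_cst.
by split; [exact: measurable_excess1|exact: measurable_conj_fun].
Qed.

Lemma cmeas_multiplier : cmeas (multiplier r w).
Proof.
rewrite /multiplier (gt_eqF r0); have ma := cmeasX 2 cmeas_outer.
by apply: cmeasM => //; apply: cmeasB => //; exact: cmeas_cst.
Qed.

Let a j (y : C) : R[i] := (1 + (conj_approx (excess r w) j).[val y])^-1.

Lemma cmod_a j y : cmod (a j y) <= 1.
Proof.
have h := cmod1D_ge1 (conj_approx_Re_ge0 L2_excess (excess_ge0 r w) j y).
by rewrite /a cmodV invf_le1// (lt_le_trans ltr01 h).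
Qed.

Lemma cmeas_a j : cmeas (a j).
Proof.
apply: cmeasV; apply: cmeasD; first exact: cmeas_cst.
by apply: cmeas_poly; exact: cmeas_circle.
Qed.

Lemma cvg_a : {ae m, forall y, cmod (a j y - outer r w y) @[j --> \oo] --> (0 : R)}.
Proof.
have h1 := cvg_conj_Re L2_excess (excess_ge0 r w).
have h2 := cvg_conj_Im L2_excess (excess_ge0 r w).
move: h1 h2; apply: filterS2 => y h1 h2.
set S := excess r w y +i* conj_fun (excess r w) y.
have hc : cmod ((conj_approx (excess r w) j).[val y] - S) @[j --> \oo] --> (0 : R).
  have n0 (x : nat -> R) l : x j @[j --> \oo] --> l -> `|x j - l| @[j --> \oo] --> (0 : R).
    move=> xl; rewrite -(normr0 R) -(subrr l); apply: cvg_norm.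
    by apply: cvgB => //; exact: cvg_cst.
  apply: cvg0_le (cvg0D (n0 _ _ h1) (n0 _ _ h2)) => j; first exact: cmod_ge0.
  by apply: le_trans (ler_cmod_ReIm _) _; rewrite !raddfB.
apply: (@cvg_le_EFin0 _ _ (fun j => (cmod ((conj_approx (excess r w) j).[val y] - S))%:E)).
- by move=> j; exact: cmod_ge0.
- move=> j; rewrite lee_fin /a /outer -/S; set p := _.[_].
  have p1 : 1 <= cmod (1 + p) by apply: cmod1D_ge1; exact: (conj_approx_Re_ge0 L2_excess (excess_ge0 r w)).
  have S1 : 1 <= cmod (1 + S) by apply: cmod1D_ge1; exact: excess_ge0.
  have n1 : 1 + p != 0 by rewrite -cmod_eq0 gt_eqF// (lt_le_trans ltr01).
  have n2 : 1 + S != 0 by rewrite -cmod_eq0 gt_eqF// (lt_le_trans ltr01).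
  rewrite (_ : _ - _ = (S - p) * ((1 + p)^-1 * (1 + S)^-1)); last by field; rewrite n1 n2.
  rewrite cmodM -cmodN opprB ler_piMr ?cmod_ge0// cmodM !cmodV mulr_ile1 ?invr_ge0 ?cmod_ge0//.
    by rewrite invf_le1// (lt_le_trans ltr01).
  by rewrite invf_le1// (lt_le_trans ltr01).
- by apply: cvg_EFin; [apply: nearW|exact: hc].
Qed.

End Bounds.
End Fiber.

Lemma bint_integrable (R : realType) (X : completeNormedModType R[i]) d
    (T : measurableType d) (P : probability T R) (f : T -> X) :
  bint P f -> P.-integrable setT (fun w => (rnorm (f w))%:E).
Proof.
move=> [mf intf]; apply/integrableP; split; first exact: measurable_rnormE.
by under eq_integral do rewrite abse_EFin ger0_norm ?rnorm_ge0//.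
Qed.

Lemma bochner_cst (R : realType) (X : completeNormedModType R[i]) d
    (T : measurableType d) (P : probability T R) (v : X) :
  bochner_integral P (fun=> v) = v.
Proof.
have h : bochner_integral P (fun=> (1 : R)%:C *: v) = (\int[P]_w (1 : R))%:C *: v.
  by apply: (@bochner_real _ _ _ _ _ _ 1) => // _; rewrite normr1.
rewrite Rintegral_cst_prob scale1r in h.
by rewrite -[RHS]h; congr bochner_integral; apply/funext => w; rewrite scale1r.
Qed.

Lemma quartic_lipschitz (R : realType) (a b : R[i]) : cmod a <= 1 -> cmod b <= 1 ->
  cmod (a ^+ 2 * (2 - a ^+ 2) - b ^+ 2 * (2 - b ^+ 2)) <= cmod (a - b) * 8.
Proof.
move=> a1 b1; rewrite (_ : _ - _ = (a - b) * ((a + b) * (2 - a ^+ 2 - b ^+ 2))); last by ring.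
rewrite cmodM ler_wpM2l ?cmod_ge0// cmodM (_ : 8 = 2 * 4); last by ring.
have a2 : cmod a ^+ 2 <= 1 by rewrite exprn_ile1 ?cmod_ge0.
have b2 : cmod b ^+ 2 <= 1 by rewrite exprn_ile1 ?cmod_ge0.
apply: ler_pM; rewrite ?cmod_ge0//.
  by apply: le_trans (ler_cmodD _ _) _; lra.
apply: le_trans (ler_cmodB _ _) _.
apply: le_trans (lerD (ler_cmodB _ _) (lexx _)) _; rewrite cmod_nat !cmodX; lra.
Qed.

Section AnalyticMultipliers.
Context (R : realType) (X : completeNormedModType R[i]).
Local Notation C := (circle R).
Local Notation m := (@circle_haar R).
Implicit Types f g h : C -> X.

(** The working form of [H1_0] on a fiber, equivalent to it for functions satisfying [bint], and
    stable under the algebra and the limits that build the multiplier. *)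
Definition null_moments h := bint m h /\ forall n, moment h n = 0.

Lemma bint_pow n h : bint m h -> bint m (fun y : C => val y ^+ n *: h y).
Proof.
move=> bh; apply: (bintM (M := 1)) => //; first by apply: cmeasX; exact: cmeas_circle.
by move=> y; rewrite cmodX cmod_circle expr1n.
Qed.

Lemma momentD f g n : bint m f -> bint m g ->
  moment (fun y => f y + g y) n = moment f n + moment g n.
Proof.
move=> bf bg; rewrite /moment -(bochnerD (bint_pow n bf) (bint_pow n bg)).
by congr bochner_integral; apply/funext => y; rewrite scalerDr.
Qed.

Lemma null_momentsB f g : null_moments f -> null_moments g ->
  null_moments (fun y => f y - g y).
Proof.
move=> [bf f0] [bg g0]; split=> [|n]; first exact: bintB.
rewrite /moment -[RHS](subrr 0) -[X in X - _](f0 n) -(g0 n).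
rewrite -(bochnerB (bint_pow n bf) (bint_pow n bg)).
by congr bochner_integral; apply/funext => y; rewrite scalerBr.
Qed.

Lemma null_momentsZ (c : R[i]) h : null_moments h -> null_moments (fun y => c *: h y).
Proof.
move=> [bh h0]; split=> [|n]; first exact: bintZ.
rewrite -(scaler0 _ c) -(h0 n) /moment -(bochnerZ _ (bint_pow n bh)).
by congr bochner_integral; apply/funext => y; rewrite !scalerA mulrC.
Qed.

(** Multiplying [h] by a power of [y] only shifts its moments, so [bochner_inv1D] with mean 0
    applies to [y^n h] and yields the moment of order [n]. *)
Lemma null_moments_inv1D (p : {poly R[i]}) h : null_moments h ->
  (forall y : C, 0 <= complex.Re p.[val y]) -> 0 <= complex.Re p.[0] ->
  null_moments (fun y => (1 + p.[val y])^-1 *: h y).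
Proof.
move=> [bh h0] p0 pz; split=> [|n].
  apply: (bintM (M := 1)) => //.
    apply: cmeasV; apply: cmeasD; first exact: cmeas_cst.
    by apply: cmeas_poly; exact: cmeas_circle.
  by move=> y; rewrite cmodV invf_le1 ?cmod1D_ge1// (lt_le_trans ltr01)// cmod1D_ge1.
have hk k : moment (fun y : C => val y ^+ n *: h y) k = 0.
  rewrite -(h0 (k + n)%N); congr bochner_integral; apply/funext => y.
  by rewrite scalerA exprD.
have := bochner_inv1D (bint_pow n bh) (hk 0) (fun k => hk k.+1) p0 pz.
rewrite scaler0 => <-; congr bochner_integral; apply/funext => y.
by rewrite !scalerA mulrC.
Qed.

Lemma null_moments_quartic (a : C -> R[i]) h :
  (forall g, null_moments g -> null_moments (fun y => a y *: g y)) ->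
  null_moments h -> null_moments (fun y => (a y ^+ 2 * (2 - a y ^+ 2)) *: h y).
Proof.
move=> ha hh.
have h2 := ha _ (ha _ hh); have h4 := ha _ (ha _ h2).
have := null_momentsB (null_momentsZ 2 h2) h4; congr null_moments.
apply/funext => y; rewrite !scalerA -scalerBl; congr (_ *: _); ring.
Qed.

Lemma moment_translate (z : X) h : null_moments h ->
  let f y := z + h y in
  [/\ bint m f, moment f 0 = z & forall n, moment f n.+1 = 0].
Proof.
move=> [bh h0] f; have bz : bint m (fun=> z) by exact: bint_cst.
have zn n : moment (fun=> z) n = (\int[m]_y ycos n y)%:C *: z + (0 +i* 1) *: ((\int[m]_y ysin n y)%:C *: z).
  rewrite -(bochner_real m z (measurable_ycos n) (ycos_le1 n)).
  rewrite -(bochner_real m z (measurable_ysin n) (ysin_le1 n)).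
  have bc := bint_real m z (measurable_ycos n) (ycos_le1 n).
  have bs := bint_real m z (measurable_ysin n) (ysin_le1 n).
  rewrite -(bochnerZ _ bs) -(bochnerD bc (bintZ _ bs)).
  congr bochner_integral; apply/funext => y; rewrite scalerA -scalerDl; congr (_ *: _).
  rewrite /ycos /ysin; case: (_ ^+ n) => u v.
  by apply/eqP; rewrite eq_complex /=; apply/andP; split; apply/eqP; ring.
split; first exact: bintD.
  by rewrite momentD// h0 addr0 moment0 bochner_cst.
move=> n; rewrite momentD// h0 addr0 zn.
by rewrite /ycos integral_Re_pow// /ysin integral_Im_pow// !scale0r scaler0 addr0.
Qed.

Section Fiber.
Variables (r : R) (w : C -> R).
Hypotheses (r0 : 0 < r) (mw : measurable_fun setT w) (w0 : forall y, 0 <= w y)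
  (iw : m.-integrable setT (fun y => (w y)%:E)).

Let L := L2_excess r0 mw w0 iw.
Let e0 := excess_ge0 r w.
Let p j := conj_approx (excess r w) j.

Let p_Re0 j : 0 <= complex.Re (p j).[0].
Proof. by rewrite /p conj_approx0 /= Rintegral_ge0. Qed.

(** The quartic in [1 / (1 + p j)] preserves vanishing moments for each polynomial [p j]; it is
    bounded by 3 and converges to [q] almost everywhere. *)
Lemma null_moments_multiplier h : null_moments h ->
  null_moments (fun y => multiplier r w y *: h y).
Proof.
move=> hh; have [bh h0] := hh.
have mm := cmeas_multiplier r0 mw.
split=> [|n]; first by apply: (bintM (M := 3)) => // y; exact: multiplier_le3.
have bn := bint_pow n bh.
pose a j (y : C) : R[i] := (1 + (p j).[val y])^-1.
have -> : moment (fun y => multiplier r w y *: h y) n =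
    bochner_integral m (fun y : C => multiplier r w y *: (val y ^+ n *: h y)).
  by congr bochner_integral; apply/funext => y; rewrite !scalerA mulrC.
have a1 j y : cmod (a j y) <= 1 by exact: cmod_a.
have ma j : cmeas (a j) by exact: cmeas_a.
apply: (@bochner_cvgM _ _ _ _ m (fun j y => a j y ^+ 2 * (2 - a j y ^+ 2)) _ _ 3 (fun=> 0)).
- move=> j; have ma2 := cmeasX 2 (ma j).
  by apply: cmeasM ma2 (cmeasB (cmeas_cst _ _) ma2).
- exact: mm.
- move=> j y; apply: le_trans (cmod_quartic (a1 j y)) _.
  by rewrite -[leRHS]mulr1 ler_wpM2l// exprn_ile1 ?cmod_ge0.
- by move=> y; exact: multiplier_le3.
- have := cvg_a r0 mw w0 iw; apply: filterS => y ha.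
  apply: cvg0_le (cvg0Mr 8 ha) => j; first exact: cmod_ge0.
  by rewrite /multiplier (gt_eqF r0); exact: quartic_lipschitz (a1 j y) (cmod_outer_le1 _ _ _).
- exact: bn.
- move=> j; have [_ /(_ n) <-] := @null_moments_quartic (a j) h
    (fun g gg => null_moments_inv1D gg (conj_approx_Re_ge0 L e0 j) (p_Re0 j)) hh.
  by congr bochner_integral; apply/funext => y; rewrite !scalerA mulrC.
- exact: cvg_cst.
Qed.

(** Each approximating polynomial has the value [\int s] at the origin, so the approximating
    integrals form a constant sequence. *)
Lemma bochner_outer f z : bint m f -> moment f 0 = z -> (forall n, moment f n.+1 = 0) ->
  bochner_integral m (fun y => outer r w y *: f y) =
  ((1 + \int[m]_y excess r w y)^-1)%:C *: z.
Proof.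
move=> bf f0 fS.
pose a j (y : C) : R[i] := (1 + (p j).[val y])^-1.
apply: (@bochner_cvgM _ _ _ _ m a _ _ 1 (fun=> ((1 + \int[m]_y excess r w y)^-1)%:C *: z)).
- by move=> j; exact: cmeas_a.
- exact: cmeas_outer.
- by move=> j y; exact: cmod_a.
- by move=> y; exact: cmod_outer_le1.
- exact: cvg_a.
- exact: bf.
- move=> j; rewrite (bochner_inv1D bf f0 fS (conj_approx_Re_ge0 L e0 j) (p_Re0 j)).
  by congr (_ *: z); rewrite /p conj_approx0 [RHS]fmorphV rmorphD rmorph1.
- exact: cvg_cst.
Qed.

Let W y := if 9 * r < w y then w y else 0.

(** Above the threshold, [w = 9 r s^2] and [n >= w - r] reduce the claim to
    [2 r s (s - 1) (3 s + 1) >= 0]. The expression vanishes at [s = 1], the value of [s] at the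
    threshold: this ties the constant 9 to the fraction [3^-1]. *)
Lemma excess_tradeoff y (n : R) : 0 <= n -> w y <= n + r ->
  n * (1 + excess r w y)^-1 + (r * excess r w y + 3^-1 * W y) <= n.
Proof.
move=> n0 wn; have sE := excess_sqr r0 w0 y.
move: sE (e0 y); rewrite /W; case: ltP => wr sE; last first.
  move=> _; have -> : excess r w y = 0 by apply/eqP; rewrite -sqrf_eq0 sE mulr0.
  by rewrite addr0 invr1 !mulr0 mulr1 !addr0.
move: (excess r w y) sE => s sE s0.
have r9 : 9 * r != 0 by rewrite mulf_neq0// gt_eqF.
have wE : w y = 9 * r * s ^+ 2 by rewrite sE mulVKf.
have s1 : 1 < s.
  rewrite -(ltr_pXn2r (n := 2)) ?nnegrE// expr1n sE -ltr_pdivrMl ?invr_gt0 ?mulr_gt0//.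
  by rewrite invrK mulr1.
have p0 : 0 < 1 + s by lra.
rewrite -lerBrDr ler_pdivrMr// wE; clear sE r9.
(* The two nonnegative quantities stated here and next add up to the difference of the two sides of
   the goal. *)
have : 0 <= (n + r - 9 * r * s ^+ 2) * s by rewrite mulr_ge0// subr_ge0 -wE.
have : 0 <= r * s * ((s - 1) * (6 * s + 2)) by apply: mulr_ge0; apply: mulr_ge0; rewrite ?(ltW r0)//; lra.
by rewrite -wE; move: (w y) wE wn => wy -> wn; nra.
Qed.

(** Above the threshold [|1 - q| <= 4] suffices. Below it [s = 0], so only the conjugate function
    contributes, and [w <= 9 r]. *)
Lemma multiplier_defect y : cmod (1 - multiplier r w y) * w y <=
  4 * W y + 36 * r * conj_fun (excess r w) y ^+ 2.
Proof.
have [q1 q2] := one_minus_multiplier w y (lt0r_neq0 r0).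
have c0 : 0 <= conj_fun (excess r w) y ^+ 2 by rewrite sqr_ge0.
have wy := w0 y; rewrite (excess_sqr r0 w0 y) -/(W y) in q2.
move: q1 q2 c0; move: (cmod _) (conj_fun _ _ ^+ 2) => q c q1 q2 c0.
rewrite /W in q2 *; case: ltP q2 => wr q2.
  have := ler_wpM2r wy q1; have : 0 <= r * c by rewrite mulr_ge0// ltW.
  by lra.
rewrite mulr0 add0r in q2 *.
have h1 := ler_wpM2r wy q2; apply: le_trans h1 _; rewrite mulr0 add0r.
have := ler_wpM2l c0 wr; lra.
Qed.

Let c := \int[m]_y excess r w y.
Let Wi := \int[m]_y W y.

Let iW : m.-integrable setT (fun y => (W y)%:E).
Proof. exact: integrable_W. Qed.

(** Conjugation does not increase the [L^2] norm and [\int s^2 = Wi / (9 r)], so the conjugate term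
    costs [36 r * Wi / (9 r) = 4 Wi], as much as the other one. *)
Lemma int_defect : \int[m]_y (cmod (1 - multiplier r w y) * w y) <= 8 * Wi /\
  m.-integrable setT (fun y => (cmod (1 - multiplier r w y) * w y)%:E).
Proof.
have [cs [mc ic]] := int_conj_sqr L e0.
have i36 := RintegrableZ (36 * r) ic; have i4 := RintegrableZ 4 iW.
have iD := RintegrableD i4 i36.
have mq : measurable_fun setT (fun y => cmod (1 - multiplier r w y) * w y).
  apply: measurable_funM => //; apply: measurable_cmod.
  by apply: cmeasB; [exact: cmeas_cst|exact: cmeas_multiplier].
have ii : m.-integrable setT (fun y => (cmod (1 - multiplier r w y) * w y)%:E).
  apply: (integrable_le mq iD) => y.
  by rewrite ger0_norm ?mulr_ge0 ?cmod_ge0//; exact: multiplier_defect.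
split=> //; apply: le_trans (le_Rintegral measurableT ii iD (fun y _ => multiplier_defect y)) _.
rewrite (RintegralD measurableT i4 i36) (RintegralZl 4 measurableT iW).
rewrite (RintegralZl (36 * r) measurableT ic).
have e1 : \int[m]_y (excess r w y ^+ 2) = (9 * r)^-1 * Wi.
  by under eq_Rintegral do rewrite (excess_sqr r0 w0); rewrite RintegralZl.
rewrite e1 in cs; have r36 : 0 <= 36 * r by rewrite mulr_ge0// ltW.
have := ler_wpM2l r36 cs; rewrite mulrA (_ : 36 * r * (9 * r)^-1 = 4).
  by rewrite -/Wi (_ : 8 * Wi = 4 * Wi + 4 * Wi) ?lerD2l//; ring.
by field; rewrite gt_eqF.
Qed.

(** Integrating [excess_tradeoff] leaves [r ((1 + c)^-1 + c)] besides [Wi / 3], where [c = \int s].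
    The analytic identity [bochner_outer] produces the term [r / (1 + c)], and
    [(1 + c)^-1 + c >= 1]. *)
Lemma int_translate_ge f z : bint m f -> moment f 0 = z -> (forall n, moment f n.+1 = 0) ->
  r = rnorm z -> (forall y, w y <= rnorm (f y) + r) ->
  r + 3^-1 * Wi <= \int[m]_y rnorm (f y).
Proof.
move=> bf f0 fS rz wf; have fi := bint_integrable bf.
have ms := measurable_excess1 r mw.
have ie := L2_integrable L.
have inv1 y : 0 <= (1 + excess r w y)^-1 <= 1.
  have p1 : 0 < 1 + excess r w y by rewrite ltr_pwDl.
  by rewrite invr_ge0 (ltW p1) invf_le1//= lerDl.
have id : m.-integrable setT (fun y => (rnorm (f y) * (1 + excess r w y)^-1)%:E).
  apply: (integrable_le _ fi).
    apply: measurable_funM; first by apply: measurable_rnorm; case: bf.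
    by apply: (measurableT_comp (@measurable_inv R)); apply: measurable_funD.
  move=> y; have /andP[i0 i1] := inv1 y.
  by rewrite ger0_norm ?mulr_ge0 ?rnorm_ge0// ler_piMr ?rnorm_ge0.
have i1 := RintegrableZ r ie; have i3 := RintegrableZ 3^-1 iW.
have i13 := RintegrableD i1 i3; have iall := RintegrableD id i13.
have h1 := le_Rintegral measurableT iall fi
  (fun y _ => excess_tradeoff (rnorm_ge0 (f y)) (wf y)).
rewrite (RintegralD measurableT id i13) (RintegralD measurableT i1 i3) in h1.
rewrite (RintegralZl r measurableT ie) (RintegralZl 3^-1 measurableT iW) -/c -/Wi in h1.
have bo : bint m (fun y => outer r w y *: f y).
  apply: (bintM (M := 1)) bf; first exact: cmeas_outer.
  by move=> y; exact: cmod_outer_le1.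
have c0 : 0 <= c by apply: Rintegral_ge0.
have h2 : r * (1 + c)^-1 <= \int[m]_y (rnorm (f y) * (1 + excess r w y)^-1).
  have io := bint_integrable bo.
  apply: (@le_trans _ _ (\int[m]_y rnorm (outer r w y *: f y))).
    have := ler_bochner bo; rewrite (bochner_outer bf f0 fS) rnormZ cmod_real -/c -rz.
    rewrite ger0_norm ?invr_ge0 ?addr_ge0// mulrC => h.
    rewrite -lee_fin /Rintegral fineK//; exact: integrable_fin_num.
  apply: le_Rintegral => // y _; rewrite rnormZ mulrC ler_wpM2l ?rnorm_ge0//.
  exact: cmod_outer.
apply: le_trans h1; apply: le_trans (lerD h2 (lexx _)).
rewrite addrA lerD2r -mulrDr ler_peMr ?(ltW r0)//.
have p1 : 0 < 1 + c by lra.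
have e1 : (1 + c)^-1 + c - 1 = c * (1 - (1 + c)^-1) by field; rewrite gt_eqF.
by rewrite -subr_ge0 e1 mulr_ge0// subr_ge0 invf_le1// lerDl.
Qed.

End Fiber.
Lemma fiber_bound (z : X) h (w := fun y : C => rnorm (h y)) : null_moments h ->
  (\int[m]_y (rnorm ((1 - multiplier (rnorm z) w y) *: h y))%:E + (27 * rnorm z)%:E <=
   27%:E * \int[m]_y (rnorm (z + h y))%:E)%E.
Proof.
move=> hh; have [bh _] := hh; have [mh _] := bh.
have [z0|z0] := eqVneq z 0.
  (* At [z = 0] the multiplier is 0, the whole difference goes to the bad part, and the inequality
     compares an integral with 27 times itself. *)
  rewrite z0 rnorm0 mulr0 adde0 /multiplier eqxx.
  rewrite (_ : (fun y => _) = (fun y => (rnorm (h y))%:E)); last first.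
    by apply/funext => y; rewrite subr0 scale1r.
  rewrite (_ : (fun y => (rnorm (0 + _))%:E) = (fun y => (rnorm (h y))%:E)); last first.
    by apply/funext => y; rewrite add0r.
  by apply: lee_pemull; rewrite ?lee_fin ?ler1n//; apply: integral_ge0 => y _; rewrite lee_fin rnorm_ge0.
have r0 : 0 < rnorm z by rewrite lt_def rnorm_eq0 z0 rnorm_ge0.
have mw : measurable_fun setT w by exact: measurable_rnorm.
have w0 y : 0 <= w y by exact: rnorm_ge0.
have iw := bint_integrable bh.
have [bf f0 fS] := moment_translate z hh.
have wf y : w y <= rnorm (z + h y) + rnorm z.
  by rewrite -[leRHS]/(_ + rnorm z) /w -{1}(addKr z (h y)) addrC; exact: ler_rnormB.
have h1 := int_translate_ge r0 mw w0 iw bf f0 fS erefl wf.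
have [h2 i2] := int_defect r0 mw w0 iw.
have eE : (\int[m]_y (rnorm ((1 - multiplier (rnorm z) w y) *: h y))%:E)%E =
    (\int[m]_y (cmod (1 - multiplier (rnorm z) w y) * w y))%:E.
  under eq_integral do rewrite rnormZ.
  by rewrite /Rintegral fineK//; exact: integrable_fin_num.
have eF : (\int[m]_y (rnorm (z + h y))%:E)%E = (\int[m]_y rnorm (z + h y))%:E.
  by rewrite /Rintegral fineK//; exact: integrable_fin_num (bint_integrable bf).
rewrite eE eF -EFinD -EFinM lee_fin.
set I := \int[m]_y (if _ then _ else _) in h1 h2.
have I0 : 0 <= I by apply: Rintegral_ge0 => y _; case: ifP.
(* 27 times the gain [I / 3] is [9 I], which covers the defect of at most [8 I]. *)
lra.
Qed.

End AnalyticMultipliers.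

(** * The martingale transform *)

Section Transform.
Context (R : realType) (X : completeNormedModType R[i]).
Context (P : probability (torusN R) R).
Hypothesis hP : torus_haar P.
Local Notation T := (torusN R).
Local Notation C := (circle R).
Local Notation m := (@circle_haar R).
Local Notation adapted k f := (@smeas R X _ (@subtorus R `I_k) f).

Let u k (p : T * C) : T := replace_coordinate p.1 k p.2.

Let mu k : measurable_fun setT (u k).
Proof. exact: measurable_replaceT. Qed.

Let Pu k (g : T -> \bar R) : measurable_fun setT g -> (forall w, 0 <= g w)%E ->
  (\int[P]_w g w = \int[P]_w \int[m]_y g (u k (w, y)))%E.
Proof. exact: torus_resample. Qed.

Lemma adapted_leq j k (f : T -> X) : (j <= k)%N -> adapted j f -> adapted k f.
Proof. by move=> jk; apply: smeas_sub => i /= ij; exact: leq_trans ij jk. Qed.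

Lemma adapted_smeas k (f : T -> X) : adapted k f -> smeas f.
Proof. by move=> mf; apply: smeas_torus; apply: smeas_sub mf. Qed.

Lemma adapted_replace k (f : T -> X) : adapted k f ->
  forall w y, f (replace_coordinate w k y) = f w.
Proof. by move=> mf; apply: smeas_replace mf => /=; rewrite ltnn. Qed.

Lemma bint_patch (A : set T) (f : T -> X) : measurable A -> bint P f ->
  bint P (patch (fun=> 0) A f).
Proof.
move=> mA bf; rewrite patchE0; apply: (bintM (M := 1)) => //; first exact: cmeas_indic.
by move=> w; rewrite cmod_real indicE; case: (w \in A); rewrite ?normr1 ?normr0.
Qed.

Definition partial_sum (f0 : T -> X) (D : nat -> T -> X) (k : nat) (w : T) : X :=
  f0 w + \sum_(i < k) D i w.

Lemma mdiff_partial_sum f0 D k w : mdiff (partial_sum f0 D) k w = D k w.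
Proof. by rewrite /mdiff /partial_sum big_ord_recr /= addrA [_ + D k w]addrC addrK. Qed.

(** A set measurable with respect to the first [k] coordinates has an indicator that is constant
    along coordinate [k]. The vanishing moment of order zero thus makes the section integrals of
    [D k] over that set zero, which is the martingale property; the other moments give [H1_0]. *)
Lemma hardy_partial_sum f0 D : adapted 0 f0 -> bint P f0 ->
  (forall k, adapted k.+1 (D k)) -> (forall k, bint P (D k)) ->
  (forall k, {ae P, forall w, null_moments (fun y => D k (replace_coordinate w k y))}) ->
  hardy_martingale P (partial_sum f0 D).
Proof.
move=> mf0 bf0 mD bD nD.
have SE k : partial_sum f0 D k.+1 = fun w => partial_sum f0 D k w + D k w.
  by apply/funext => w; rewrite /partial_sum big_ord_recr /= addrA.
have S0 : partial_sum f0 D 0 = f0.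
  by apply/funext => w; rewrite /partial_sum big_ord0 addr0.
have mS k : adapted k (partial_sum f0 D k).
  elim: k => [|k IH]; first by rewrite S0.
  by rewrite SE; apply: smeasD => //; exact: adapted_leq IH.
have bS k : bint P (partial_sum f0 D k).
  by elim: k => [|k IH]; [rewrite S0|rewrite SE; exact: bintD].
split; last first.
  move=> k; have := nD k; apply: filterS => w [bh h0].
  have -> : (fun y => mdiff (partial_sum f0 D) k (replace_coordinate w k y)) =
      (fun y => D k (replace_coordinate w k y)).
    by apply/funext => y; rewrite mdiff_partial_sum.
  exact: H1_0_of_moments.
split; [exact: mS|by move=> k; exact: bint_bochner|].
move=> k A mA; have mA' : measurable (A : set T) by apply: sub_filtration mA.
have -> : patch (fun=> 0) A (partial_sum f0 D k.+1) =
    fun w => patch (fun=> 0) A (partial_sum f0 D k) w + patch (fun=> 0) A (D k) w.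
  by apply/funext => w; rewrite !patchE0 SE scalerDr.
rewrite bochnerD; [|exact: bint_patch|exact: bint_patch].
rewrite (bochner_section0 (mu k) (@Pu k) (bint_patch mA' (bD k))) ?addr0//.
have := nD k; apply: filterS => w [bh h0]; have := h0 0%N; rewrite moment0 => h00.
have Ik : ~ `I_k k by rewrite /= ltnn.
have -> : (fun y => patch (fun=> 0) A (D k) (u k (w, y))) =
    (fun y => (\1_A w)%:C *: D k (replace_coordinate w k y)).
  apply/funext => y; rewrite patchE0 /u /= !indicE.
  suff -> : (replace_coordinate w k y \in A) = (w \in A) by [].
  by apply/idP/idP => /set_mem h; apply/mem_set; move: h; rewrite (filtration_replace Ik mA).
by rewrite bochnerZ// h00 scaler0.
Qed.

Variable F : nat -> T -> X.
Hypothesis hF : hardy_martingale P F.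

(** The fiber through [w] is swept by resampling coordinate [k], and its multiplier is evaluated at
    the actual coordinate [w k]. *)
Definition coefficient k (w : T) : R[i] :=
  multiplier (rnorm (F k w))
    (fun y => rnorm (mdiff F k (replace_coordinate w k y))) (w k).

Let mF k : adapted k (F k).
Proof. by have [[+ _ _] _] := hF; exact. Qed.

Let bF k : bint P (F k).
Proof. by have [[_ + _] _] := hF => /(_ k); apply: bochner_bint; exact: adapted_smeas (mF k). Qed.

Lemma adapted_mdiff k : adapted k.+1 (mdiff F k).
Proof. by apply: smeasB => //; exact: adapted_leq (mF k). Qed.

Let bdF k : bint P (mdiff F k).
Proof. exact: bintB. Qed.

Lemma coefficient_replace k w y : coefficient k (replace_coordinate w k y) =
  multiplier (rnorm (F k w)) (fun y => rnorm (mdiff F k (replace_coordinate w k y))) y.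
Proof.
rewrite /coefficient (adapted_replace (mF k)) replace_same.
by under [X in multiplier _ X]eq_fun do rewrite replace_idem.
Qed.

(** The multiplier is jointly measurable in the fiber and the fiber variable by
    [measurable_conj_param]; the coefficient is its composition with [w] mapped to [(w, w k)],
    measurable for the first [k + 1] coordinates. *)
Lemma cmeas_coefficient k : @cmeas R _ (@subtorus R `I_k.+1) (coefficient k).
Proof.
pose S := @subtorus R `I_k.+1.
pose r (w : S) := rnorm (F k w).
pose v (p : S * C) := rnorm (mdiff F k (replace_coordinate p.1 k p.2)).
have mr : measurable_fun setT r by apply: measurable_rnorm; exact: adapted_leq (mF k).
have mv : measurable_fun setT v.
  apply: measurable_rnorm; apply: (smeas_comp _ (@adapted_mdiff k)).
  exact: measurable_replace.
have mr1 : measurable_fun setT (fun p : S * C => r p.1) by exact: measurableT_comp.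
have me := measurable_excess mr1 mv.
have mc := measurable_conj_param me.
have mk : measurable_fun setT (fun w : S => (w, w k)).
  by apply: measurable_fun_pair => //; apply: measurable_coordinate => /=.
have me' := measurableT_comp me mk; have mc' := measurableT_comp mc mk.
have mo : cmeas (fun w : S => outer (r w) (fun y => v (w, y)) (w k)).
  by apply: cmeasV; apply: cmeasD; [exact: cmeas_cst|split].
have mo2 := cmeasX 2 mo.
apply: (@cmeas_ite _ _ _ (fun w : S => r w == 0)).
- by apply: measurable_fun_eqr => //; exact: measurable_cst.
- exact: cmeas_cst.
- by apply: cmeasM => //; apply: cmeasB => //; exact: cmeas_cst.
Qed.

Lemma cmod_coefficient k w : cmod (coefficient k w) <= 3.
Proof. exact: multiplier_le3. Qed.

Lemma cmeas_subtorus k (c : T -> R[i]) : @cmeas R _ (@subtorus R `I_k) c -> cmeas c.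
Proof. by move=> [mr mi]; split=> _ B mB; apply: (@sub_filtration _ `I_k) => //; [exact: mr|exact: mi]. Qed.

Lemma ae_null_mdiff k :
  {ae P, forall w, null_moments (fun y => mdiff F k (replace_coordinate w k y))}.
Proof.
have [_ /(_ k) h1] := hF.
have h2 := ae_bint_section (mu k) (@Pu k) (bdF k).
move: h1 h2; apply: filterS2 => w h1 h2; split=> // n.
exact: moments_of_H1_0.
Qed.

Lemma ae_null_coefficient k : {ae P, forall w,
  null_moments (fun y => let w' := replace_coordinate w k y in coefficient k w' *: mdiff F k w')}.
Proof.
have := ae_null_mdiff k; apply: filterS => w hw.
rewrite [X in null_moments X](_ : _ = fun y => multiplier (rnorm (F k w))
    (fun y => rnorm (mdiff F k (replace_coordinate w k y))) y *:
    mdiff F k (replace_coordinate w k y)); last first.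
  by apply/funext => y /=; rewrite coefficient_replace.
have [bh _] := hw; have [mh _] := bh.
have [r0|r0] := eqVneq (rnorm (F k w)) 0.
  rewrite /multiplier r0 eqxx; have := null_momentsZ 0 hw; congr null_moments.
apply: null_moments_multiplier => //.
- by rewrite lt_def r0 rnorm_ge0.
- exact: measurable_rnorm.
- by move=> y; exact: rnorm_ge0.
- exact: bint_integrable.
Qed.

Definition good_diff k w : X := coefficient k w *: mdiff F k w.
Definition bad_diff k w : X := (1 - coefficient k w) *: mdiff F k w.

(** The initial value [F 0] is put entirely into the good part, so that the bad part starts at 0. *)
Lemma hardy_good : hardy_martingale P (partial_sum (F 0) good_diff).
Proof.
apply: hardy_partial_sum => //.
- by move=> k; apply: smeasZ; [exact: cmeas_coefficient|exact: adapted_mdiff].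
- move=> k; apply: (bintM (M := 3)) => //; last exact: cmod_coefficient.
  exact: cmeas_subtorus (@cmeas_coefficient k).
- exact: ae_null_coefficient.
Qed.

Lemma badE k w : bad_diff k w = mdiff F k w - good_diff k w.
Proof. by rewrite /bad_diff scalerBl scale1r. Qed.

Lemma bint_bad k : bint P (bad_diff k).
Proof.
apply: (bintM (M := 4)) => //.
  apply: cmeasB; first exact: cmeas_cst.
  exact: cmeas_subtorus (@cmeas_coefficient k).
move=> w; apply: le_trans (ler_cmodB _ _) _; rewrite cmod1.
by have := cmod_coefficient k w; lra.
Qed.

Lemma hardy_bad : hardy_martingale P (partial_sum (fun=> 0) bad_diff).
Proof.
apply: hardy_partial_sum.
- exact: smeas_cst.
- exact: bint_cst.
- move=> k; apply: smeasZ; last exact: adapted_mdiff.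
  by apply: cmeasB; [exact: cmeas_cst|exact: cmeas_coefficient].
- exact: bint_bad.
- move=> k; have h1 := ae_null_mdiff k; have h2 := ae_null_coefficient k.
  move: h1 h2; apply: filterS2 => w h1 h2; have := null_momentsB h1 h2.
  by congr null_moments; apply/funext => y; rewrite badE.
Qed.

Lemma good_bad k w : F k w = partial_sum (F 0) good_diff k w + partial_sum (fun=> 0) bad_diff k w.
Proof.
rewrite /partial_sum add0r -addrA -big_split /=.
under eq_bigr do rewrite badE addrC subrK.
elim: k => [|k IH]; first by rewrite big_ord0 addr0.
by rewrite big_ord_recr /= addrA -IH /mdiff addrC subrK.
Qed.

Lemma rnorm_good k w : rnorm (good_diff k w) <= 27 * rnorm (F k w).
Proof.
rewrite /good_diff rnormZ.
have := multiplier_bound (fun y => rnorm (mdiff F k (replace_coordinate w k y))) (w k) (rnorm_ge0 (F k w)).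
by rewrite replace_self.
Qed.

(** Resampling coordinate [k] turns [F k.+1] into [z + h] with [z = F k w] fixed and [h] the fiber
    of the difference, so [fiber_bound] applies for almost every [w] and is integrated. *)
Lemma int_bad_step k :
  (\int[P]_w (rnorm (bad_diff k w))%:E + 27%:E * \int[P]_w (rnorm (F k w))%:E <=
   27%:E * \int[P]_w (rnorm (F k.+1 w))%:E)%E.
Proof.
have mb := measurable_rnormE (bint_bad k).1.
have mk := measurable_rnormE (bF k).1.
have mS := measurable_rnormE (bF k.+1).1.
have n0 (f : T -> X) w : (0 <= (rnorm (f w))%:E)%E by rewrite lee_fin rnorm_ge0.
have is0 (f : T -> X) w : (0 <= \int[m]_y (rnorm (f (u k (w, y))))%:E)%E by apply: integral_ge0.
have mib := measurable_int_section m (mu k) mb (n0 _).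
have miS := measurable_int_section m (mu k) mS (n0 _).
have m27 : measurable_fun setT (fun w => 27%:E * (rnorm (F k w))%:E)%E.
  by apply: measurable_funeM.
rewrite (Pu k mb (n0 _)) (Pu k mS (n0 _)).
rewrite -(ge0_integralZl _ _ mk)//.
rewrite -(ge0_integralZl _ _ miS)//.
rewrite -ge0_integralD//; last first.
  by move=> w _; rewrite mule_ge0// lee_fin.
apply: ae_ge0_le_integral => //.
- by move=> w _; rewrite adde_ge0// mule_ge0// lee_fin.
- exact: emeasurable_funD.
- by move=> w _; rewrite mule_ge0// lee_fin.
- exact: measurable_funeM.
have := ae_null_mdiff k; apply: filterS => w hw _.
have e1 y : bad_diff k (u k (w, y)) = (1 - multiplier (rnorm (F k w))
    (fun y => rnorm (mdiff F k (replace_coordinate w k y))) y) *: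
    mdiff F k (replace_coordinate w k y) by rewrite /bad_diff coefficient_replace.
have e2 y : F k.+1 (u k (w, y)) = F k w + mdiff F k (replace_coordinate w k y).
  by rewrite /mdiff (adapted_replace (mF k)) addrC subrK.
under eq_integral do rewrite e1.
under [X in (_ <= _ * X)%E]eq_integral do rewrite e2.
exact: fiber_bound.
Qed.

Lemma int_bad_sum :
  (\int[P]_w (\sum_(0 <= k <oo) (rnorm (bad_diff k w))%:E) <=
   27%:E * ereal_sup (range (fun k => \int[P]_w (rnorm (F k w))%:E)))%E.
Proof.
have n0 (f : T -> X) w : (0 <= (rnorm (f w))%:E)%E by rewrite lee_fin rnorm_ge0.
rewrite integral_nneseries//; last by move=> k; exact: measurable_rnormE (bint_bad k).1.
apply: lime_le; first by apply: is_cvg_nneseries => k _ _; apply: integral_ge0.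
apply: nearW => n.
have F0 : (0 <= 27%:E * \int[P]_w (rnorm (F 0 w))%:E)%E.
  by rewrite mule_ge0// ?lee_fin// integral_ge0.
(* Telescoped form of [int_bad_step]; the term in [F 0] is nonnegative and is dropped afterwards. *)
have : (\sum_(0 <= k < n) \int[P]_w (rnorm (bad_diff k w))%:E +
    27%:E * \int[P]_w (rnorm (F 0 w))%:E <= 27%:E * \int[P]_w (rnorm (F n w))%:E)%E.
  elim: n => [|n IH]; first by rewrite big_geq// add0e.
  rewrite big_nat_recr//= addeAC; apply: le_trans (int_bad_step n).
  by rewrite [leRHS]addeC leeD2r.
move=> h; apply: (@le_trans _ _ (27%:E * \int[P]_w (rnorm (F n w))%:E)%E).
  by apply: le_trans h; rewrite leeDl.
by apply: lee_wpmul2l; rewrite ?lee_fin//; apply: ereal_sup_ubound; exists n.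
Qed.

End Transform.

Theorem theorem3p4 (R : realType) :
  exists C : R, 0 < C /\
  forall (X : completeNormedModType R[i]) (P : probability (torusN R) R)
         (F : nat -> torusN R -> X),
  torus_haar P -> hardy_martingale P F ->
  exists G B : nat -> torusN R -> X,
    [/\ hardy_martingale P G,
        hardy_martingale P B,
        forall k, {ae P, forall w, F k w = G k w + B k w},
        forall k, {ae P, forall w, rnorm (mdiff G k w) <= C * rnorm (F k w)} &
        (\int[P]_w (\sum_(0 <= k <oo) (rnorm (mdiff B k w))%:E) <=
         C%:E * ereal_sup (range (fun k => \int[P]_w (rnorm (F k w))%:E)))%E].
Proof.
(* The pointwise bound on the good part fixes the constant 27; the bad part is estimated with the
   same one. *)
exists 27; split=> // X P F hP hF.
exists (partial_sum (F 0) (good_diff F)), (partial_sum (fun=> 0) (bad_diff F)); split.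
- exact: hardy_good.
- exact: hardy_bad.
- by move=> k; apply: nearW => w; exact: good_bad.
- by move=> k; apply: nearW => w; rewrite mdiff_partial_sum; exact: rnorm_good.
- rewrite [X in (X <= _)%E](_ : _ = \int[P]_w (\sum_(0 <= k <oo) (rnorm (bad_diff F k w))%:E))%E.
    exact: int_bad_sum.
  apply: eq_integral => w _; apply: eq_eseriesr => k _.
  by rewrite mdiff_partial_sum.
Qed.
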